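(* Let $\alpha<1$ be a real number and let $f$ be a slice regular function on $\mathbb{B}$ whose zero set is $\{0\}$ and with $f'(0)=1$. Then the following statements are equivalent: (1) $\mathrm{Re}\big(f(q)^{-1}qf'(q)\big)>\alpha$ on $\mathbb{B}\setminus\{0\}$; (2) $\mathrm{Re}\big(f(q)^{-\ast}\ast(qf'(q))\big)>\alpha$ on $\mathbb{B}\setminus\{0\}$; (3) for any $u\in\partial\mathbb{B}$, the function $M(r)=|f(ru)|/r^{\alpha}$ is strictly increasing on $(0,1)$.
   Context: $\mathbb{H}$ denotes the quaternions, $\mathbb{B}=\{q\in\mathbb{H}:|q|<1\}$, $\mathbb{S}=\{q\in\mathbb{H}:q^2=-1\}$; for $I\in\mathbb{S}$, $\mathbb{C}_I=\mathbb{R}\oplus I\mathbb{R}$ and $\mathbb{B}_I=\mathbb{B}\cap\mathbb{C}_I$. A function $f:\mathbb{B}\to\mathbb{H}$ is (left) slice regular if for every $I\in\mathbb{S}$ the restriction $f_I=f|_{\mathbb{B}_I}$ has continuous partial derivatives and $\frac12\left(\frac{\partial}{\partial x}+I\frac{\partial}{\partial y}\right)f_I(x+yI)=0$ on $\mathbb{B}_I$; equivalently $f(q)=\sum_{n\ge0}q^na_n$ on $\mathbb{B}$ with $a_n\in\mathbb{H}$. Its slice derivative is $f'(x+yI)=\frac12\left(\frac{\partial}{\partial x}-I\frac{\partial}{\partial y}\right)f_I(x+yI)$, i.e. $f'(q)=\sum_{n\ge1}q^{n-1}na_n$. For slice regular $f=\sum q^na_n$, $g=\sum q^nb_n$ on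 $\mathbb{B}$: the regular product is $f\ast g(q)=\sum_n q^n\sum_{k=0}^n a_kb_{n-k}$; the regular conjugate is $f^c(q)=\sum q^n\overline{a_n}$; the symmetrization is $f^s=f\ast f^c$; the regular reciprocal is $f^{-\ast}(q)=f^s(q)^{-1}f^c(q)$ off the zero set of $f^s$, and $f^{-\ast}\ast g(q)=f^s(q)^{-1}(f^c\ast g)(q)$ there. (If the zero set of $f$ is $\{0\}$, so is that of $f^s$.) In (2), $f(q)^{-\ast}\ast(qf'(q))$ is the value at $q$ of $f^{-\ast}\ast g$ with $g(q)=qf'(q)$; in (1) the products are pointwise. *)

(* Defs.v *)
From Stdlib Require Import Reals ClassicalEpsilon.
From Coquelicot Require Import Coquelicot.

Open Scope R_scope.

(** * Quaternions *)

Record quat : Type := Quat { re : R; imi : R; imj : R; imk : R }.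

Declare Scope quat_scope.
Delimit Scope quat_scope with H.
Bind Scope quat_scope with quat.

Definition qreal (x : R) : quat := Quat x 0 0 0.

Definition qadd (p q : quat) : quat :=
  Quat (re p + re q) (imi p + imi q) (imj p + imj q) (imk p + imk q).

Definition qopp (q : quat) : quat :=
  Quat (- re q) (- imi q) (- imj q) (- imk q).

Definition qscal (t : R) (q : quat) : quat :=
  Quat (t * re q) (t * imi q) (t * imj q) (t * imk q).

Definition qmul (p q : quat) : quat :=
  Quat (re p * re q - imi p * imi q - imj p * imj q - imk p * imk q)
       (re p * imi q + imi p * re q + imj p * imk q - imk p * imj q)
       (re p * imj q - imi p * imk q + imj p * re q + imk p * imi q)
       (re p * imk q + imi p * imj q - imj p * imi q + imk p * re q).

Definition qconj (q : quat) : quat := Quat (re q) (- imi q) (- imj q) (- imk q).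

Definition qnorm (q : quat) : R :=
  sqrt (re q ^ 2 + imi q ^ 2 + imj q ^ 2 + imk q ^ 2).

Definition qinv (q : quat) : quat := qscal (/ (qnorm q ^ 2)) (qconj q).

Fixpoint qpow (q : quat) (n : nat) : quat :=
  match n with
  | O => qreal 1
  | S m => qmul q (qpow q m)
  end.

Notation "0" := (qreal 0) : quat_scope.
Notation "1" := (qreal 1) : quat_scope.
Notation "p + q" := (qadd p q) : quat_scope.
Notation "- q" := (qopp q) : quat_scope.
Notation "p - q" := (qadd p (qopp q)) : quat_scope.
Notation "p * q" := (qmul p q) : quat_scope.
Notation "/ q" := (qinv q) : quat_scope.
Notation "q ^ n" := (qpow q n) : quat_scope.

(** The open unit ball, its boundary, and the sphere of imaginary units. *)

Definition ball1 (q : quat) : Prop := qnorm q < 1.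
Definition sphere1 (q : quat) : Prop := qnorm q = 1.
Definition imag_unit (I : quat) : Prop := (I * I)%H = qreal (-1).

(** * Calculus of quaternion-valued functions, coordinate by coordinate *)

Definition ex_qderive (g : R -> quat) (t : R) : Prop :=
  ex_derive (fun s => re (g s)) t /\ ex_derive (fun s => imi (g s)) t /\
  ex_derive (fun s => imj (g s)) t /\ ex_derive (fun s => imk (g s)) t.

Definition qDerive (g : R -> quat) (t : R) : quat :=
  Quat (Derive (fun s => re (g s)) t) (Derive (fun s => imi (g s)) t)
       (Derive (fun s => imj (g s)) t) (Derive (fun s => imk (g s)) t).

Definition qcontinuous_2d (G : R -> R -> quat) (x y : R) : Prop :=
  continuity_2d_pt (fun s t => re (G s t)) x y /\
  continuity_2d_pt (fun s t => imi (G s t)) x y /\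
  continuity_2d_pt (fun s t => imj (G s t)) x y /\
  continuity_2d_pt (fun s t => imk (G s t)) x y.

Definition qsum_n (u : nat -> quat) (n : nat) : quat :=
  Quat (sum_n (fun k => re (u k)) n) (sum_n (fun k => imi (u k)) n)
       (sum_n (fun k => imj (u k)) n) (sum_n (fun k => imk (u k)) n).

Definition is_qseries (u : nat -> quat) (l : quat) : Prop :=
  is_series (fun n => re (u n)) (re l) /\ is_series (fun n => imi (u n)) (imi l) /\
  is_series (fun n => imj (u n)) (imj l) /\ is_series (fun n => imk (u n)) (imk l).

Definition qSeries (u : nat -> quat) : quat :=
  Quat (Series (fun n => re (u n))) (Series (fun n => imi (u n)))
       (Series (fun n => imj (u n))) (Series (fun n => imk (u n))).

(** * Slice regular functions

    A function on the unit ball is a total function on [quat] of which only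
    the values on [ball1] are ever used. *)

Definition slice_pt (I : quat) (x y : R) : quat := (qreal x + qscal y I)%H.

Definition partial_x (f : quat -> quat) (I : quat) (x y : R) : quat :=
  qDerive (fun s => f (slice_pt I s y)) x.

Definition partial_y (f : quat -> quat) (I : quat) (x y : R) : quat :=
  qDerive (fun t => f (slice_pt I x t)) y.

Definition slice_regular (f : quat -> quat) : Prop :=
  forall I : quat, imag_unit I ->
  forall x y : R, ball1 (slice_pt I x y) ->
    ex_qderive (fun s => f (slice_pt I s y)) x /\
    ex_qderive (fun t => f (slice_pt I x t)) y /\
    qcontinuous_2d (partial_x f I) x y /\
    qcontinuous_2d (partial_y f I) x y /\
    qscal (1 / 2) (partial_x f I x y + I * partial_y f I x y)%H = 0%H.

(** Every [q] is [re q + im_norm q * im_dir q] with [im_dir q] an imaginary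
    unit.  For real [q] any unit would do: the slice derivative of a slice
    regular function does not depend on it. *)

Definition im_norm (q : quat) : R := sqrt (imi q ^ 2 + imj q ^ 2 + imk q ^ 2).

Definition im_dir (q : quat) : quat :=
  if Req_dec_T (im_norm q) 0 then Quat 0 1 0 0
  else qscal (/ im_norm q) (Quat 0 (imi q) (imj q) (imk q)).

Definition slice_derive (f : quat -> quat) (q : quat) : quat :=
  let I := im_dir q in
  qscal (1 / 2) (partial_x f I (re q) (im_norm q)
                 - I * partial_y f I (re q) (im_norm q))%H.

(** * Regular product, conjugate, symmetrization and quotient *)

Definition has_expansion (f : quat -> quat) (a : nat -> quat) : Prop :=
  forall q : quat, ball1 q -> is_qseries (fun n => q ^ n * a n)%H (f q).

(** The coefficients of the expansion of [f] on the ball; they exist and are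
    unique when [f] is slice regular, and are arbitrary if there is no expansion. *)
Definition coeffs (f : quat -> quat) : nat -> quat :=
  epsilon (inhabits (fun _ : nat => 0%H)) (has_expansion f).

Definition reg_mul (f g : quat -> quat) (q : quat) : quat :=
  qSeries (fun n => q ^ n * qsum_n (fun k => coeffs f k * coeffs g (n - k)%nat) n)%H.

Definition reg_conj (f : quat -> quat) (q : quat) : quat :=
  qSeries (fun n => q ^ n * qconj (coeffs f n))%H.

Definition reg_sym (f : quat -> quat) : quat -> quat := reg_mul f (reg_conj f).

(** The regular product of the regular reciprocal of [f] with [g]; meaningful
    off the zero set of [reg_sym f]. *)
Definition reg_recip_mul (f g : quat -> quat) (q : quat) : quat :=
  (/ reg_sym f q * reg_mul (reg_conj f) g q)%H.

(* Main.v *)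
(* On a slice, f(x + I y) = b + I c with quaternions b, c depending only on z = x + i y, so f is a
   holomorphic function with values in the complexified quaternions, regular products become
   pointwise products there, and f^{-*} * g at x + I y equals f^{-1} g at a rotated point x + J y of
   the same sphere, where I -> J is a bijection; this gives (1) <-> (2).  Since the derivative of
   log |f(ru)| in r is Re (f^{-1} q f') / r at q = ru, (1) implies (3), and (3) implies (1) with
   >= in place of >.  That inequality passes to (2), where Re (f^{-*} * (q f')) restricted to a slice
   is the real part of a holomorphic function with value 1 > alpha at the origin, and Harnack's
   inequality makes it strict. *)

(* Slice regularity is a [C^1] Cauchy-Riemann condition on each slice, while regular products are
   defined through coefficients, so everything rests on one power series expansion valid on all
   slices. It is extracted from scalar holomorphic functions [re (f w) - i re (I f w)]. Cauchy's
   formula, proved with real integrals over the angle, serves twice: for that expansion and, with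
   the squared modulus of the kernel as weight, for Harnack's inequality. The detour through (2) is
   forced: monotonicity yields only a weak inequality, and the pointwise quotient in (1) need not be
   the real part of a holomorphic function on a slice, so no minimum principle applies to it
   directly. Since [J] depends on the point as well as on [I], an inequality passes between (1) and
   (2) only when it is known on all slices at once. The origin, where numerator and denominator of
   the quotient both vanish, is a removable singularity: both stems are divided by [z]. *)
Require Import Defs.
From Stdlib Require Import Reals Lra Lia ClassicalEpsilon.
From Coquelicot Require Import Coquelicot.

Open Scope R_scope.

(* Coquelicot's structures hide [R] behind projections that [ring] does not unfold. *)
Ltac ring_R := match goal with |- @eq _ ?a ?b => change (@eq R a b); ring end.

(** * Continuously differentiable holomorphic functions *)

Lemma continuity_2d_pt_comp (f g h : R -> R -> R) (x y : R) :
  continuity_2d_pt f (g x y) (h x y) ->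
  continuity_2d_pt g x y -> continuity_2d_pt h x y ->
  continuity_2d_pt (fun s t => f (g s t) (h s t)) x y.
Proof.
  intros Hf Hg Hh eps.
  destruct (Hf eps) as [d Hd].
  destruct (Hg d) as [d1 H1]. destruct (Hh d) as [d2 H2].
  assert (Hm : 0 < Rmin d1 d2) by (apply Rmin_pos; apply cond_pos).
  exists (mkposreal _ Hm); simpl; intros u v Hu Hv.
  assert (Rmin d1 d2 <= d1) by apply Rmin_l.
  assert (Rmin d1 d2 <= d2) by apply Rmin_r.
  apply Hd; [apply H1 | apply H2]; lra.
Qed.

Lemma continuity_2d_pt_slice (f : R -> R -> R) (x y : R) :
  continuity_2d_pt f x y -> continuous (fun t => f x t) y.
Proof.
  intros Hf. apply continuity_pt_filterlim.
  intros eps Heps. destruct (Hf (mkposreal _ Heps)) as [d Hd].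
  exists d; split; [apply cond_pos|].
  intros t [_ Ht]. apply Hd.
  - rewrite Rminus_eq_0, Rabs_R0. apply cond_pos.
  - exact Ht.
Qed.

Lemma differentiable_pt_lim_continuity (f : R -> R -> R) (x y lx ly : R) :
  differentiable_pt_lim f x y lx ly -> continuity_2d_pt f x y.
Proof.
  intros H. apply differentiable_continuity_pt. exists lx, ly. exact H.
Qed.

Lemma differentiable_pt_lim_eq (f : R -> R -> R) (x y lx ly lx' ly' : R) :
  differentiable_pt_lim f x y lx ly -> lx = lx' -> ly = ly' ->
  differentiable_pt_lim f x y lx' ly'.
Proof. intros H <- <-. exact H. Qed.

(** An increment is a step in [x] at varying height, controlled by the mean value theorem and the
    continuity of [fx], plus a step in [y] on the fixed line through [x], where a derivative at one
    point suffices; hence the asymmetric hypotheses. *)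
Lemma C1_differentiable_pt_lim (f fx : R -> R -> R) (x y fy : R) :
  locally_2d (fun s t => is_derive (fun z => f z t) s (fx s t)) x y ->
  is_derive (fun t => f x t) y fy -> continuity_2d_pt fx x y ->
  differentiable_pt_lim f x y (fx x y) fy.
Proof.
  intros H1 H2 H3. apply filterdiff_differentiable_pt_lim.
  apply (filterdiff_ext_lin _ (fun u : R * R => plus (scal (fst u) (fx x y)) (scal (snd u) fy))).
  - apply is_derive_filterdiff; [|exact H2|].
    + destruct H1 as [d Hd]. exists d. intros [s t] [Hs Ht].
      apply Hd; [exact Hs | exact Ht].
    + apply continuity_2d_pt_filterlim in H3. exact H3.
  - reflexivity.
Qed.

Lemma differentiable_pt_lim_plus (f g : R -> R -> R) (x y a b c d : R) :
  differentiable_pt_lim f x y a b -> differentiable_pt_lim g x y c d ->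
  differentiable_pt_lim (fun s t => f s t + g s t) x y (a + c) (b + d).
Proof.
  intros Hf Hg.
  eapply differentiable_pt_lim_eq.
  - apply (differentiable_pt_lim_comp (fun s t => s + t) f g x y 1 1); [|exact Hf|exact Hg].
    apply (C1_differentiable_pt_lim _ (fun _ _ => 1)).
    + apply locally_2d_forall. intros s t. auto_derive; auto.
    + auto_derive; auto.
    + apply continuity_2d_pt_const.
  - ring.
  - ring.
Qed.

Lemma differentiable_pt_lim_mult (f g : R -> R -> R) (x y a b c d : R) :
  differentiable_pt_lim f x y a b -> differentiable_pt_lim g x y c d ->
  differentiable_pt_lim (fun s t => f s t * g s t) x y
    (a * g x y + f x y * c) (b * g x y + f x y * d).
Proof.
  intros Hf Hg.
  eapply differentiable_pt_lim_eq.
  - apply (differentiable_pt_lim_comp (fun s t => s * t) f g x y (g x y) (f x y));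
      [|exact Hf|exact Hg].
    apply (C1_differentiable_pt_lim _ (fun _ t => t)).
    + apply locally_2d_forall. intros s t. auto_derive; auto. ring.
    + auto_derive; auto. ring.
    + apply continuity_2d_pt_id2.
  - ring.
  - ring.
Qed.

Lemma differentiable_pt_lim_inv (f : R -> R -> R) (x y a b : R) :
  f x y <> 0 -> differentiable_pt_lim f x y a b ->
  differentiable_pt_lim (fun s t => / f s t) x y
    (- a / f x y ^ 2) (- b / f x y ^ 2).
Proof.
  intros H0 Hf.
  eapply differentiable_pt_lim_eq.
  - apply (differentiable_pt_lim_comp (fun s _ => / s) f (fun _ _ => 0) x y
      (- / f x y ^ 2) 0 a b 0 0); [|exact Hf|].
    + apply differentiable_pt_lim_proj1_0. apply is_derive_Reals.
      auto_derive; auto. field. auto.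
    + apply (C1_differentiable_pt_lim _ (fun _ _ => 0)).
      * apply locally_2d_forall. intros s t. auto_derive; auto.
      * auto_derive; auto.
      * apply continuity_2d_pt_const.
  - field; auto.
  - field; auto.
Qed.

Lemma differentiable_pt_lim_const (c x y : R) :
  differentiable_pt_lim (fun _ _ => c) x y 0 0.
Proof.
  apply (C1_differentiable_pt_lim _ (fun _ _ => 0)).
  - apply locally_2d_forall. intros s t. auto_derive; auto.
  - auto_derive; auto.
  - apply continuity_2d_pt_const.
Qed.

Lemma continuity_2d_pt_cos (x y : R) : continuity_2d_pt (fun _ t => cos t) x y.
Proof.
  apply (continuity_1d_2d_pt_comp cos (fun _ t => t)).
  - apply continuity_cos.
  - apply continuity_2d_pt_id2.
Qed.

Lemma continuity_2d_pt_sin (x y : R) : continuity_2d_pt (fun _ t => sin t) x y.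
Proof.
  apply (continuity_1d_2d_pt_comp sin (fun _ t => t)).
  - apply continuity_sin.
  - apply continuity_2d_pt_id2.
Qed.

Ltac continuity_2d :=
  repeat first [assumption | apply continuity_2d_pt_const | apply continuity_2d_pt_id1
    | apply continuity_2d_pt_id2 | apply continuity_2d_pt_cos | apply continuity_2d_pt_sin
    | apply continuity_2d_pt_minus | apply continuity_2d_pt_plus
    | apply continuity_2d_pt_mult | apply continuity_2d_pt_opp].

(** Real differentiability in the form that the chain rule along a path consumes, with the
    Cauchy-Riemann equations built into [D = F']. Continuity of [D] is what differentiation under
    the integral sign needs. *)
Definition C1_holo (F D : C -> C) : Prop :=
  forall x y : R, Cmod (x, y) < 1 ->
  differentiable_pt_lim (fun s t => fst (F (s, t))) x y (fst (D (x, y))) (- snd (D (x, y))) /\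
  differentiable_pt_lim (fun s t => snd (F (s, t))) x y (snd (D (x, y))) (fst (D (x, y))) /\
  continuity_2d_pt (fun s t => fst (D (s, t))) x y /\
  continuity_2d_pt (fun s t => snd (D (s, t))) x y.

Lemma C1_holo_continuity (F D : C -> C) (x y : R) :
  C1_holo F D -> Cmod (x, y) < 1 ->
  continuity_2d_pt (fun s t => fst (F (s, t))) x y /\
  continuity_2d_pt (fun s t => snd (F (s, t))) x y.
Proof.
  intros H Hz. destruct (H x y Hz) as (H1 & H2 & _).
  split; eapply differentiable_pt_lim_continuity; eassumption.
Qed.

Lemma C1_holo_const (c : C) : C1_holo (fun _ => c) (fun _ => RtoC 0).
Proof.
  intros x y _; simpl; repeat split.
  - eapply differentiable_pt_lim_eq; [apply differentiable_pt_lim_const| |]; simpl; ring.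
  - apply differentiable_pt_lim_const.
  - apply continuity_2d_pt_const.
  - apply continuity_2d_pt_const.
Qed.

Lemma C1_holo_id : C1_holo (fun z => z) (fun _ => RtoC 1).
Proof.
  intros x y _; simpl; repeat split.
  - eapply differentiable_pt_lim_eq;
      [apply (differentiable_pt_lim_proj1_0 (fun u => u) x y 1)| |]; simpl; try ring.
    apply is_derive_Reals. auto_derive; auto.
  - apply (C1_differentiable_pt_lim _ (fun _ _ => 0)).
    + apply locally_2d_forall. intros s t. auto_derive; auto.
    + auto_derive; auto.
    + apply continuity_2d_pt_const.
  - apply continuity_2d_pt_const.
  - apply continuity_2d_pt_const.
Qed.

Lemma C1_holo_plus (F D G E : C -> C) :
  C1_holo F D -> C1_holo G E -> C1_holo (fun z => F z + G z)%C (fun z => D z + E z)%C.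
Proof.
  intros HF HG x y Hz.
  destruct (HF x y Hz) as (F1 & F2 & F3 & F4).
  destruct (HG x y Hz) as (G1 & G2 & G3 & G4).
  simpl; repeat split.
  - eapply differentiable_pt_lim_eq; [apply differentiable_pt_lim_plus; eassumption| |]; ring.
  - eapply differentiable_pt_lim_eq; [apply differentiable_pt_lim_plus; eassumption| |]; ring.
  - apply continuity_2d_pt_plus; assumption.
  - apply continuity_2d_pt_plus; assumption.
Qed.

Lemma C1_holo_mult (F D G E : C -> C) :
  C1_holo F D -> C1_holo G E ->
  C1_holo (fun z => F z * G z)%C (fun z => D z * G z + F z * E z)%C.
Proof.
  intros HF HG x y Hz.
  destruct (HF x y Hz) as (F1 & F2 & F3 & F4).
  destruct (HG x y Hz) as (G1 & G2 & G3 & G4).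
  destruct (C1_holo_continuity F D x y HF Hz) as (F5 & F6).
  destruct (C1_holo_continuity G E x y HG Hz) as (G5 & G6).
  simpl; repeat split.
  - eapply differentiable_pt_lim_eq.
    + apply (differentiable_pt_lim_ext (fun s t => fst (F (s, t)) * fst (G (s, t))
        + (-1) * (snd (F (s, t)) * snd (G (s, t))))).
      * apply locally_2d_forall. intros; simpl; ring.
      * apply differentiable_pt_lim_plus; [apply differentiable_pt_lim_mult; eassumption|].
        apply differentiable_pt_lim_mult; [apply differentiable_pt_lim_const|].
        apply differentiable_pt_lim_mult; eassumption.
    + simpl; ring.
    + simpl; ring.
  - eapply differentiable_pt_lim_eq.
    + apply differentiable_pt_lim_plus; apply differentiable_pt_lim_mult; eassumption.
    + simpl; ring.
    + simpl; ring.
  - continuity_2d.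
  - continuity_2d.
Qed.

Lemma Cmod_sqr (z : C) : Cmod z ^ 2 = fst z ^ 2 + snd z ^ 2.
Proof. exact (Cmod2_alt z). Qed.

Lemma C_neq_0_sqr (z : C) : z <> 0 -> fst z ^ 2 + snd z ^ 2 <> 0.
Proof.
  intros Hz. rewrite <- Cmod_sqr. apply pow_nonzero.
  apply Cmod_gt_0 in Hz. lra.
Qed.

Lemma continuity_2d_pt_sqr (f : R -> R -> R) (x y : R) :
  continuity_2d_pt f x y -> continuity_2d_pt (fun s t => f s t ^ 2) x y.
Proof.
  intros H. apply (continuity_2d_pt_ext (fun s t => f s t * f s t)).
  - intros; ring.
  - apply continuity_2d_pt_mult; exact H.
Qed.

(** Since [1/F = conj F / |F|^2], the real derivative of [1/|F|^2] ([dn]) handles both components.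
    Likewise [- D / F^2] is [- D conj (F^2)] over [|F^2|^2], which [cn] shows to be continuous. *)
Lemma C1_holo_inv (F D : C -> C) :
  C1_holo F D -> (forall z, Cmod z < 1 -> F z <> 0) ->
  C1_holo (fun z => / F z)%C (fun z => - D z / (F z * F z))%C.
Proof.
  intros HF H0 x y Hz.
  destruct (HF x y Hz) as (F1 & F2 & F3 & F4).
  destruct (C1_holo_continuity F D x y HF Hz) as (F5 & F6).
  pose proof (C_neq_0_sqr _ (H0 _ Hz)) as Hn.
  assert (Hm : (F (x, y) * F (x, y))%C <> 0) by (apply Cmult_neq_0; auto).
  assert (Hn2 := C_neq_0_sqr _ Hm).
  assert (dn : differentiable_pt_lim (fun s t => / (fst (F (s, t)) ^ 2 + snd (F (s, t)) ^ 2)) x y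
    (- (2 * fst (F (x, y)) * fst (D (x, y)) + 2 * snd (F (x, y)) * snd (D (x, y)))
       / (fst (F (x, y)) ^ 2 + snd (F (x, y)) ^ 2) ^ 2)
    (- (2 * fst (F (x, y)) * - snd (D (x, y)) + 2 * snd (F (x, y)) * fst (D (x, y)))
       / (fst (F (x, y)) ^ 2 + snd (F (x, y)) ^ 2) ^ 2)).
  { apply (differentiable_pt_lim_inv (fun s t => fst (F (s, t)) ^ 2 + snd (F (s, t)) ^ 2));
      [exact Hn|].
    apply (differentiable_pt_lim_ext
      (fun s t => fst (F (s, t)) * fst (F (s, t)) + snd (F (s, t)) * snd (F (s, t)))).
    - apply locally_2d_forall; intros; ring.
    - eapply differentiable_pt_lim_eq.
      + apply differentiable_pt_lim_plus; apply differentiable_pt_lim_mult; eassumption.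
      + cbv beta; ring.
      + cbv beta; ring. }
  assert (cn : forall p : C -> R, continuity_2d_pt (fun s t => p (s, t)) x y ->
    continuity_2d_pt (fun s t => p (s, t) / (fst (F (s, t) * F (s, t))%C ^ 2
       + snd (F (s, t) * F (s, t))%C ^ 2)) x y).
  { intros p Hp. apply continuity_2d_pt_mult; [exact Hp|].
    apply (continuity_2d_pt_inv (fun s t => fst (F (s, t) * F (s, t))%C ^ 2
       + snd (F (s, t) * F (s, t))%C ^ 2)); [|exact Hn2].
    simpl fst; simpl snd.
    apply continuity_2d_pt_plus; apply continuity_2d_pt_sqr;
    continuity_2d. }
  repeat split.
  - eapply differentiable_pt_lim_eq.
    + apply (differentiable_pt_lim_ext (fun s t => fst (F (s, t)) *
         / (fst (F (s, t)) ^ 2 + snd (F (s, t)) ^ 2))).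
      * apply locally_2d_forall. reflexivity.
      * apply differentiable_pt_lim_mult; eassumption.
    + simpl in *. field. split; intro Hc; [apply Hn2 | apply Hn]; rewrite <- Hc; ring.
    + simpl in *. field. split; intro Hc; [apply Hn2 | apply Hn]; rewrite <- Hc; ring.
  - eapply differentiable_pt_lim_eq.
    + apply (differentiable_pt_lim_ext (fun s t => ((-1) * snd (F (s, t))) *
         / (fst (F (s, t)) ^ 2 + snd (F (s, t)) ^ 2))).
      * apply locally_2d_forall. intros; simpl. unfold Rdiv. ring.
      * apply differentiable_pt_lim_mult; [|eassumption].
        apply differentiable_pt_lim_mult; [apply differentiable_pt_lim_const|eassumption].
    + simpl in *. field. split; intro Hc; [apply Hn2 | apply Hn]; rewrite <- Hc; ring.
    + simpl in *. field. split; intro Hc; [apply Hn2 | apply Hn]; rewrite <- Hc; ring.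
  - apply (continuity_2d_pt_ext (fun s t =>
      fst (- D (s, t) * Cconj (F (s, t) * F (s, t)))%C / (fst (F (s, t) * F (s, t))%C ^ 2
       + snd (F (s, t) * F (s, t))%C ^ 2))).
    + intros; simpl; unfold Rdiv; ring.
    + apply (cn (fun z => fst (- D z * Cconj (F z * F z))%C)). simpl.
      continuity_2d.
  - apply (continuity_2d_pt_ext (fun s t =>
      snd (- D (s, t) * Cconj (F (s, t) * F (s, t)))%C / (fst (F (s, t) * F (s, t))%C ^ 2
       + snd (F (s, t) * F (s, t))%C ^ 2))).
    + intros; simpl; unfold Rdiv; ring.
    + apply (cn (fun z => snd (- D z * Cconj (F z * F z))%C)). simpl.
      continuity_2d.
Qed.

(** * Cauchy's formula and Harnack's inequality *)

Definition circ (r th : R) : C := (r * cos th, r * sin th).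

Lemma Cmod_circ (r th : R) : 0 <= r -> Cmod (circ r th) = r.
Proof.
  intros Hr. unfold Cmod, circ; simpl.
  replace (r * cos th * (r * cos th * 1) + r * sin th * (r * sin th * 1))
    with (r ^ 2 * (Rsqr (sin th) + Rsqr (cos th))) by (unfold Rsqr; ring).
  rewrite sin2_cos2, Rmult_1_r, sqrt_pow2; auto.
Qed.

(** The modulus is at most [(|1 - t| + |t|) r <= (2 - r) r = 1 - (1 - r)^2]. The range of [t]
    overshoots [[0, 1]] on both sides so that two-sided derivatives exist at the end points. *)
Lemma homotopy_in_disc (w : C) (r t th : R) :
  Cmod w < r -> r < 1 -> - ((1 - r) / 2) < t < 1 + (1 - r) / 2 ->
  Cmod (fst w + t * (r * cos th - fst w), snd w + t * (r * sin th - snd w)) < 1.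
Proof.
  intros Hw Hr Ht. pose proof (Cmod_ge_0 w) as Hw0.
  replace (fst w + t * (r * cos th - fst w), snd w + t * (r * sin th - snd w))
    with (RtoC (1 - t) * w + RtoC t * circ r th)%C
    by (apply injective_projections; simpl; ring).
  eapply Rle_lt_trans; [apply Cmod_triangle|].
  rewrite !Cmod_mult, !Cmod_R, Cmod_circ by lra.
  assert (Rabs (1 - t) * Cmod w + Rabs t * r <= (1 + (1 - r)) * r).
  { unfold Rabs; destruct (Rcase_abs (1 - t)); destruct (Rcase_abs t); nra. }
  nra.
Qed.

Lemma is_derive_mult_const (f : R -> R) (t l c : R) :
  is_derive f t l -> is_derive (fun s => f s * c) t (l * c).
Proof.
  intros H. apply (is_derive_ext (fun s => c * f s)); [intros; apply Rmult_comm|].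
  rewrite Rmult_comm. apply is_derive_scal. exact H.
Qed.

(* The integral of [F (w + t (circ r th - w)) k th] does not depend on [t]: its [t]-derivative
   is [1/t] times the integral of a [th]-derivative. *)
Lemma cauchy_homotopy (F D : C -> C) (w : C) (r : R) (k : R -> C) :
  C1_holo F D -> Cmod w < r -> r < 1 ->
  (forall th, ((circ r th - w) * k th)%C = circ r th) ->
  (forall th, continuity_pt (fun s => fst (k s)) th) ->
  (forall th, continuity_pt (fun s => snd (k s)) th) ->
  RInt (fun th => fst (F (circ r th) * k th)%C) 0 (2 * PI)
  = RInt (fun th => fst (F w * k th)%C) 0 (2 * PI).
Proof.
  intros HF Hw Hr Hk Ck1 Ck2.
  set (X := fun t th => fst w + t * (r * cos th - fst w)).
  set (Y := fun t th => snd w + t * (r * sin th - snd w)).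
  set (phi := fun t th => fst (F (X t th, Y t th) * k th)%C).
  set (psi := fun t th => r * (fst (D (X t th, Y t th)) * cos th - snd (D (X t th, Y t th)) * sin th)).
  assert (Hin : forall t th, - ((1 - r) / 2) < t < 1 + (1 - r) / 2 ->
    Cmod (X t th, Y t th) < 1) by (intros; apply homotopy_in_disc; assumption).
  assert (CX : forall t th, continuity_2d_pt X t th) by (intros; unfold X; continuity_2d).
  assert (CY : forall t th, continuity_2d_pt Y t th) by (intros; unfold Y; continuity_2d).
  assert (Hphi : forall t th, - ((1 - r) / 2) < t < 1 + (1 - r) / 2 ->
    is_derive (fun s => phi s th) t (psi t th)).
  { intros t th Ht. destruct (HF _ _ (Hin t th Ht)) as (F1 & F2 & _ & _).
    assert (dX : derivable_pt_lim (fun s => X s th) t (r * cos th - fst w)).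
    { apply is_derive_Reals. unfold X. auto_derive; auto. ring. }
    assert (dY : derivable_pt_lim (fun s => Y s th) t (r * sin th - snd w)).
    { apply is_derive_Reals. unfold Y. auto_derive; auto. ring. }
    pose proof (derivable_pt_lim_comp_2d _ (fun s => X s th) (fun s => Y s th) _ _ _ _ _ F1 dX dY) as E1.
    pose proof (derivable_pt_lim_comp_2d _ (fun s => X s th) (fun s => Y s th) _ _ _ _ _ F2 dX dY) as E2.
    apply is_derive_Reals in E1. apply is_derive_Reals in E2.
    pose proof (f_equal fst (Hk th)) as K1. pose proof (f_equal snd (Hk th)) as K2.
    simpl in K1, K2. unfold phi; simpl.
    evar_last.
    - apply (is_derive_minus (fun s => fst (F (X s th, Y s th)) * fst (k th))
        (fun s => snd (F (X s th, Y s th)) * snd (k th))).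
      + apply is_derive_mult_const. exact E1.
      + apply is_derive_mult_const. exact E2.
    - unfold minus, plus, opp, scal, psi; simpl; unfold mult; simpl.
      (* The hypothesis on [k] turns [(circ r th - w) * k th] into [circ r th], so the kernel
         disappears from the [t]-derivative. *)
      transitivity
        (fst (D (X t th, Y t th)) * ((r * cos th + - fst w) * fst (k th)
            - (r * sin th + - snd w) * snd (k th))
         - snd (D (X t th, Y t th)) * ((r * cos th + - fst w) * snd (k th)
            + (r * sin th + - snd w) * fst (k th))); [ring|].
      rewrite K1, K2. ring. }
  assert (Cpsi : forall t th, - ((1 - r) / 2) < t < 1 + (1 - r) / 2 ->
    continuity_2d_pt psi t th).
  { intros t th Ht. destruct (HF _ _ (Hin t th Ht)) as (_ & _ & F3 & F4).
    pose proof (continuity_2d_pt_comp _ X Y t th F3 (CX t th) (CY t th)).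
    pose proof (continuity_2d_pt_comp _ X Y t th F4 (CX t th) (CY t th)).
    unfold psi. continuity_2d. }
  assert (Cphi : forall t th, - ((1 - r) / 2) < t < 1 + (1 - r) / 2 ->
    continuity_2d_pt phi t th).
  { intros t th Ht. destruct (C1_holo_continuity _ _ _ _ HF (Hin t th Ht)) as (F3 & F4).
    pose proof (continuity_2d_pt_comp _ X Y t th F3 (CX t th) (CY t th)).
    pose proof (continuity_2d_pt_comp _ X Y t th F4 (CX t th) (CY t th)).
    pose proof (continuity_1d_2d_pt_comp (fun s => fst (k s)) (fun _ s => s) t th (Ck1 th)
      (continuity_2d_pt_id2 _ _)).
    pose proof (continuity_1d_2d_pt_comp (fun s => snd (k s)) (fun _ s => s) t th (Ck2 th)
      (continuity_2d_pt_id2 _ _)).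
    unfold phi; simpl. continuity_2d. }
  assert (Hloc : forall t, 0 <= t <= 1 -> exists d : posreal, forall s, Rabs (s - t) < d ->
    - ((1 - r) / 2) < s < 1 + (1 - r) / 2).
  { intros t Ht. assert (H0 : 0 < (1 - r) / 2) by lra.
    exists (mkposreal _ H0). simpl. intros s Hs.
    apply Rabs_def2 in Hs. lra. }
  assert (HI : forall t, 0 <= t <= 1 ->
    is_derive (fun s => RInt (phi s) 0 (2 * PI)) t (RInt (psi t) 0 (2 * PI))).
  { intros t Ht. destruct (Hloc t Ht) as [d Hd].
    replace (RInt (psi t) 0 (2 * PI))
      with (RInt (fun th => Derive (fun u => phi u th) t) 0 (2 * PI)).
    - apply (is_derive_RInt_param phi).
      + exists d. intros s Hs th _. exists (psi s th). apply Hphi. apply Hd, Hs.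
      + intros th _. apply (continuity_2d_pt_ext_loc psi).
        * exists d. intros s v Hs _. symmetry. apply is_derive_unique, Hphi, Hd, Hs.
        * apply Cpsi. lra.
      + exists d. intros s Hs. apply (ex_RInt_continuous (phi s)). intros th _.
        apply continuity_2d_pt_slice, Cphi, Hd, Hs.
    - apply RInt_ext. intros th _. apply is_derive_unique, Hphi. lra. }
  (* [t * psi t th] is the [th]-derivative of the imaginary part of [F] along the circle of
     parameter [t], a closed curve. *)
  assert (HI0 : forall t, 0 <= t <= 1 -> t * RInt (psi t) 0 (2 * PI) = 0).
  { intros t Ht.
    assert (E : is_RInt (fun th => scal t (psi t th)) 0 (2 * PI)
      (minus (snd (F (X t (2 * PI), Y t (2 * PI)))) (snd (F (X t 0, Y t 0))))).
    { apply (is_RInt_derive (fun th => snd (F (X t th, Y t th)))).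
      - intros th _. assert (Ht' : - ((1 - r) / 2) < t < 1 + (1 - r) / 2) by lra.
        destruct (HF _ _ (Hin t th Ht')) as (_ & F2 & _ & _).
        assert (dX : derivable_pt_lim (fun s => X t s) th (- t * r * sin th)).
        { apply is_derive_Reals. unfold X. auto_derive; auto. ring. }
        assert (dY : derivable_pt_lim (fun s => Y t s) th (t * r * cos th)).
        { apply is_derive_Reals. unfold Y. auto_derive; auto. ring. }
        pose proof (derivable_pt_lim_comp_2d _ (X t) (Y t) _ _ _ _ _ F2 dX dY) as E2.
        apply is_derive_Reals in E2. evar_last; [exact E2|].
        unfold psi, scal; simpl; unfold mult; simpl. ring.
      - intros th _. apply (continuous_scal_r t (psi t)).
        apply continuity_2d_pt_slice, Cpsi. lra. }
    apply (is_RInt_unique (V := R_CompleteNormedModule)) in E.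
    rewrite (RInt_scal (V := R_CompleteNormedModule)) in E.
    - unfold X, Y in E. rewrite cos_2PI, sin_2PI, cos_0, sin_0 in E.
      rewrite (minus_eq_zero (G := R_AbelianGroup)) in E. exact E.
    - apply (ex_RInt_continuous (V := R_CompleteNormedModule)). intros th _. apply continuity_2d_pt_slice, Cpsi. lra. }
  (* At [t = 0] the identity [HI0] says nothing about the integral of [psi]; the mean value theorem
     asks for the derivative on the open interval only. *)
  destruct (MVT_gen (fun s => RInt (phi s) 0 (2 * PI)) 0 1 (fun _ => 0)) as [c [_ Hc]].
  - rewrite Rmin_left, Rmax_right by lra. intros t Ht.
    evar_last; [apply HI; lra|].
    apply (Rmult_eq_reg_l t); [|lra]. rewrite HI0; lra.
  - rewrite Rmin_left, Rmax_right by lra. intros t Ht.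
    apply continuity_pt_filterlim. apply (ex_derive_continuous (fun s => RInt (phi s) 0 (2 * PI))).
    eexists. apply HI, Ht.
  - transitivity (RInt (phi 1) 0 (2 * PI)).
    + apply RInt_ext. intros th _. unfold phi.
      replace (X 1 th, Y 1 th) with (circ r th); [reflexivity|].
      unfold X, Y, circ. f_equal; ring.
    + transitivity (RInt (phi 0) 0 (2 * PI)); [lra|].
      apply RInt_ext. intros th _. unfold phi.
      replace (X 0 th, Y 0 th) with w; [reflexivity|].
      apply injective_projections; unfold X, Y; simpl; ring.
Qed.

(** * Integrals of complex paths over one full turn *)

Definition cont_path (g : R -> C) : Prop :=
  forall t, continuity_pt (fun s => fst (g s)) t /\ continuity_pt (fun s => snd (g s)) t.

Definition CInt (g : R -> C) : C :=
  (RInt (fun t => fst (g t)) 0 (2 * PI), RInt (fun t => snd (g t)) 0 (2 * PI)).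

Lemma cont_path_const (c : C) : cont_path (fun _ => c).
Proof. intros t; split; apply continuity_pt_const; intros u v; reflexivity. Qed.

Lemma cont_path_plus (g h : R -> C) :
  cont_path g -> cont_path h -> cont_path (fun t => g t + h t)%C.
Proof.
  intros Hg Hh t. destruct (Hg t), (Hh t).
  split; simpl; apply (continuity_pt_plus (fun s => _ (g s)) (fun s => _ (h s))); assumption.
Qed.

Lemma cont_path_mult (g h : R -> C) :
  cont_path g -> cont_path h -> cont_path (fun t => g t * h t)%C.
Proof.
  intros Hg Hh t. destruct (Hg t), (Hh t). split; simpl.
  - apply (continuity_pt_minus (fun s => fst (g s) * fst (h s)) (fun s => snd (g s) * snd (h s)));
      apply (continuity_pt_mult (fun s => _ (g s)) (fun s => _ (h s))); assumption.
  - apply (continuity_pt_plus (fun s => fst (g s) * snd (h s)) (fun s => snd (g s) * fst (h s)));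
      apply (continuity_pt_mult (fun s => _ (g s)) (fun s => _ (h s))); assumption.
Qed.

Lemma cont_path_inv (g : R -> C) :
  cont_path g -> (forall t, g t <> 0) -> cont_path (fun t => / g t)%C.
Proof.
  intros Hg H0 t. destruct (Hg t) as [G1 G2].
  pose proof (C_neq_0_sqr _ (H0 t)) as Hn.
  assert (Hd : continuity_pt (fun s => fst (g s) ^ 2 + snd (g s) ^ 2) t).
  { apply (continuity_pt_plus (fun s => fst (g s) ^ 2) (fun s => snd (g s) ^ 2)).
    - apply (continuity_pt_comp (fun s => fst (g s)) (fun x => x ^ 2)); [assumption|].
      apply derivable_continuous_pt, derivable_pt_pow.
    - apply (continuity_pt_comp (fun s => snd (g s)) (fun x => x ^ 2)); [assumption|].
      apply derivable_continuous_pt, derivable_pt_pow. }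
  split; simpl.
  - apply (continuity_pt_div (fun s => fst (g s))); assumption.
  - apply (continuity_pt_div (fun s => - snd (g s))); [|assumption|assumption].
    apply continuity_pt_opp. assumption.
Qed.

Lemma cont_path_pow (g : R -> C) (n : nat) :
  cont_path g -> cont_path (fun t => g t ^ n)%C.
Proof.
  intros Hg. induction n as [|n IH].
  - apply (cont_path_const (RtoC 1)).
  - apply (cont_path_mult g (fun t => g t ^ n)%C); assumption.
Qed.

Lemma cont_path_circ (r : R) : cont_path (circ r).
Proof.
  intros t. split; simpl.
  - apply (continuity_pt_mult (fun _ => r) cos); [|apply continuity_cos].
    apply continuity_pt_const; intros u v; reflexivity.
  - apply (continuity_pt_mult (fun _ => r) sin); [|apply continuity_sin].
    apply continuity_pt_const; intros u v; reflexivity.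
Qed.

Lemma cont_path_holo_circ (F D : C -> C) (r : R) :
  C1_holo F D -> 0 <= r -> r < 1 -> cont_path (fun t => F (circ r t)).
Proof.
  intros HF Hr Hr1 t.
  assert (Hin : Cmod (r * cos t, r * sin t) < 1) by (change (Cmod (circ r t) < 1);
    rewrite Cmod_circ; assumption).
  destruct (C1_holo_continuity F D _ _ HF Hin) as [F1 F2].
  assert (CX : continuity_2d_pt (fun _ s => r * cos s) 0 t) by continuity_2d.
  assert (CY : continuity_2d_pt (fun _ s => r * sin s) 0 t) by continuity_2d.
  split; apply continuity_pt_filterlim.
  - exact (continuity_2d_pt_slice _ 0 t (continuity_2d_pt_comp _ _ _ 0 t F1 CX CY)).
  - exact (continuity_2d_pt_slice _ 0 t (continuity_2d_pt_comp _ _ _ 0 t F2 CX CY)).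
Qed.

Lemma ex_RInt_continuity (f : R -> R) (a b : R) :
  (forall t, continuity_pt f t) -> ex_RInt f a b.
Proof.
  intros H. apply (ex_RInt_continuous (V := R_CompleteNormedModule)).
  intros t _. apply continuity_pt_filterlim, H.
Qed.

Lemma cont_path_ex_RInt (g : R -> C) (a b : R) :
  cont_path g -> ex_RInt (fun t => fst (g t)) a b /\ ex_RInt (fun t => snd (g t)) a b.
Proof. intros H; split; apply ex_RInt_continuity; apply H. Qed.

Lemma CInt_ext (g h : R -> C) : (forall t, g t = h t) -> CInt g = CInt h.
Proof.
  intros H. unfold CInt. f_equal; apply RInt_ext; intros t _; rewrite H; reflexivity.
Qed.

Lemma CInt_plus (g h : R -> C) :
  cont_path g -> cont_path h -> CInt (fun t => g t + h t)%C = (CInt g + CInt h)%C.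
Proof.
  intros Hg Hh.
  destruct (cont_path_ex_RInt g 0 (2 * PI) Hg), (cont_path_ex_RInt h 0 (2 * PI) Hh).
  unfold CInt; simpl. unfold Cplus; simpl. f_equal;
  apply (RInt_plus (V := R_CompleteNormedModule) (fun t => _ (g t)) (fun t => _ (h t))); assumption.
Qed.

Lemma CInt_scal (c : C) (g : R -> C) :
  cont_path g -> CInt (fun t => c * g t)%C = (c * CInt g)%C.
Proof.
  intros Hg. destruct (cont_path_ex_RInt g 0 (2 * PI) Hg) as [E1 E2].
  unfold CInt; simpl. unfold Cmult; simpl. f_equal.
  - apply is_RInt_unique.
    apply (is_RInt_minus (V := R_NormedModule) (fun t => fst c * fst (g t)) (fun t => snd c * snd (g t)));
      apply (is_RInt_scal (V := R_NormedModule)); apply (RInt_correct (V := R_CompleteNormedModule)); assumption.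
  - apply is_RInt_unique.
    apply (is_RInt_plus (V := R_NormedModule) (fun t => fst c * snd (g t)) (fun t => snd c * fst (g t)));
      apply (is_RInt_scal (V := R_NormedModule)); apply (RInt_correct (V := R_CompleteNormedModule)); assumption.
Qed.

Lemma CInt_const (c : C) : CInt (fun _ => c) = (RtoC (2 * PI) * c)%C.
Proof.
  unfold CInt. rewrite !RInt_const. unfold scal; simpl; unfold mult; simpl.
  apply injective_projections; simpl; ring.
Qed.

Lemma circ_minus_neq_0 (w : C) (r th : R) : Cmod w < r -> (circ r th - w)%C <> 0.
Proof.
  intros Hw Hc. apply Ceq_minus in Hc.
  assert (Hr : 0 <= r) by (pose proof (Cmod_ge_0 w); lra).
  rewrite <- Hc, Cmod_circ in Hw; lra.
Qed.

Lemma circ_neq_0 (r th : R) : 0 < r -> circ r th <> 0.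
Proof.
  intros Hr Hc. pose proof (Cmod_circ r th (Rlt_le _ _ Hr)) as H.
  rewrite Hc, Cmod_0 in H. lra.
Qed.

(** The Cauchy kernel [dzeta / (zeta - w)] in the angle [th]: there [dzeta = i zeta dth], and the
    factor [i] is dropped. *)
Definition ckernel (r : R) (w : C) (th : R) : C := (circ r th / (circ r th - w))%C.

Lemma cont_path_ckernel (r : R) (w : C) : Cmod w < r -> cont_path (ckernel r w).
Proof.
  intros Hw. apply (cont_path_mult (circ r) (fun t => / (circ r t - w))%C).
  - apply cont_path_circ.
  - apply (cont_path_inv (fun t => circ r t - w)%C).
    + apply (cont_path_plus (circ r) (fun _ => - w)%C).
      * apply cont_path_circ.
      * apply cont_path_const.
    + intros t. apply circ_minus_neq_0, Hw.
Qed.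

Lemma cauchy_ckernel (F D : C -> C) (w : C) (r : R) :
  C1_holo F D -> Cmod w < r -> r < 1 ->
  CInt (fun th => F (circ r th) * ckernel r w th)%C = (F w * CInt (ckernel r w))%C.
Proof.
  intros HF Hw Hr.
  pose proof (cont_path_ckernel r w Hw) as Ck.
  assert (Hk : forall th, ((circ r th - w) * ckernel r w th)%C = circ r th).
  { intros th. unfold ckernel. field. apply circ_minus_neq_0, Hw. }
  rewrite <- CInt_scal by assumption.
  unfold CInt. f_equal.
  - apply (cauchy_homotopy F D w r); auto; apply Ck.
  (* The real part of the formula for [- i F] is the imaginary part of the formula for [F]. *)
  - pose proof (cauchy_homotopy _ _ w r (ckernel r w)
      (C1_holo_mult _ _ _ _ (C1_holo_const (- Ci)%C) HF) Hw Hr Hk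
      (fun t => proj1 (Ck t)) (fun t => proj2 (Ck t))) as H.
    transitivity (RInt (fun th => fst (- Ci * F (circ r th) * ckernel r w th)%C) 0 (2 * PI)).
    + apply RInt_ext. intros t _. simpl. ring.
    + rewrite H. apply RInt_ext. intros t _. simpl. ring.
Qed.

Lemma mean_value (F D : C -> C) (r : R) :
  C1_holo F D -> 0 < r -> r < 1 ->
  CInt (fun th => F (circ r th)) = (RtoC (2 * PI) * F (RtoC 0))%C.
Proof.
  intros HF Hr Hr1.
  assert (H0 : Cmod (RtoC 0) < r) by (rewrite Cmod_0; exact Hr).
  assert (H1 : forall th, ckernel r (RtoC 0) th = RtoC 1).
  { intros th. unfold ckernel.
    pose proof (circ_minus_neq_0 _ _ th H0). pose proof (circ_neq_0 r th Hr). field. auto. }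
  pose proof (cauchy_ckernel F D (RtoC 0) r HF H0 Hr1) as H.
  rewrite (CInt_ext _ _ H1), CInt_const in H.
  rewrite (CInt_ext _ (fun th => F (circ r th) * ckernel r (RtoC 0) th)%C).
  - rewrite H. ring.
  - intros t. rewrite H1. ring.
Qed.

(** On the circle [r^2 = zeta conj zeta], so the conjugate kernel equals
    [r^2 / (r^2 - conj w zeta)]: it is the restriction of a function holomorphic in [zeta]. *)
Lemma ckernel_conj (r : R) (w : C) (th : R) : Cmod w < r ->
  (Cconj (ckernel r w th) * (RtoC (r ^ 2) - Cconj w * circ r th))%C = RtoC (r ^ 2).
Proof.
  intros Hw. pose proof (circ_minus_neq_0 _ _ th Hw) as H0.
  pose proof (Cmod_ge_0 w). pose proof (circ_neq_0 r th ltac:(lra)) as H1.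
  assert (E : (RtoC (r ^ 2) = circ r th * Cconj (circ r th))%C).
  { rewrite <- Cmod2_conj, Cmod_circ by lra. reflexivity. }
  unfold ckernel. rewrite Cdiv_conj by exact H0. rewrite Cminus_conj, E.
  assert (Cconj (circ r th) - Cconj w <> 0)%C.
  { rewrite <- Cminus_conj. intros Hc. apply H0. rewrite <- (Cconj_conj (circ r th - w)), Hc.
    unfold Cconj; simpl. apply injective_projections; simpl; ring. }
  field. assumption.
Qed.

(** The pole [r^2 / conj w] has to lie outside the whole unit disc, the domain of [C1_holo], and not
    merely outside the circle of radius [r]. This is why [w] is restricted to [Cmod w < r ^ 2] from
    here on. *)
Lemma poisson_denominator_neq_0 (r : R) (w z : C) :
  Cmod w < r ^ 2 -> Cmod z < 1 -> (RtoC (r ^ 2) - Cconj w * z)%C <> 0.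
Proof.
  intros Hw Hz Hc. apply Ceq_minus in Hc.
  assert (E : Cmod (RtoC (r ^ 2)) = Cmod (Cconj w * z)%C) by (rewrite Hc; reflexivity).
  rewrite Cmod_mult, Cmod_conj, Cmod_R, Rabs_right in E by nra.
  pose proof (Cmod_ge_0 w). pose proof (Cmod_ge_0 z). nra.
Qed.

Lemma C1_holo_poisson (r : R) (w : C) : Cmod w < r ^ 2 ->
  exists D, C1_holo (fun z => / (RtoC (r ^ 2) + - Cconj w * z))%C D.
Proof.
  intros Hw. eexists. apply C1_holo_inv.
  - eapply (C1_holo_plus (fun _ => RtoC (r ^ 2)) _ (fun z => - Cconj w * z)%C).
    + apply C1_holo_const.
    + eapply (C1_holo_mult (fun _ => - Cconj w)%C _ (fun z => z));
        [apply C1_holo_const|apply C1_holo_id].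
  - intros z Hz. pose proof (poisson_denominator_neq_0 r w z Hw Hz) as H.
    replace (RtoC (r ^ 2) + - Cconj w * z)%C with (RtoC (r ^ 2) - Cconj w * z)%C by ring.
    exact H.
Qed.

Lemma ckernel_conj_inv (r : R) (w : C) (th : R) : 0 < r -> r < 1 -> Cmod w < r ^ 2 ->
  (RtoC (r ^ 2) * / (RtoC (r ^ 2) + - Cconj w * circ r th))%C = Cconj (ckernel r w th).
Proof.
  intros Hr Hr1 Hw.
  assert (H : (RtoC (r ^ 2) - Cconj w * circ r th)%C <> 0).
  { apply poisson_denominator_neq_0; [exact Hw|]. rewrite Cmod_circ; lra. }
  pose proof (ckernel_conj r w th ltac:(nra)) as E.
  replace (RtoC (r ^ 2) + - Cconj w * circ r th)%C
    with (RtoC (r ^ 2) - Cconj w * circ r th)%C by ring.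
  rewrite <- E at 1. field. exact H.
Qed.

Lemma CInt_conj (g : R -> C) : cont_path g ->
  CInt (fun t => Cconj (g t)) = Cconj (CInt g).
Proof.
  intros Hg. destruct (cont_path_ex_RInt g 0 (2 * PI) Hg) as [E1 E2].
  unfold CInt, Cconj; simpl. f_equal.
  apply (RInt_opp (V := R_CompleteNormedModule) (fun t => snd (g t))). exact E2.
Qed.

(** The conjugate kernel is the restriction to the circle of a holomorphic function with value 1 at
    the origin, so the mean value property gives its integral. *)
Lemma CInt_ckernel (r : R) (w : C) : 0 < r -> r < 1 -> Cmod w < r ^ 2 ->
  CInt (ckernel r w) = RtoC (2 * PI).
Proof.
  intros Hr Hr1 Hw.
  assert (Hwr : Cmod w < r) by nra.
  destruct (C1_holo_poisson r w Hw) as [D HD].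
  pose proof (C1_holo_mult _ _ _ _ (C1_holo_const (RtoC (r ^ 2))) HD) as HF.
  pose proof (mean_value _ _ r HF Hr Hr1) as H. cbv beta in H.
  rewrite (CInt_ext _ (fun th => Cconj (ckernel r w th))) in H
    by (intros; apply ckernel_conj_inv; assumption).
  rewrite CInt_conj in H by (apply cont_path_ckernel; exact Hwr).
  rewrite <- (Cconj_conj (CInt _)), H.
  assert (Hr2 : r ^ 2 <> 0) by (apply pow_nonzero; lra).
  assert (RtoC (r ^ 2) <> 0) by (intros Hc; apply Hr2; apply RtoC_inj, Hc).
  replace (RtoC (r ^ 2) + - Cconj w * RtoC 0)%C with (RtoC (r ^ 2)) by ring.
  rewrite Cinv_r by assumption.
  apply injective_projections; simpl; ring.
Qed.

Lemma cauchy_formula (F D : C -> C) (w : C) (r : R) :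
  C1_holo F D -> 0 < r -> r < 1 -> Cmod w < r ^ 2 ->
  CInt (fun th => F (circ r th) * ckernel r w th)%C = (F w * RtoC (2 * PI))%C.
Proof.
  intros HF Hr Hr1 Hw.
  rewrite (cauchy_ckernel F D); [|exact HF|nra|exact Hr1].
  rewrite CInt_ckernel by assumption. reflexivity.
Qed.

(** Cauchy's formula is applied to [F(z) r^2 / (r^2 - conj w z)]. On the circle the extra factor is
    the conjugate of the kernel, so the integrand is [F] times the nonnegative weight [|ckernel|^2],
    which up to a constant is the Poisson kernel. At [w] the extra factor is
    [c = r^2 / (r^2 - |w|^2) > 0], and a lower bound for the weight compares [c Re F(w)] with the
    mean value [Re F(0)]. *)
Lemma harnack (F D : C -> C) (w : C) :
  C1_holo F D -> (forall z, Cmod z < 1 -> 0 <= fst (F z)) -> 0 < fst (F (RtoC 0)) ->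
  Cmod w < 1 -> 0 < fst (F w).
Proof.
  intros HF Hpos H0 Hw1.
  pose proof (Cmod_ge_0 w) as Hw0.
  (* With this radius [r^2 - |w| = (1 - |w|)^2 / 4 > 0]. *)
  set (r := (1 + Cmod w) / 2).
  assert (Hr : 0 < r) by (unfold r; lra).
  assert (Hr1 : r < 1) by (unfold r; lra).
  assert (Hw : Cmod w < r ^ 2) by (unfold r; nra).
  assert (Hwr : Cmod w < r) by nra.
  pose proof PI_RGT_0 as HPI.
  destruct (C1_holo_poisson r w Hw) as [E HE].
  pose proof (C1_holo_mult _ _ _ _ HF
    (C1_holo_mult _ _ _ _ (C1_holo_const (RtoC (r ^ 2))) HE)) as HG.
  pose proof (cauchy_formula _ _ w r HG Hr Hr1 Hw) as HC. cbv beta in HC.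
  rewrite (CInt_ext _ (fun th => F (circ r th) * RtoC (Cmod (ckernel r w th) ^ 2))%C) in HC.
  2: { intros th. rewrite ckernel_conj_inv by assumption. rewrite Cmod2_conj. ring. }
  pose proof (mean_value F D r HF Hr Hr1) as HM.
  (* On the circle [|circ r th - w| <= 2 r], so the kernel has modulus at least 1/2. *)
  assert (Hk : forall th, / 4 <= Cmod (ckernel r w th) ^ 2).
  { intros th. pose proof (circ_minus_neq_0 w r th Hwr) as Hn.
    unfold ckernel. rewrite Cmod_div, Cmod_circ by (assumption || lra).
    apply Cmod_gt_0 in Hn.
    assert (Cmod (circ r th - w) <= 2 * r).
    { eapply Rle_trans; [apply Cmod_triangle|]. rewrite Cmod_opp, Cmod_circ; lra. }
    assert (/ 2 <= r / Cmod (circ r th - w)).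
    { apply (Rmult_le_reg_r (Cmod (circ r th - w))); [assumption|].
      unfold Rdiv. rewrite Rmult_assoc, Rinv_l; lra. }
    nra. }
  assert (Cg : cont_path (fun th => F (circ r th))).
  { apply (cont_path_holo_circ F D); auto; lra. }
  assert (Ck : cont_path (fun th => RtoC (Cmod (ckernel r w th) ^ 2))).
  { pose proof (cont_path_ckernel r w Hwr) as Ck.
    intros t. destruct (Ck t) as [C1 C2]. split; simpl.
    - apply (continuity_pt_ext (fun s => fst (ckernel r w s) * fst (ckernel r w s)
        + snd (ckernel r w s) * snd (ckernel r w s))).
      + intros s. transitivity (Cmod (ckernel r w s) ^ 2); [rewrite Cmod_sqr; ring | simpl; ring].
      + apply (continuity_pt_plus (fun s => fst (ckernel r w s) * fst (ckernel r w s))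
          (fun s => snd (ckernel r w s) * snd (ckernel r w s)));
        apply (continuity_pt_mult (fun s => _ (ckernel r w s)) (fun s => _ (ckernel r w s))); assumption.
    - apply continuity_pt_const; intros u v; reflexivity. }
  assert (HL : RInt (fun th => / 4 * fst (F (circ r th))) 0 (2 * PI)
    <= RInt (fun th => fst (F (circ r th) * RtoC (Cmod (ckernel r w th) ^ 2))%C) 0 (2 * PI)).
  { apply RInt_le; [lra| | |].
    - apply ex_RInt_continuity. intros t.
      apply (continuity_pt_mult (fun _ => / 4) (fun s => fst (F (circ r s)))); [|apply Cg].
      apply continuity_pt_const; intros u v; reflexivity.
    - apply (cont_path_ex_RInt _ 0 (2 * PI) (cont_path_mult _ _ Cg Ck)).
    - intros t _.
      assert (Hin : Cmod (circ r t) < 1) by (rewrite Cmod_circ; lra).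
      pose proof (Hpos _ Hin). pose proof (Hk t).
      unfold Cmult; simpl fst. simpl snd. nra. }
  rewrite (RInt_scal (V := R_CompleteNormedModule) (fun th => fst (F (circ r th)))) in HL
    by apply (cont_path_ex_RInt _ 0 (2 * PI) Cg).
  apply (f_equal fst) in HC. apply (f_equal fst) in HM.
  match type of HC with _ = ?X => change (RInt (fun th =>
    fst (F (circ r th) * RtoC (Cmod (ckernel r w th) ^ 2))%C) 0 (2 * PI) = X) in HC end.
  match type of HM with _ = ?X => change (RInt (fun th => fst (F (circ r th))) 0 (2 * PI) = X) in HM end.
  rewrite HM, HC in HL.
  replace (RtoC (r ^ 2) + - Cconj w * w)%C with (RtoC (r ^ 2 - Cmod w ^ 2)) in HL.
  2: { rewrite RtoC_minus, Cmod2_conj. ring. }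
  assert (Hd : 0 < r ^ 2 - Cmod w ^ 2) by nra.
  rewrite <- RtoC_inv, <- RtoC_mult in HL by lra.
  assert (Hd2 : 0 < r ^ 2 * / (r ^ 2 - Cmod w ^ 2)).
  { apply Rmult_lt_0_compat; [nra|]. apply Rinv_0_lt_compat, Hd. }
  set (c := r ^ 2 * / (r ^ 2 - Cmod w ^ 2)) in *.
  unfold scal in HL; simpl in HL; unfold mult in HL; simpl in HL.
  apply Rnot_le_lt. intros Hneg.
  assert (0 < 2 * PI * fst (F (RtoC 0))) by nra.
  assert (2 * PI * c * fst (F w) <= 0) by (apply Rmult_le_0_l; nra).
  nra.
Qed.

(** * Power series expansion of holomorphic functions *)

(** At a point strictly between the radius of convergence and [rho] the terms would tend to 0, which
    is impossible outside the disc of convergence. *)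
Lemma CV_radius_ge (a : nat -> R) (rho : R) (f : R -> R) :
  (forall x, 0 <= x < rho -> is_series (fun n => a n * x ^ n) (f x)) ->
  Rbar_le rho (CV_radius a).
Proof.
  intros H. apply Rbar_not_lt_le. intros Hlt.
  pose proof (CV_radius_ge_0 a) as H0.
  destruct (CV_radius a) as [c| |] eqn:Ec; simpl in *; try tauto.
  set (x := (c + rho) / 2).
  assert (Hx : 0 <= x < rho) by (unfold x; lra).
  apply (CV_disk_outside a x).
  - rewrite Ec, Rabs_right by lra. simpl. unfold x. lra.
  - apply (ex_series_lim_0 (fun n => a n * x ^ n)). eexists. apply H, Hx.
Qed.

Lemma power_series_unique (a b : nat -> R) (rho : R) (f : R -> R) :
  0 < rho ->
  (forall x, Rabs x < rho -> is_series (fun n => a n * x ^ n) (f x)) ->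
  (forall x, Rabs x < rho -> is_series (fun n => b n * x ^ n) (f x)) ->
  forall n, a n = b n.
Proof.
  intros Hrho Ha Hb n.
  assert (HR : forall c, (forall x, Rabs x < rho -> is_series (fun n => c n * x ^ n) (f x)) ->
    Rbar_lt 0 (CV_radius c)).
  { intros c Hc. apply Rbar_lt_le_trans with rho; [exact Hrho|].
    apply (CV_radius_ge c rho f). intros x Hx. apply Hc. rewrite Rabs_right; lra. }
  apply PSeries_ext_recip; [apply HR, Ha|apply HR, Hb|].
  exists (mkposreal _ Hrho). intros x Hx.
  assert (Hx' : Rabs x < rho).
  { replace x with (x - 0) by ring. exact Hx. }
  unfold PSeries. rewrite (is_series_unique _ _ (Ha x Hx')), (is_series_unique _ _ (Hb x Hx')).
  reflexivity.
Qed.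

Lemma Cmod_le_sum (z : C) : Cmod z <= Rabs (fst z) + Rabs (snd z).
Proof.
  apply Rsqr_incr_0_var.
  - pose proof (Cmod_sqr z) as H. unfold Rsqr.
    replace (Cmod z * Cmod z) with (Cmod z ^ 2) by ring. rewrite H.
    rewrite <- (pow2_abs (fst z)), <- (pow2_abs (snd z)).
    pose proof (Rabs_pos (fst z)). pose proof (Rabs_pos (snd z)). nra.
  - pose proof (Rabs_pos (fst z)). pose proof (Rabs_pos (snd z)). lra.
Qed.

Lemma abs_fst_le_Cmod (z : C) : Rabs (fst z) <= Cmod z.
Proof. eapply Rle_trans; [apply Rmax_l | apply Rmax_Cmod]. Qed.

Lemma abs_snd_le_Cmod (z : C) : Rabs (snd z) <= Cmod z.
Proof. eapply Rle_trans; [apply Rmax_r | apply Rmax_Cmod]. Qed.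

(** The two components are bounded separately, whence the factor 2. The integral on the right does
    not involve [e], so with [e] a power of the inverse circle the bound is geometric. *)
Lemma CInt_mult_bound (h e : R -> C) (M : R) :
  cont_path h -> cont_path e -> (forall t, Cmod (e t) <= M) ->
  Cmod (CInt (fun t => h t * e t)%C)
  <= 2 * (M * RInt (fun t => Rabs (fst (h t)) + Rabs (snd (h t))) 0 (2 * PI)).
Proof.
  intros Hh He HM. pose proof PI_RGT_0 as HPI.
  assert (Cb : forall t, continuity_pt (fun t => Rabs (fst (h t)) + Rabs (snd (h t))) t).
  { intros t. destruct (Hh t).
    apply (continuity_pt_plus (fun t => Rabs (fst (h t))) (fun t => Rabs (snd (h t)))).
    - apply (continuity_pt_comp (fun t => fst (h t)) Rabs); [assumption|apply Rcontinuity_abs].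
    - apply (continuity_pt_comp (fun t => snd (h t)) Rabs); [assumption|apply Rcontinuity_abs]. }
  assert (Hb : forall f : R -> R, (forall t, continuity_pt f t) ->
    (forall t, Rabs (f t) <= Cmod (h t * e t)%C) ->
    Rabs (RInt f 0 (2 * PI)) <= M * RInt (fun t => Rabs (fst (h t)) + Rabs (snd (h t))) 0 (2 * PI)).
  { intros f Cf Hf.
    eapply Rle_trans; [apply abs_RInt_le; [lra | apply ex_RInt_continuity, Cf]|].
    rewrite <- (RInt_scal (V := R_CompleteNormedModule)
      (fun t => Rabs (fst (h t)) + Rabs (snd (h t)))) by apply ex_RInt_continuity, Cb.
    apply RInt_le; [lra| | |].
    - apply ex_RInt_continuity. intros t.
      apply (continuity_pt_comp f Rabs); [apply Cf|apply Rcontinuity_abs].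
    - apply ex_RInt_continuity. intros t.
      apply (continuity_pt_scal (fun t => Rabs (fst (h t)) + Rabs (snd (h t)))), Cb.
    - intros t _. eapply Rle_trans; [apply Hf|].
      rewrite Cmod_mult. unfold scal; simpl; unfold mult; simpl.
      pose proof (Cmod_le_sum (h t)). pose proof (HM t).
      pose proof (Cmod_ge_0 (h t)). pose proof (Cmod_ge_0 (e t)). nra. }
  pose proof (cont_path_mult h e Hh He) as Che.
  eapply Rle_trans; [apply Cmod_le_sum|].
  set (u := CInt (fun t => h t * e t)%C).
  assert (H1 : Rabs (fst u) <= M * RInt (fun t => Rabs (fst (h t)) + Rabs (snd (h t))) 0 (2 * PI)).
  { apply (Hb (fun t => fst (h t * e t)%C) (fun t => proj1 (Che t))).
    intros t. apply abs_fst_le_Cmod. }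
  assert (H2 : Rabs (snd u) <= M * RInt (fun t => Rabs (fst (h t)) + Rabs (snd (h t))) 0 (2 * PI)).
  { apply (Hb (fun t => snd (h t * e t)%C) (fun t => proj2 (Che t))).
    intros t. apply abs_snd_le_Cmod. }
  lra.
Qed.

Fixpoint Csum (u : nat -> C) (n : nat) : C :=
  match n with O => RtoC 0 | S m => (Csum u m + u m)%C end.

Lemma Csum_components (u : nat -> C) (n : nat) :
  fst (Csum u (S n)) = sum_n (fun k => fst (u k)) n /\
  snd (Csum u (S n)) = sum_n (fun k => snd (u k)) n.
Proof.
  induction n as [|n [IH1 IH2]].
  - rewrite !sum_O. simpl. split; ring.
  - rewrite !sum_Sn, <- IH1, <- IH2. split; reflexivity.
Qed.

Lemma is_series_components (u : nat -> C) (l : C) (b : nat -> R) :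
  is_lim_seq b 0 -> (forall n, Cmod (Csum u n - l)%C <= b n) ->
  is_series (fun n => fst (u n)) (fst l) /\ is_series (fun n => snd (u n)) (snd l).
Proof.
  intros Hb Hle.
  (* [Csum u (S n)] is the sum up to index [n], so the bounds are shifted by one. *)
  apply is_lim_seq_incr_1 in Hb.
  assert (Hp : forall (s : nat -> R) (x : R), (forall n, Rabs (s n - x) <= b (S n)) -> is_lim_seq s x).
  { intros s x Hs.
    assert (E : is_lim_seq (fun n => s n - x) 0).
    { apply is_lim_seq_abs_0.
      apply (is_lim_seq_le_le (fun _ => 0) _ (fun n => b (S n))).
      - intros n; split; [apply Rabs_pos | apply Hs].
      - apply is_lim_seq_const.
      - exact Hb. }
    apply (is_lim_seq_ext (fun n => (s n - x) + x)); [intros; ring|].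
    replace (Finite x) with (Finite (0 + x)) by (f_equal; ring).
    apply is_lim_seq_plus'; [exact E|apply is_lim_seq_const]. }
  split; [apply (Hp (fun n => sum_n (fun k => fst (u k)) n))
    | apply (Hp (fun n => sum_n (fun k => snd (u k)) n))]; intros n.
  - destruct (Csum_components u n) as [E _]. rewrite <- E.
    eapply Rle_trans; [|apply Hle]. apply (abs_fst_le_Cmod (Csum u (S n) - l)%C).
  - destruct (Csum_components u n) as [_ E]. rewrite <- E.
    eapply Rle_trans; [|apply Hle]. apply (abs_snd_le_Cmod (Csum u (S n) - l)%C).
Qed.

(** No series is exchanged with an integral. The kernel satisfies [k = 1 + w k / zeta], so the
    integrals [A n] of [F k / zeta^n] obey [A n = c n + w A (n + 1)]. Iterating gives [F w] up to
    [2 PI] as a partial sum plus the remainder [w^n A n], which is bounded by a multiple of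
    [(|w| / r)^n]. *)
Lemma power_expansion_local (F D : C -> C) (r : R) :
  C1_holo F D -> 0 < r -> r < 1 ->
  exists c : nat -> C, forall w, Cmod w < r ^ 2 ->
    is_series (fun n => fst (w ^ n * c n)%C) (fst (F w)) /\
    is_series (fun n => snd (w ^ n * c n)%C) (snd (F w)).
Proof.
  intros HF Hr Hr1. pose proof PI_RGT_0 as HPI.
  set (e := fun th => (/ circ r th)%C).
  assert (Ce : cont_path e).
  { apply cont_path_inv; [apply cont_path_circ|]. intros t. apply circ_neq_0, Hr. }
  assert (Cg : cont_path (fun th => F (circ r th))).
  { apply (cont_path_holo_circ F D); auto; lra. }
  assert (HP : RtoC (2 * PI) <> 0) by (intros Hc; apply RtoC_inj in Hc; lra).
  exists (fun n => CInt (fun th => F (circ r th) * e th ^ n) / RtoC (2 * PI))%C.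
  intros w Hw. assert (Hwr : Cmod w < r) by nra.
  pose proof (cont_path_ckernel r w Hwr) as Ck.
  set (c := fun n => CInt (fun th => F (circ r th) * e th ^ n)%C).
  set (A := fun n => CInt (fun th => F (circ r th) * ckernel r w th * e th ^ n)%C).
  assert (HA : forall n, A n = (c n + w * A (S n))%C).
  { intros n. unfold A, c.
    rewrite <- CInt_scal.
    2: { apply cont_path_mult; [apply cont_path_mult; assumption | apply cont_path_pow, Ce]. }
    rewrite <- CInt_plus.
    - apply CInt_ext. intros t. unfold ckernel, e. rewrite Cpow_S.
      pose proof (circ_neq_0 r t Hr). pose proof (circ_minus_neq_0 w r t Hwr).
      set (p := (/ circ r t ^ n)%C). rewrite Cpow_inv by assumption. fold p. field. auto.
    - apply cont_path_mult; [assumption | apply cont_path_pow, Ce].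
    - apply (cont_path_mult (fun _ => w)); [apply cont_path_const|].
      apply (cont_path_mult (fun th => F (circ r th) * ckernel r w th)%C (fun th => e th ^ S n)%C);
        [apply cont_path_mult; assumption | apply cont_path_pow, Ce]. }
  assert (HS : forall n, A O = (Csum (fun k => w ^ k * c k)%C n + w ^ n * A n)%C).
  { induction n as [|n IH]; simpl Csum.
    - simpl. ring.
    - rewrite IH, (HA n), Cpow_S. ring. }
  assert (HA0 : A O = (F w * RtoC (2 * PI))%C).
  { rewrite <- (cauchy_formula F D w r) by assumption.
    apply CInt_ext. intros t. simpl. ring. }
  set (M := RInt (fun t => Rabs (fst (F (circ r t) * ckernel r w t)%C)
    + Rabs (snd (F (circ r t) * ckernel r w t)%C)) 0 (2 * PI)).
  assert (HAn : forall n, Cmod (A n) <= 2 * (/ r ^ n * M)).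
  { intros n. apply CInt_mult_bound.
    - apply (cont_path_mult (fun t => F (circ r t))); assumption.
    - apply cont_path_pow, Ce.
    - intros t. unfold e. rewrite Cmod_pow, Cmod_inv, Cmod_circ by (try apply circ_neq_0; lra).
      rewrite pow_inv. lra. }
  assert (Csum_div : forall n, Csum (fun k => w ^ k * (c k / RtoC (2 * PI)))%C n
    = (Csum (fun k => w ^ k * c k)%C n / RtoC (2 * PI))%C).
  { induction n as [|n IH]; simpl Csum.
    - field. exact HP.
    - rewrite IH. field. exact HP. }
  apply (is_series_components (fun n => w ^ n * (c n / RtoC (2 * PI)))%C (F w)
    (fun n => (/ PI * M) * (Cmod w / r) ^ n)).
  - replace (Finite 0) with (Rbar_mult (/ PI * M) 0) by (simpl; f_equal; ring).
    apply is_lim_seq_scal_l, is_lim_seq_geom.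
    pose proof (Cmod_ge_0 w).
    rewrite Rabs_right.
    + apply (Rmult_lt_reg_r r); [exact Hr|]. unfold Rdiv. rewrite Rmult_assoc, Rinv_l; lra.
    + apply Rle_ge, Rmult_le_pos; [assumption|]. left. apply Rinv_0_lt_compat, Hr.
  - intros n. rewrite Csum_div.
    replace (Csum (fun k => w ^ k * c k) n / RtoC (2 * PI) - F w)%C
      with (- (w ^ n * A n / RtoC (2 * PI)))%C.
    2: { replace (F w) with (A O / RtoC (2 * PI))%C.
         - rewrite (HS n). field. exact HP.
         - rewrite HA0. field. exact HP. }
    rewrite Cmod_opp, Cmod_div, Cmod_mult, Cmod_pow, Cmod_R, (Rabs_right (2 * PI)) by (assumption || lra).
    unfold Rdiv. rewrite Rpow_mult_distr, pow_inv, Rinv_mult.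
    pose proof (pow_le (Cmod w) n (Cmod_ge_0 w)) as Hp. pose proof (HAn n) as Ha.
    assert (0 < / PI) by apply Rinv_0_lt_compat, HPI.
    apply Rle_trans with (Cmod w ^ n * (2 * (/ r ^ n * M)) * (/ 2 * / PI)).
    + apply Rmult_le_compat_r; [nra|]. apply Rmult_le_compat_l; assumption.
    + right. field. split; [apply pow_nonzero|]; lra.
Qed.

(** The local coefficients depend on the radius. Those of radius 1/2 serve everywhere: for a larger
    radius both expansions hold near 0 on the real axis, and uniqueness of real power series
    identifies them. *)
Lemma power_expansion (F D : C -> C) :
  C1_holo F D ->
  exists c : nat -> C, forall w, Cmod w < 1 ->
    is_series (fun n => fst (w ^ n * c n)%C) (fst (F w)) /\
    is_series (fun n => snd (w ^ n * c n)%C) (snd (F w)).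
Proof.
  intros HF.
  destruct (power_expansion_local F D (/ 2) HF) as [c Hc]; [lra|lra|].
  exists c. intros w Hw.
  pose proof (Cmod_ge_0 w) as Hw0.
  set (r := (1 + Cmod w) / 2).
  assert (Hr : 0 < r) by (unfold r; lra).
  assert (Hr1 : r < 1) by (unfold r; lra).
  assert (Hwr : Cmod w < r ^ 2) by (unfold r; nra).
  destruct (power_expansion_local F D r HF Hr Hr1) as [d Hd].
  assert (E : forall n, c n = d n).
  { set (rho := Rmin ((/ 2) ^ 2) (r ^ 2)).
    assert (Hrho : 0 < rho) by (apply Rmin_pos; nra).
    assert (H1 : rho <= (/ 2) ^ 2) by apply Rmin_l.
    assert (H2 : rho <= r ^ 2) by apply Rmin_r.
    intros n. apply injective_projections.
    - apply (power_series_unique (fun n => fst (c n)) (fun n => fst (d n)) rho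
        (fun x => fst (F (RtoC x))) Hrho).
      + intros x Hx. destruct (Hc (RtoC x)) as [S1 _]; [rewrite Cmod_R; lra|].
        eapply is_series_ext; [|exact S1]. intros m. simpl. rewrite <- RtoC_pow. simpl. ring.
      + intros x Hx. destruct (Hd (RtoC x)) as [S1 _]; [rewrite Cmod_R; lra|].
        eapply is_series_ext; [|exact S1]. intros m. simpl. rewrite <- RtoC_pow. simpl. ring.
    - apply (power_series_unique (fun n => snd (c n)) (fun n => snd (d n)) rho
        (fun x => snd (F (RtoC x))) Hrho).
      + intros x Hx. destruct (Hc (RtoC x)) as [_ S1]; [rewrite Cmod_R; lra|].
        eapply is_series_ext; [|exact S1]. intros m. simpl. rewrite <- RtoC_pow. simpl. ring.
      + intros x Hx. destruct (Hd (RtoC x)) as [_ S1]; [rewrite Cmod_R; lra|].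
        eapply is_series_ext; [|exact S1]. intros m. simpl. rewrite <- RtoC_pow. simpl. ring. }
  destruct (Hd w Hwr) as [S1 S2].
  split; eapply is_series_ext; try eassumption; intros n; cbv beta; rewrite E; reflexivity.
Qed.

(** * Complex power series with real coefficients *)

(* Meaningful on the unit disc when [Rbar_le 1 (CV_radius a)]; [Series] has junk values where the
   series diverges. *)
Definition cps (a : nat -> R) (z : C) : C :=
  (Series (fun n => fst (z ^ n)%C * a n), Series (fun n => snd (z ^ n)%C * a n)).

Lemma CV_radius_ge_1_abs (a : nat -> R) (x : R) :
  Rbar_le 1 (CV_radius a) -> 0 <= x < 1 -> ex_series (fun n => x ^ n * Rabs (a n)).
Proof.
  intros Ha Hx. apply (ex_series_ext (fun n => Rabs (a n * x ^ n))).
  - intros n. rewrite Rabs_mult, (Rabs_right (x ^ n)); [ring_R|].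
    apply Rle_ge, pow_le. lra.
  - apply CV_disk_inside. eapply Rbar_lt_le_trans; [|exact Ha].
    simpl. rewrite Rabs_right; lra.
Qed.

Lemma CV_radius_ge_1_intro (a : nat -> R) :
  (forall x, 0 <= x < 1 -> ex_series (fun n => a n * x ^ n)) -> Rbar_le 1 (CV_radius a).
Proof.
  intros H. apply (CV_radius_ge a 1 (fun x => Series (fun n => a n * x ^ n))).
  intros x Hx. apply Series_correct, H, Hx.
Qed.

Lemma CV_radius_ge_1_pseries (a : nat -> R) (x : R) :
  Rbar_le 1 (CV_radius a) -> 0 <= x < 1 -> ex_series (fun n => a n * x ^ n).
Proof.
  intros Ha Hx. apply ex_series_Rabs.
  apply (ex_series_ext (fun n => x ^ n * Rabs (a n))).
  - intros n. rewrite Rabs_mult, (Rabs_right (x ^ n)); [ring_R|].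
    apply Rle_ge, pow_le. lra.
  - apply CV_radius_ge_1_abs; assumption.
Qed.

Lemma cps_abs (a : nat -> R) (z : C) (p : C -> R) :
  (forall w, Rabs (p w) <= Cmod w) ->
  Rbar_le 1 (CV_radius a) -> Cmod z < 1 -> ex_series (fun n => Rabs (p (z ^ n)%C * a n)).
Proof.
  intros Hp Ha Hz.
  apply (ex_series_le (V := R_CompleteNormedModule) _ (fun n => Cmod z ^ n * Rabs (a n))).
  - intros n. change (Rabs (Rabs (p (z ^ n)%C * a n)) <= Cmod z ^ n * Rabs (a n)).
    rewrite Rabs_Rabsolu, Rabs_mult. apply Rmult_le_compat_r; [apply Rabs_pos|].
    rewrite <- Cmod_pow. apply Hp.
  - apply CV_radius_ge_1_abs; [exact Ha|]. split; [apply Cmod_ge_0|exact Hz].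
Qed.

Lemma is_series_cps (a : nat -> R) (z : C) :
  Rbar_le 1 (CV_radius a) -> Cmod z < 1 ->
  is_series (fun n => fst (z ^ n)%C * a n) (fst (cps a z)) /\
  is_series (fun n => snd (z ^ n)%C * a n) (snd (cps a z)).
Proof.
  intros Ha Hz; split; apply Series_correct, ex_series_Rabs.
  - apply (cps_abs a z fst abs_fst_le_Cmod); assumption.
  - apply (cps_abs a z snd abs_snd_le_Cmod); assumption.
Qed.

Lemma cps_ext (a b : nat -> R) (z : C) : (forall n, a n = b n) -> cps a z = cps b z.
Proof.
  intros H. unfold cps. f_equal; apply Series_ext; intros n; rewrite H; reflexivity.
Qed.

Lemma CV_radius_ge_1_plus (a b : nat -> R) :
  Rbar_le 1 (CV_radius a) -> Rbar_le 1 (CV_radius b) ->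
  Rbar_le 1 (CV_radius (fun n => a n + b n)).
Proof.
  intros Ha Hb. apply CV_radius_ge_1_intro. intros x Hx.
  apply (ex_series_ext (fun n => a n * x ^ n + b n * x ^ n)); [intros; ring_R|].
  apply (ex_series_plus (V := R_NormedModule) (fun n => a n * x ^ n) (fun n => b n * x ^ n));
    apply CV_radius_ge_1_pseries; assumption.
Qed.

Lemma CV_radius_ge_1_scal (c : R) (a : nat -> R) :
  Rbar_le 1 (CV_radius a) -> Rbar_le 1 (CV_radius (fun n => c * a n)).
Proof.
  intros Ha. apply CV_radius_ge_1_intro. intros x Hx.
  apply (ex_series_ext (fun n => c * (a n * x ^ n))); [intros; ring_R|].
  apply (ex_series_scal (V := R_NormedModule) c (fun n => a n * x ^ n)).
  apply CV_radius_ge_1_pseries; assumption.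
Qed.

Lemma CV_radius_ge_1_mult (a b : nat -> R) :
  Rbar_le 1 (CV_radius a) -> Rbar_le 1 (CV_radius b) -> Rbar_le 1 (CV_radius (PS_mult a b)).
Proof.
  intros Ha Hb. apply CV_radius_ge_1_intro. intros x Hx.
  apply (proj1 (ex_pseries_R (PS_mult a b) x)), (ex_pseries_mult a b x); (eapply Rbar_lt_le_trans; [|eassumption]);
    simpl; rewrite Rabs_right; lra.
Qed.

Lemma CV_radius_ge_1_shift (a : nat -> R) :
  Rbar_le 1 (CV_radius a) -> Rbar_le 1 (CV_radius (fun n => a (S n))).
Proof.
  intros Ha. rewrite <- (CV_radius_decr_1 a) in Ha. exact Ha.
Qed.

Lemma cps_plus (a b : nat -> R) (z : C) :
  Rbar_le 1 (CV_radius a) -> Rbar_le 1 (CV_radius b) -> Cmod z < 1 ->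
  cps (fun n => a n + b n) z = (cps a z + cps b z)%C.
Proof.
  intros Ha Hb Hz.
  destruct (is_series_cps a z Ha Hz) as [A1 A2], (is_series_cps b z Hb Hz) as [B1 B2].
  apply injective_projections; simpl; apply is_series_unique.
  - eapply is_series_ext; [|apply (is_series_plus (V := R_NormedModule) _ _ _ _ A1 B1)].
    intros n. unfold plus; simpl. ring_R.
  - eapply is_series_ext; [|apply (is_series_plus (V := R_NormedModule) _ _ _ _ A2 B2)].
    intros n. unfold plus; simpl. ring_R.
Qed.

Lemma cps_scal (c : R) (a : nat -> R) (z : C) :
  cps (fun n => c * a n) z = (RtoC c * cps a z)%C.
Proof.
  apply injective_projections; simpl.
  - transitivity (c * Series (fun n => fst (z ^ n)%C * a n)); [|ring].
    rewrite <- Series_scal_l. apply Series_ext; intros; ring.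
  - transitivity (c * Series (fun n => snd (z ^ n)%C * a n)); [|ring].
    rewrite <- Series_scal_l. apply Series_ext; intros; ring.
Qed.

Lemma sum_f_R0_components (A1 A2 B1 B2 : nat -> R) (n : nat) (c1 c2 : R) :
  c1 * sum_f_R0 (fun k => A1 k * B1 (n - k)%nat) n
  + c2 * sum_f_R0 (fun k => A2 k * B2 (n - k)%nat) n
  = sum_f_R0 (fun k => c1 * (A1 k * B1 (n - k)%nat) + c2 * (A2 k * B2 (n - k)%nat)) n.
Proof. rewrite !scal_sum, <- sum_plus. apply sum_eq; intros; ring. Qed.

(** Each component of the product combines two real Cauchy products, which converge because the
    component series converge absolutely; [z^n = z^k z^(n-k)] reassembles the terms. *)
Lemma cps_mult (a b : nat -> R) (z : C) :
  Rbar_le 1 (CV_radius a) -> Rbar_le 1 (CV_radius b) -> Cmod z < 1 ->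
  cps (PS_mult a b) z = (cps a z * cps b z)%C.
Proof.
  intros Ha Hb Hz.
  destruct (is_series_cps a z Ha Hz) as [A1 A2], (is_series_cps b z Hb Hz) as [B1 B2].
  pose proof (cps_abs a z fst abs_fst_le_Cmod Ha Hz) as A3.
  pose proof (cps_abs a z snd abs_snd_le_Cmod Ha Hz) as A4.
  pose proof (cps_abs b z fst abs_fst_le_Cmod Hb Hz) as B3.
  pose proof (cps_abs b z snd abs_snd_le_Cmod Hb Hz) as B4.
  assert (Hpow : forall n k, (k <= n)%nat -> (z ^ n = z ^ k * z ^ (n - k))%C).
  { intros n k Hk. rewrite <- Cpow_add_r. f_equal. lia. }
  apply injective_projections; simpl; apply is_series_unique.
  - pose proof (is_series_minus (V := R_NormedModule) _ _ _ _
      (is_series_mult _ _ _ _ A1 B1 A3 B3) (is_series_mult _ _ _ _ A2 B2 A4 B4)) as H.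
    eapply is_series_ext; [|exact H]. intros n. unfold minus, plus, opp; simpl.
    unfold PS_mult. rewrite scal_sum.
    match goal with |- ?u + - ?v = _ => transitivity (1 * u + (-1) * v); [ring|] end.
    rewrite (sum_f_R0_components (fun n => fst (z ^ n)%C * a n) (fun n => snd (z ^ n)%C * a n)
      (fun n => fst (z ^ n)%C * b n) (fun n => snd (z ^ n)%C * b n)).
    apply sum_eq. intros k Hk. rewrite (Hpow n k Hk). simpl. ring_R.
  - pose proof (is_series_plus (V := R_NormedModule) _ _ _ _
      (is_series_mult _ _ _ _ A1 B2 A3 B4) (is_series_mult _ _ _ _ A2 B1 A4 B3)) as H.
    eapply is_series_ext; [|exact H]. intros n. unfold plus; simpl.
    unfold PS_mult. rewrite scal_sum.
    match goal with |- ?u + ?v = _ => transitivity (1 * u + 1 * v); [ring|] end.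
    rewrite (sum_f_R0_components (fun n => fst (z ^ n)%C * a n) (fun n => snd (z ^ n)%C * a n)
      (fun n => snd (z ^ n)%C * b n) (fun n => fst (z ^ n)%C * b n)).
    apply sum_eq. intros k Hk. rewrite (Hpow n k Hk). simpl. ring_R.
Qed.

Lemma cps_shift (a : nat -> R) (z : C) :
  Rbar_le 1 (CV_radius a) -> Cmod z < 1 ->
  cps a z = (RtoC (a O) + z * cps (fun n => a (S n)) z)%C.
Proof.
  intros Ha Hz.
  destruct (is_series_cps a z Ha Hz) as [A1 A2].
  destruct (is_series_cps _ z (CV_radius_ge_1_shift a Ha) Hz) as [B1 B2].
  assert (E1 : ex_series (fun n => fst (z ^ n)%C * a n)) by (eexists; exact A1).
  assert (E2 : ex_series (fun n => snd (z ^ n)%C * a n)) by (eexists; exact A2).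
  apply injective_projections.
  - change (Series (fun n => fst (z ^ n)%C * a n)
      = fst (RtoC (a O) + z * cps (fun n => a (S n)) z)%C).
    rewrite Series_incr_1 by exact E1.
    rewrite (is_series_unique _ (fst (z * cps (fun n => a (S n)) z)%C)).
    + simpl. ring_R.
    + pose proof (is_series_minus (V := R_NormedModule) _ _ _ _
        (is_series_scal (fst z) _ _ B1) (is_series_scal (snd z) _ _ B2)) as H.
      eapply is_series_ext; [|exact H].
      intros n. unfold minus, plus, opp, scal; simpl; unfold mult; simpl. ring_R.
  - change (Series (fun n => snd (z ^ n)%C * a n)
      = snd (RtoC (a O) + z * cps (fun n => a (S n)) z)%C).
    rewrite Series_incr_1 by exact E2.
    rewrite (is_series_unique _ (snd (z * cps (fun n => a (S n)) z)%C)).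
    + simpl. ring_R.
    + pose proof (is_series_plus (V := R_NormedModule) _ _ _ _
        (is_series_scal (fst z) _ _ B2) (is_series_scal (snd z) _ _ B1)) as H.
      eapply is_series_ext; [|exact H].
      intros n. unfold plus, scal; simpl; unfold mult; simpl. ring_R.
Qed.

(** * Termwise differentiation of power series in the disc *)

Lemma Cpow_taylor_bound (z h : C) (rho : R) (n : nat) :
  Cmod z <= rho -> Cmod (z + h) <= rho ->
  Cmod ((z + h) ^ S (S n) - z ^ S (S n) - RtoC (INR (S (S n))) * h * z ^ S n)
  <= Cmod h ^ 2 * (INR (S (S n)) * INR (S n) * rho ^ n).
Proof.
  intros Hz Hzh. pose proof (Cmod_ge_0 z) as Hz0. pose proof (Cmod_ge_0 h) as Hh0.
  induction n as [|n IH].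
  - replace ((z + h) ^ 2 - z ^ 2 - RtoC (INR 2) * h * z ^ 1)%C with (h ^ 2)%C.
    + rewrite Cmod_pow. simpl. nra.
    + simpl INR. rewrite RtoC_plus. simpl Cpow. ring.
  - set (m := S (S n)) in *.
    (* The remainder [T_m] of the power [m] satisfies [T_(m+1) = m h^2 z^(m-1) + (z + h) T_m]. The
       constant [m (m - 1) rho^(m-2)] is the second derivative of the power at [rho], so that
       summing over the coefficients produces the twice derived series. *)
    replace ((z + h) ^ S m - z ^ S m - RtoC (INR (S m)) * h * z ^ m)%C with
      (RtoC (INR m) * h ^ 2 * z ^ S n
       + (z + h) * ((z + h) ^ m - z ^ m - RtoC (INR m) * h * z ^ S n))%C.
    + eapply Rle_trans; [apply Cmod_triangle|].
      rewrite !Cmod_mult, !Cmod_pow, Cmod_R, (Rabs_right (INR m)) by apply Rle_ge, pos_INR.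
      assert (Hp : Cmod z ^ S n <= rho ^ S n) by (apply pow_incr; lra).
      pose proof (pos_INR m) as Hm.
      assert (Hrn : 0 <= rho ^ S n) by (apply pow_le; lra).
      assert (Hh2 : 0 <= Cmod h ^ 2) by (apply pow_le; lra).
      apply Rle_trans with (INR m * Cmod h ^ 2 * rho ^ S n
        + rho * (Cmod h ^ 2 * (INR m * INR (S n) * rho ^ n))).
      * apply Rplus_le_compat.
        -- apply Rmult_le_compat_l; [nra|exact Hp].
        -- apply Rmult_le_compat; [apply Cmod_ge_0|apply Cmod_ge_0|exact Hzh|exact IH].
      * replace (INR (S n)) with (INR m - 1) by (unfold m; rewrite (S_INR (S n)); ring).
        rewrite (S_INR m).
        set (X := Cmod h ^ 2 * (INR m * rho ^ S n)).
        assert (0 <= X) by (apply Rmult_le_pos; nra).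
        replace (INR m * Cmod h ^ 2 * rho ^ S n
          + rho * (Cmod h ^ 2 * (INR m * (INR m - 1) * rho ^ n))) with (X * INR m)
          by (unfold X; simpl; ring).
        replace (Cmod h ^ 2 * ((INR m + 1) * INR m * rho ^ S n)) with (X * INR m + X)
          by (unfold X; simpl; ring).
        lra.
    + rewrite (S_INR m), RtoC_plus. unfold m. simpl Cpow. ring.
Qed.

Lemma is_series_tail (u : nat -> R) (l : R) :
  is_series u l -> is_series (fun n => u (S n)) (l - u O).
Proof.
  intros H. apply is_series_incr_1. evar_last; [exact H|].
  unfold plus; simpl. ring_R.
Qed.

(** The remainders of the powers are summed against the coefficients. The constant is the twice
    derived series of absolute values at [rho], a radius between [|z|] and 1, and [h] is kept so
    small that [z + h] stays in the disc of radius [rho]. *)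
Lemma cps_taylor_bound (a : nat -> R) (z : C) :
  Rbar_le 1 (CV_radius a) -> Cmod z < 1 ->
  exists M d : R, 0 <= M /\ 0 < d /\ forall h, Cmod h < d ->
    Rabs (fst (cps a (z + h) - cps a z - h * cps (PS_derive a) z)%C) <= M * Cmod h ^ 2 /\
    Rabs (snd (cps a (z + h) - cps a z - h * cps (PS_derive a) z)%C) <= M * Cmod h ^ 2.
Proof.
  intros Ha Hz. pose proof (Cmod_ge_0 z) as Hz0.
  set (rho := (1 + Cmod z) / 2).
  assert (Hrho : 0 <= rho < 1) by (unfold rho; lra).
  assert (Ha' : Rbar_le 1 (CV_radius (PS_derive a))) by (rewrite CV_radius_derive; exact Ha).
  assert (Ha'' : Rbar_le 1 (CV_radius (PS_derive (PS_derive a)))) by (rewrite CV_radius_derive; exact Ha').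
  pose proof (CV_radius_ge_1_abs _ rho Ha'' Hrho) as HM.
  exists (Series (fun n => rho ^ n * Rabs (PS_derive (PS_derive a) n))), (rho - Cmod z).
  assert (HM0 : 0 <= Series (fun n => rho ^ n * Rabs (PS_derive (PS_derive a) n))).
  { rewrite <- (Rmult_0_l (Series (fun n => rho ^ n * Rabs (PS_derive (PS_derive a) n)))).
    rewrite <- Series_scal_l. apply Series_le; [|exact HM].
    intros n. pose proof (pow_le rho n (proj1 Hrho)).
    pose proof (Rabs_pos (PS_derive (PS_derive a) n)). nra. }
  split; [exact HM0|]. split; [unfold rho; lra|].
  intros h Hh. pose proof (Cmod_ge_0 h) as Hh0.
  assert (Hzh : Cmod (z + h)%C <= rho) by (eapply Rle_trans; [apply Cmod_triangle|]; lra).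
  assert (Hzr : Cmod z <= rho) by (unfold rho; lra).
  (* [T n] belongs to the power [S n]: the constant terms cancel and are removed from the series by
     [is_series_tail], and the linear term has remainder [T 0 = 0]. *)
  set (T := fun n => ((z + h) ^ S n - z ^ S n - RtoC (INR (S n)) * h * z ^ n)%C).
  assert (HT0 : T O = RtoC 0) by (unfold T; simpl; ring).
  assert (HT : forall n, Cmod (T (S n)) <= Cmod h ^ 2 * (INR (S (S n)) * INR (S n) * rho ^ n))
    by (intros n; apply Cpow_taylor_bound; assumption).
  assert (key : forall p : C -> R, (forall w, Rabs (p w) <= Cmod w) -> p (RtoC 0) = 0 ->
    forall l, is_series (fun n => p (T n) * a (S n)) l ->
    Rabs l <= Series (fun n => rho ^ n * Rabs (PS_derive (PS_derive a) n)) * Cmod h ^ 2).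
  { intros p Hp Hp0 l Hl.
    assert (Hu : forall n, Rabs (p (T (S n)) * a (S (S n)))
      <= Cmod h ^ 2 * (rho ^ n * Rabs (PS_derive (PS_derive a) n))).
    { intros n. unfold PS_derive.
      rewrite !Rabs_mult, (Rabs_right (INR (S n))), (Rabs_right (INR (S (S n))))
        by apply Rle_ge, pos_INR.
      replace (Cmod h ^ 2 * (rho ^ n * (INR (S n) * (INR (S (S n)) * Rabs (a (S (S n)))))))
        with (Cmod h ^ 2 * (INR (S (S n)) * INR (S n) * rho ^ n) * Rabs (a (S (S n)))) by ring.
      apply Rmult_le_compat_r; [apply Rabs_pos|].
      eapply Rle_trans; [apply Hp|apply HT]. }
    assert (HMh : ex_series (fun n => Cmod h ^ 2 * (rho ^ n * Rabs (PS_derive (PS_derive a) n)))).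
    { apply (ex_series_scal (V := R_NormedModule) (Cmod h ^ 2)
        (fun n => rho ^ n * Rabs (PS_derive (PS_derive a) n))). exact HM. }
    assert (Hab : ex_series (fun n => Rabs (p (T (S n)) * a (S (S n))))).
    { apply (ex_series_le (V := R_CompleteNormedModule) _
        (fun n => Cmod h ^ 2 * (rho ^ n * Rabs (PS_derive (PS_derive a) n)))); [|exact HMh].
      intros n. change (Rabs (Rabs (p (T (S n)) * a (S (S n))))
        <= Cmod h ^ 2 * (rho ^ n * Rabs (PS_derive (PS_derive a) n))).
      rewrite Rabs_Rabsolu. apply Hu. }
    rewrite <- (is_series_unique _ _ Hl), Series_incr_1 by (eexists; exact Hl).
    rewrite HT0, Hp0, Rmult_0_l, Rplus_0_l.
    eapply Rle_trans; [apply Series_Rabs, Hab|].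
    rewrite Rmult_comm, <- Series_scal_l. apply Series_le; [|exact HMh].
    intros n. split; [apply Rabs_pos|apply Hu]. }
  destruct (is_series_cps a (z + h)%C Ha ltac:(lra)) as [A1 A2].
  destruct (is_series_cps a z Ha Hz) as [B1 B2].
  destruct (is_series_cps _ z Ha' Hz) as [D1 D2].
  apply is_series_tail in A1. apply is_series_tail in A2.
  apply is_series_tail in B1. apply is_series_tail in B2.
  split; [apply (key fst abs_fst_le_Cmod eq_refl) | apply (key snd abs_snd_le_Cmod eq_refl)].
  - pose proof (is_series_minus (V := R_NormedModule) _ _ _ _
      (is_series_minus (V := R_NormedModule) _ _ _ _ A1 B1)
      (is_series_minus (V := R_NormedModule) _ _ _ _
        (is_series_scal (fst h) _ _ D1) (is_series_scal (snd h) _ _ D2))) as H.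
    evar_last; [eapply is_series_ext; [|exact H]|].
    + intros n. unfold minus, plus, opp, scal, PS_derive, T; cbn -[INR Cpow cps]; unfold mult; simpl mult.
      cbn -[INR Cpow cps]. ring_R.
    + unfold minus, plus, opp, scal; cbn -[INR Cpow cps]; unfold mult; cbn -[INR Cpow cps]. simpl Cpow. simpl. ring_R.
  - pose proof (is_series_minus (V := R_NormedModule) _ _ _ _
      (is_series_minus (V := R_NormedModule) _ _ _ _ A2 B2)
      (is_series_plus (V := R_NormedModule) _ _ _ _
        (is_series_scal (fst h) _ _ D2) (is_series_scal (snd h) _ _ D1))) as H.
    evar_last; [eapply is_series_ext; [|exact H]|].
    + intros n. unfold minus, plus, opp, scal, PS_derive, T; cbn -[INR Cpow cps]; unfold mult; simpl mult.
      cbn -[INR Cpow cps]. ring_R.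
    + unfold minus, plus, opp, scal; cbn -[INR Cpow cps]; unfold mult; cbn -[INR Cpow cps]. simpl Cpow. simpl. ring_R.
Qed.

Lemma differentiable_pt_lim_quadratic (f : R -> R -> R) (x y lx ly M d : R) :
  0 <= M -> 0 < d ->
  (forall u v, Cmod (u, v) < d ->
    Rabs (f (x + u) (y + v) - f x y - (lx * u + ly * v)) <= M * Cmod (u, v) ^ 2) ->
  differentiable_pt_lim f x y lx ly.
Proof.
  intros HM Hd H eps.
  (* The modulus is at most twice the maximum norm [m], so the error is at most [4 M m^2]; the
     summand 1 keeps the divisor positive when [M = 0]. *)
  assert (He : 0 < Rmin (d / 2) (eps / (4 * M + 1))).
  { apply Rmin_pos; [lra|]. apply Rdiv_lt_0_compat; [apply cond_pos|lra]. }
  exists (mkposreal _ He). simpl. intros u v Hu Hv.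
  pose proof (Rmin_l (d / 2) (eps / (4 * M + 1))) as M1.
  pose proof (Rmin_r (d / 2) (eps / (4 * M + 1))) as M2.
  set (m := Rmax (Rabs (u - x)) (Rabs (v - y))).
  assert (Hm : m < Rmin (d / 2) (eps / (4 * M + 1))) by (apply Rmax_lub_lt; assumption).
  assert (Hm0 : 0 <= m) by (eapply Rle_trans; [apply Rabs_pos|apply Rmax_l]).
  assert (HC : Cmod (u - x, v - y) <= 2 * m).
  { eapply Rle_trans; [apply Cmod_le_sum|]. simpl.
    pose proof (Rmax_l (Rabs (u - x)) (Rabs (v - y))).
    pose proof (Rmax_r (Rabs (u - x)) (Rabs (v - y))). unfold m; lra. }
  specialize (H (u - x) (v - y)).
  replace (x + (u - x)) with u in H by ring. replace (y + (v - y)) with v in H by ring.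
  eapply Rle_trans; [apply H; lra|].
  pose proof (Cmod_ge_0 (u - x, v - y)).
  assert (HM4 : (4 * M + 1) * m <= eps).
  { apply Rle_trans with ((4 * M + 1) * (eps / (4 * M + 1))).
    - apply Rmult_le_compat_l; lra.
    - right. field. lra. }
  apply Rle_trans with (4 * M * m * m); [|fold m; nra].
  replace (4 * M * m * m) with (M * (2 * m) ^ 2) by ring.
  apply Rmult_le_compat_l; [exact HM|]. apply pow_incr. lra.
Qed.

(** Continuity of the derivative comes from differentiability of the derived series, which has the
    same radius of convergence. *)
Lemma C1_holo_cps (a : nat -> R) :
  Rbar_le 1 (CV_radius a) -> C1_holo (cps a) (cps (PS_derive a)).
Proof.
  assert (HD : forall b, Rbar_le 1 (CV_radius b) -> forall x y, Cmod (x, y) < 1 ->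
    differentiable_pt_lim (fun s t => fst (cps b (s, t))) x y
      (fst (cps (PS_derive b) (x, y))) (- snd (cps (PS_derive b) (x, y))) /\
    differentiable_pt_lim (fun s t => snd (cps b (s, t))) x y
      (snd (cps (PS_derive b) (x, y))) (fst (cps (PS_derive b) (x, y)))).
  { intros b Hb x y Hz.
    destruct (cps_taylor_bound b (x, y) Hb Hz) as (M & d & HM & Hd & H).
    split; apply (differentiable_pt_lim_quadratic _ _ _ _ _ M d HM Hd); intros u v Huv;
      destruct (H (u, v) Huv) as [H1 H2].
    - eapply Rle_trans; [|exact H1]. right. f_equal.
      cbn -[cps]. unfold Cplus. cbn -[cps]. ring.
    - eapply Rle_trans; [|exact H2]. right. f_equal.
      cbn -[cps]. unfold Cplus. cbn -[cps]. ring. }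
  intros Ha x y Hz.
  assert (Ha' : Rbar_le 1 (CV_radius (PS_derive a))) by (rewrite CV_radius_derive; exact Ha).
  destruct (HD a Ha x y Hz) as [H1 H2]. destruct (HD _ Ha' x y Hz) as [H3 H4].
  repeat split; try assumption; eapply differentiable_pt_lim_continuity; eassumption.
Qed.

(** * Expansion of slice regular functions *)

Lemma quat_ext (p q : quat) :
  re p = re q -> imi p = imi q -> imj p = imj q -> imk p = imk q -> p = q.
Proof. destruct p, q; simpl; intros; subst; reflexivity. Qed.

Ltac qring := apply quat_ext; simpl; ring.

Lemma imag_unit_iff (I : quat) :
  imag_unit I <-> re I = 0 /\ imi I ^ 2 + imj I ^ 2 + imk I ^ 2 = 1.
Proof.
  unfold imag_unit. split.
  - intros H. pose proof (f_equal re H) as H0. pose proof (f_equal imi H) as H1.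
    pose proof (f_equal imj H) as H2. pose proof (f_equal imk H) as H3.
    destruct I as [a b c d]; simpl in *.
    assert (a * b = 0) by lra. assert (a * c = 0) by lra. assert (a * d = 0) by lra.
    (* A nonzero real part would force the imaginary part to vanish, and the square of a real number
       is not -1. *)
    assert (Ha : a = 0).
    { destruct (Req_dec a 0) as [E|E]; [exact E|exfalso].
      assert (b = 0) by (apply (Rmult_eq_reg_l a); [lra|exact E]).
      assert (c = 0) by (apply (Rmult_eq_reg_l a); [lra|exact E]).
      assert (d = 0) by (apply (Rmult_eq_reg_l a); [lra|exact E]).
      subst. nra. }
    subst. split; [reflexivity|]. lra.
  - intros [H0 H1]. destruct I as [a b c d]; simpl in *. subst.
    apply quat_ext; simpl; lra.
Qed.

Definition qnormsq (q : quat) : R := re q ^ 2 + imi q ^ 2 + imj q ^ 2 + imk q ^ 2.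

Lemma qnormsq_ge_0 (q : quat) : 0 <= qnormsq q.
Proof.
  unfold qnormsq. pose proof (pow2_ge_0 (re q)). pose proof (pow2_ge_0 (imi q)).
  pose proof (pow2_ge_0 (imj q)). pose proof (pow2_ge_0 (imk q)). lra.
Qed.

Lemma qnorm_sqr (q : quat) : qnorm q ^ 2 = qnormsq q.
Proof. unfold qnorm. apply pow2_sqrt, qnormsq_ge_0. Qed.

Lemma qnorm_qscal (t : R) (u : quat) : qnorm (qscal t u) = Rabs t * qnorm u.
Proof.
  unfold qnorm. rewrite <- sqrt_Rsqr_abs, <- sqrt_mult_alt by apply Rle_0_sqr.
  f_equal. unfold Rsqr. simpl. ring.
Qed.

Lemma qnormsq_eq_0 (q : quat) : qnormsq q = 0 -> q = 0%H.
Proof.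
  unfold qnormsq. intros H.
  pose proof (pow2_ge_0 (re q)). pose proof (pow2_ge_0 (imi q)).
  pose proof (pow2_ge_0 (imj q)). pose proof (pow2_ge_0 (imk q)).
  apply quat_ext; simpl; apply Rsqr_0_uniq; unfold Rsqr; lra.
Qed.

Lemma qnormsq_pos (q : quat) : q <> 0%H -> 0 < qnormsq q.
Proof.
  intros H. destruct (qnormsq_ge_0 q) as [H1|H1]; [exact H1|].
  exfalso. apply H, qnormsq_eq_0. symmetry. exact H1.
Qed.

Lemma qinv_eq (q : quat) : (/ q)%H = qscal (/ qnormsq q) (qconj q).
Proof. unfold qinv. rewrite qnorm_sqr. reflexivity. Qed.

Lemma qmul_assoc (p q r : quat) : (p * (q * r))%H = (p * q * r)%H.
Proof. qring. Qed.

Lemma qmul_1_l (p : quat) : (1 * p)%H = p.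
Proof. qring. Qed.

Lemma qmul_1_r (p : quat) : (p * 1)%H = p.
Proof. qring. Qed.

Lemma qinv_l (q : quat) : q <> 0%H -> (/ q * q)%H = 1%H.
Proof.
  intros H. apply qnormsq_pos in H. rewrite qinv_eq.
  transitivity (qscal (/ qnormsq q * qnormsq q) 1%H).
  - set (k := (/ qnormsq q)%R). unfold qnormsq. qring.
  - rewrite Rinv_l by lra. qring.
Qed.

Lemma qinv_r (q : quat) : q <> 0%H -> (q * / q)%H = 1%H.
Proof.
  intros H. apply qnormsq_pos in H. rewrite qinv_eq.
  transitivity (qscal (/ qnormsq q * qnormsq q) 1%H).
  - set (k := (/ qnormsq q)%R). unfold qnormsq. qring.
  - rewrite Rinv_l by lra. qring.
Qed.

Lemma qmul_integral (p q : quat) : (p * q)%H = 0%H -> p = 0%H \/ q = 0%H.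
Proof.
  intros H. destruct (excluded_middle_informative (p = 0%H)) as [E|E]; [left; exact E|right].
  rewrite <- (qmul_1_l q), <- (qinv_l p E), <- qmul_assoc, H. qring.
Qed.

Lemma qinv_mul (p q : quat) : p <> 0%H -> q <> 0%H -> (/ (p * q))%H = (/ q * / p)%H.
Proof.
  intros Hp Hq.
  assert (Hpq : (p * q)%H <> 0%H) by (intros H; apply qmul_integral in H; tauto).
  rewrite <- (qmul_1_r (/ (p * q))%H), <- (qinv_r p Hp).
  rewrite <- (qmul_1_l (/ p)%H), <- (qinv_r q Hq) at 1.
  transitivity (/ (p * q) * (p * q) * (/ q * / p))%H.
  - rewrite !qmul_assoc. reflexivity.
  - rewrite (qinv_l _ Hpq), qmul_1_l. reflexivity.
Qed.

Lemma slice_pt_norm (I : quat) (x y : R) : imag_unit I ->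
  qnormsq (slice_pt I x y) = x ^ 2 + y ^ 2.
Proof.
  intros H. apply imag_unit_iff in H. destruct H as [H0 H1].
  unfold qnormsq, slice_pt; simpl. rewrite H0.
  transitivity (x ^ 2 + y ^ 2 * (imi I ^ 2 + imj I ^ 2 + imk I ^ 2)); [|rewrite H1]; ring.
Qed.

Lemma ball1_slice_pt (I : quat) (x y : R) : imag_unit I ->
  ball1 (slice_pt I x y) <-> Cmod (x, y) < 1.
Proof.
  intros H. unfold ball1. change (qnorm ?q) with (sqrt (qnormsq q)).
  rewrite slice_pt_norm by exact H. reflexivity.
Qed.

Lemma imag_unit_sqr_mul (I q : quat) : imag_unit I -> (I * (I * q))%H = (- q)%H.
Proof. intros H. rewrite qmul_assoc, H. qring. Qed.

Lemma slice_pt_eq (I : quat) (x y : R) : imag_unit I ->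
  slice_pt I x y = Quat x (y * imi I) (y * imj I) (y * imk I).
Proof.
  intros H. apply imag_unit_iff in H. destruct H as [H0 H1].
  apply quat_ext; simpl; rewrite ?H0; ring.
Qed.

Lemma slice_pt_mul (I : quat) (u v : C) : imag_unit I ->
  (slice_pt I (fst u) (snd u) * slice_pt I (fst v) (snd v))%H
  = slice_pt I (fst (u * v)%C) (snd (u * v)%C).
Proof.
  intros H. rewrite !slice_pt_eq by exact H. apply imag_unit_iff in H. destruct H as [H0 H1].
  apply quat_ext; simpl; try ring.
  replace (fst u * fst v - snd u * snd v)
    with (fst u * fst v - snd u * snd v * (imi I ^ 2 + imj I ^ 2 + imk I ^ 2)) by (rewrite H1; ring).
  ring.
Qed.

Lemma slice_pt_pow (I : quat) (x y : R) (n : nat) : imag_unit I ->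
  (slice_pt I x y ^ n)%H = slice_pt I (fst ((x, y) ^ n)%C) (snd ((x, y) ^ n)%C).
Proof.
  intros H. induction n as [|n IH].
  - unfold slice_pt; simpl. qring.
  - rewrite Cpow_S. rewrite <- slice_pt_mul by exact H. simpl qpow. rewrite IH. reflexivity.
Qed.

Lemma imag_unit_im_dir (q : quat) : imag_unit (im_dir q).
Proof.
  apply imag_unit_iff. unfold im_dir. destruct (Req_dec_T (im_norm q) 0) as [E|E]; simpl.
  - split; ring.
  - split; [ring|].
    assert (H : im_norm q ^ 2 = imi q ^ 2 + imj q ^ 2 + imk q ^ 2).
    { apply pow2_sqrt. pose proof (pow2_ge_0 (imi q)).
      pose proof (pow2_ge_0 (imj q)). pose proof (pow2_ge_0 (imk q)). lra. }
    transitivity (/ im_norm q ^ 2 * im_norm q ^ 2).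
    + rewrite H at 2. rewrite <- pow_inv. ring.
    + field. exact E.
Qed.

Lemma im_dir_decomposition (q : quat) : slice_pt (im_dir q) (re q) (im_norm q) = q.
Proof.
  unfold im_dir. destruct (Req_dec_T (im_norm q) 0) as [E|E].
  - assert (H : im_norm q ^ 2 = imi q ^ 2 + imj q ^ 2 + imk q ^ 2).
    { apply pow2_sqrt. pose proof (pow2_ge_0 (imi q)).
      pose proof (pow2_ge_0 (imj q)). pose proof (pow2_ge_0 (imk q)). lra. }
    rewrite E in H. pose proof (pow2_ge_0 (imi q)).
    pose proof (pow2_ge_0 (imj q)). pose proof (pow2_ge_0 (imk q)).
    apply quat_ext; simpl; rewrite ?E.
    + ring.
    + transitivity 0; [ring|]. symmetry. apply Rsqr_0_uniq. unfold Rsqr. lra.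
    + transitivity 0; [ring|]. symmetry. apply Rsqr_0_uniq. unfold Rsqr. lra.
    + transitivity 0; [ring|]. symmetry. apply Rsqr_0_uniq. unfold Rsqr. lra.
  - apply quat_ext; simpl; field; exact E.
Qed.

(** * Quaternion series tested against real linear functionals *)

Lemma is_qseries_ext (u v : nat -> quat) (l : quat) :
  (forall n, u n = v n) -> is_qseries u l -> is_qseries v l.
Proof.
  intros H (H0 & H1 & H2 & H3).
  repeat split; eapply is_series_ext; try eassumption; intros n; cbv beta; rewrite H; reflexivity.
Qed.

Lemma is_series_lin4 (u0 u1 u2 u3 : nat -> R) (l0 l1 l2 l3 k0 k1 k2 k3 : R) :
  is_series u0 l0 -> is_series u1 l1 -> is_series u2 l2 -> is_series u3 l3 ->
  is_series (fun n => k0 * u0 n + k1 * u1 n + k2 * u2 n + k3 * u3 n)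
    (k0 * l0 + k1 * l1 + k2 * l2 + k3 * l3).
Proof.
  intros H0 H1 H2 H3.
  exact (is_series_plus (V := R_NormedModule) _ _ _ _
    (is_series_plus (V := R_NormedModule) _ _ _ _
      (is_series_plus (V := R_NormedModule) _ _ _ _
        (is_series_scal k0 _ _ H0) (is_series_scal k1 _ _ H1))
      (is_series_scal k2 _ _ H2)) (is_series_scal k3 _ _ H3)).
Qed.

(* A real linear functional on the quaternions is [q |-> re (q w)] for some [w]. *)
Lemma is_qseries_re_mul (u : nat -> quat) (l w : quat) :
  is_qseries u l -> is_series (fun n => re (u n * w)%H) (re (l * w)%H).
Proof.
  intros (H0 & H1 & H2 & H3).
  pose proof (is_series_lin4 _ _ _ _ _ _ _ _ (re w) (- imi w) (- imj w) (- imk w) H0 H1 H2 H3) as H.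
  evar_last; [eapply is_series_ext; [|exact H]|].
  - intros n. simpl. ring_R.
  - simpl. ring_R.
Qed.

Lemma is_qseries_of_re_mul (u : nat -> quat) (l : quat) :
  (forall w, is_series (fun n => re (u n * w)%H) (re (l * w)%H)) -> is_qseries u l.
Proof.
  intros H. repeat split.
  - evar_last; [eapply is_series_ext; [|exact (H 1%H)]|]; simpl; intros; ring_R.
  - evar_last; [eapply is_series_ext; [|exact (H (Quat 0 (-1) 0 0))]|]; simpl; intros; ring_R.
  - evar_last; [eapply is_series_ext; [|exact (H (Quat 0 0 (-1) 0))]|]; simpl; intros; ring_R.
  - evar_last; [eapply is_series_ext; [|exact (H (Quat 0 0 0 (-1)))]|]; simpl; intros; ring_R.
Qed.

Lemma is_qseries_mul_l (p : quat) (u : nat -> quat) (l : quat) :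
  is_qseries u l -> is_qseries (fun n => p * u n)%H (p * l)%H.
Proof.
  intros H. apply is_qseries_of_re_mul. intros w.
  pose proof (is_qseries_re_mul u l (w * p)%H H) as H1.
  evar_last; [eapply is_series_ext; [|exact H1]|].
  - intros n. simpl. ring_R.
  - simpl. ring_R.
Qed.

(** * From slice regularity to scalar holomorphic functions and a common expansion *)

Lemma ex_qderive_is_derive (g : R -> quat) (t : R) : ex_qderive g t ->
  is_derive (fun s => re (g s)) t (re (qDerive g t)) /\
  is_derive (fun s => imi (g s)) t (imi (qDerive g t)) /\
  is_derive (fun s => imj (g s)) t (imj (qDerive g t)) /\
  is_derive (fun s => imk (g s)) t (imk (qDerive g t)).
Proof. intros (H0 & H1 & H2 & H3). repeat split; apply Derive_correct; assumption. Qed.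

Lemma locally_2d_disc (x y : R) : Cmod (x, y) < 1 ->
  locally_2d (fun s t => Cmod (s, t) < 1) x y.
Proof.
  intros H. assert (Hd : 0 < (1 - Cmod (x, y)) / 2) by lra.
  exists (mkposreal _ Hd). simpl. intros u v Hu Hv.
  replace (u, v) with (Cplus (x, y) (u - x, v - y))
    by (unfold Cplus; apply injective_projections; simpl; ring).
  eapply Rle_lt_trans; [apply Cmod_triangle|].
  pose proof (Cmod_le_sum (u - x, v - y)) as Hc. simpl in Hc. lra.
Qed.

Lemma slice_regular_cauchy_riemann (f : quat -> quat) (I : quat) (x y : R) :
  slice_regular f -> imag_unit I -> Cmod (x, y) < 1 ->
  partial_y f I x y = (I * partial_x f I x y)%H.
Proof.
  intros Hf HI Hz.
  destruct (Hf I HI x y) as (_ & _ & _ & _ & H); [apply ball1_slice_pt; assumption|].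
  set (X := partial_x f I x y) in *. set (Y := partial_y f I x y) in *.
  assert (E : X = (- (I * Y))%H).
  { pose proof (f_equal re H) as H0. pose proof (f_equal imi H) as H1.
    pose proof (f_equal imj H) as H2. pose proof (f_equal imk H) as H3.
    apply quat_ext; simpl in *; lra. }
  transitivity (- (I * (I * Y)))%H.
  - rewrite imag_unit_sqr_mul by exact HI. qring.
  - rewrite E. qring.
Qed.

Lemma slice_regular_differentiable (f : quat -> quat) (I : quat) (x y : R) (w : quat) :
  slice_regular f -> imag_unit I -> Cmod (x, y) < 1 ->
  differentiable_pt_lim (fun s t => re (f (slice_pt I s t) * w)%H) x y
    (re (partial_x f I x y * w)%H) (re (I * partial_x f I x y * w)%H) /\
  continuity_2d_pt (fun s t => re (partial_x f I s t * w)%H) x y.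
Proof.
  intros Hf HI Hz.
  assert (Hloc : locally_2d (fun s t => ex_qderive (fun s => f (slice_pt I s t)) s) x y).
  { apply locally_2d_impl with (2 := locally_2d_disc x y Hz).
    apply locally_2d_forall. intros s t Hst.
    apply (Hf I HI s t). apply ball1_slice_pt; assumption. }
  destruct (Hf I HI x y) as (_ & Ey & (C0 & C1 & C2 & C3) & _ & _); [apply ball1_slice_pt; assumption|].
  apply ex_qderive_is_derive in Ey. destruct Ey as (Y0 & Y1 & Y2 & Y3).
  assert (Hc : forall p : quat -> R,
    (forall g t, ex_qderive g t -> is_derive (fun s => p (g s)) t (p (qDerive g t))) ->
    is_derive (fun t => p (f (slice_pt I x t))) y (p (partial_y f I x y)) ->
    continuity_2d_pt (fun s t => p (partial_x f I s t)) x y ->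
    differentiable_pt_lim (fun s t => p (f (slice_pt I s t))) x y
      (p (partial_x f I x y)) (p (partial_y f I x y))).
  { intros p Hp Hy Hcp.
    apply (C1_differentiable_pt_lim _ (fun s t => p (partial_x f I s t))); [|exact Hy|exact Hcp].
    apply locally_2d_impl with (2 := Hloc). apply locally_2d_forall. intros s t Hst.
    apply (Hp (fun s => f (slice_pt I s t))). exact Hst. }
  pose proof (Hc re (fun g t H => proj1 (ex_qderive_is_derive g t H)) Y0 C0) as D0.
  pose proof (Hc imi (fun g t H => proj1 (proj2 (ex_qderive_is_derive g t H))) Y1 C1) as D1.
  pose proof (Hc imj (fun g t H => proj1 (proj2 (proj2 (ex_qderive_is_derive g t H)))) Y2 C2) as D2.
  pose proof (Hc imk (fun g t H => proj2 (proj2 (proj2 (ex_qderive_is_derive g t H)))) Y3 C3) as D3.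
  rewrite <- (slice_regular_cauchy_riemann f I x y Hf HI Hz).
  split.
  - apply (differentiable_pt_lim_ext (fun s t =>
      re (f (slice_pt I s t)) * re w + imi (f (slice_pt I s t)) * (- imi w)
      + imj (f (slice_pt I s t)) * (- imj w) + imk (f (slice_pt I s t)) * (- imk w))).
    + apply locally_2d_forall. intros s t. simpl. ring.
    + eapply differentiable_pt_lim_eq.
      * repeat apply differentiable_pt_lim_plus;
          (apply differentiable_pt_lim_mult; [eassumption|apply differentiable_pt_lim_const]).
      * simpl. ring.
      * simpl. ring.
  - simpl. continuity_2d.
Qed.

(* [q |-> re (q w) - i re (I q w)] is complex linear for the left action of [R + I R]. *)
Lemma slice_regular_C1_holo (f : quat -> quat) (I w : quat) :
  slice_regular f -> imag_unit I ->
  C1_holo (fun z => (re (f (slice_pt I (fst z) (snd z)) * w)%H,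
                     - re (I * f (slice_pt I (fst z) (snd z)) * w)%H))
          (fun z => (re (partial_x f I (fst z) (snd z) * w)%H,
                     - re (I * partial_x f I (fst z) (snd z) * w)%H)).
Proof.
  intros Hf HI x y Hz.
  destruct (slice_regular_differentiable f I x y w Hf HI Hz) as [D1 C1].
  destruct (slice_regular_differentiable f I x y (w * I) Hf HI Hz) as [D2 C2].
  (* By cyclicity of the real part, the second component is up to sign the first one with [w * I] in
     place of [w]. *)
  assert (Hcyc : forall q, re (q * (w * I))%H = re (I * q * w)%H) by (intros; simpl; ring).
  cbn [fst snd]. split; [|split; [|split]].
  - eapply differentiable_pt_lim_eq; [exact D1|reflexivity|]. ring.
  - apply (differentiable_pt_lim_ext (fun s t => re (f (slice_pt I s t) * (w * I))%H * (-1))).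
    + apply locally_2d_forall. intros s t. rewrite Hcyc. ring.
    + eapply differentiable_pt_lim_eq.
      * apply differentiable_pt_lim_mult; [exact D2|apply differentiable_pt_lim_const].
      * cbv beta. rewrite Hcyc. ring.
      * cbv beta. rewrite Hcyc, imag_unit_sqr_mul by exact HI. simpl. ring.
  - exact C1.
  - apply continuity_2d_pt_opp. eapply continuity_2d_pt_ext; [|exact C2].
    intros s t. apply Hcyc.
Qed.

Lemma slice_pt_real (I : quat) (x : R) : slice_pt I x 0 = qreal x.
Proof. unfold slice_pt. qring. Qed.

Lemma ball1_qreal (x : R) : ball1 (qreal x) <-> Rabs x < 1.
Proof.
  unfold ball1, qnorm; simpl. replace (x * (x * 1) + 0 * (0 * 1) + 0 * (0 * 1) + 0 * (0 * 1)) with (Rsqr x)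
    by (unfold Rsqr; ring).
  rewrite sqrt_Rsqr_abs. reflexivity.
Qed.

(** Every pair of a unit [I] and a functional [w] has its own complex coefficients. All slices share
    the real interval, so the coefficients [a] are read off there from a single unit [I0], and
    uniqueness of real power series forces those of any [(I, w)] to be
    [re (a n w) - i re (I a n w)]. *)
Lemma slice_regular_expansion (f : quat -> quat) :
  slice_regular f -> exists a, has_expansion f a.
Proof.
  intros Hf.
  assert (HP : forall I w, exists c : nat -> C, imag_unit I -> forall z, Cmod z < 1 ->
    is_series (fun n => fst (z ^ n * c n)%C) (re (f (slice_pt I (fst z) (snd z)) * w)%H) /\
    is_series (fun n => snd (z ^ n * c n)%C) (- re (I * f (slice_pt I (fst z) (snd z)) * w)%H)).
  { intros I w. destruct (excluded_middle_informative (imag_unit I)) as [HI|HI].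
    - destruct (power_expansion _ _ (slice_regular_C1_holo f I w Hf HI)) as [c Hc].
      exists c. intros _. exact Hc.
    - exists (fun _ => RtoC 0). contradiction. }
  set (I0 := Quat 0 1 0 0).
  assert (HI0 : imag_unit I0) by (apply imag_unit_iff; simpl; split; ring).
  (* Right multiplication by [1], [-i], [-j], [-k] makes the real part return the four
     coordinates. *)
  destruct (HP I0 1%H) as [c0 H0]. destruct (HP I0 (Quat 0 (-1) 0 0)) as [c1 H1].
  destruct (HP I0 (Quat 0 0 (-1) 0)) as [c2 H2]. destruct (HP I0 (Quat 0 0 0 (-1))) as [c3 H3].
  set (a := fun n => Quat (fst (c0 n)) (fst (c1 n)) (fst (c2 n)) (fst (c3 n))).
  assert (Hreal : forall x, Rabs x < 1 -> is_qseries (fun n => qscal (x ^ n) (a n)) (f (qreal x))).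
  { intros x Hx.
    assert (Hz : Cmod (x, 0) < 1).
    { change (x, 0) with (RtoC x). rewrite Cmod_R. exact Hx. }
    specialize (H0 HI0 _ Hz). specialize (H1 HI0 _ Hz).
    specialize (H2 HI0 _ Hz). specialize (H3 HI0 _ Hz).
    cbn [fst snd] in H0, H1, H2, H3. rewrite slice_pt_real in H0, H1, H2, H3.
    destruct H0 as [H0 _], H1 as [H1 _], H2 as [H2 _], H3 as [H3 _].
    change (x, 0) with (RtoC x) in *.
    split; [|split; [|split]].
    - evar_last; [eapply is_series_ext; [|exact H0]|].
      + intros n. cbv beta; rewrite <- RtoC_pow. simpl. ring_R.
      + simpl. ring_R.
    - evar_last; [eapply is_series_ext; [|exact H1]|].
      + intros n. cbv beta; rewrite <- RtoC_pow. simpl. ring_R.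
      + simpl. ring_R.
    - evar_last; [eapply is_series_ext; [|exact H2]|].
      + intros n. cbv beta; rewrite <- RtoC_pow. simpl. ring_R.
      + simpl. ring_R.
    - evar_last; [eapply is_series_ext; [|exact H3]|].
      + intros n. cbv beta; rewrite <- RtoC_pow. simpl. ring_R.
      + simpl. ring_R. }
  exists a. intros q Hq. apply is_qseries_of_re_mul. intros w.
  set (I := im_dir q). assert (HI : imag_unit I) by apply imag_unit_im_dir.
  destruct (HP I w) as [c Hc]. specialize (Hc HI).
  assert (Ec : forall n, c n = (re (a n * w)%H, - re (I * a n * w)%H)).
  { intros n. apply injective_projections; cbn [fst snd].
    - apply (power_series_unique (fun n => fst (c n)) (fun n => re (a n * w)%H) 1
        (fun x => re (f (qreal x) * w)%H) Rlt_0_1); intros x Hx.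
      + destruct (Hc (RtoC x)) as [S1 _]; [rewrite Cmod_R; exact Hx|].
        change (fst (RtoC x)) with x in S1. change (snd (RtoC x)) with 0 in S1. rewrite slice_pt_real in S1.
        eapply is_series_ext; [|exact S1]. intros m. cbv beta; rewrite <- RtoC_pow. simpl. ring_R.
      + pose proof (is_qseries_re_mul _ _ w (Hreal x Hx)) as S1.
        eapply is_series_ext; [|exact S1]. intros m. simpl. ring_R.
    - apply (power_series_unique (fun n => snd (c n)) (fun n => - re (I * a n * w)%H) 1
        (fun x => - re (I * f (qreal x) * w)%H) Rlt_0_1); intros x Hx.
      + destruct (Hc (RtoC x)) as [_ S1]; [rewrite Cmod_R; exact Hx|].
        change (fst (RtoC x)) with x in S1. change (snd (RtoC x)) with 0 in S1. rewrite slice_pt_real in S1.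
        eapply is_series_ext; [|exact S1]. intros m. cbv beta; rewrite <- RtoC_pow. simpl. ring_R.
      + pose proof (is_qseries_re_mul _ _ (- w)%H (is_qseries_mul_l I _ _ (Hreal x Hx))) as S1.
        evar_last; [eapply is_series_ext; [|exact S1]|].
        * intros m. simpl. ring_R.
        * simpl. ring_R. }
  destruct (Hc (re q, im_norm q)) as [S1 _].
  { apply (ball1_slice_pt I); [exact HI|]. unfold I. rewrite im_dir_decomposition. exact Hq. }
  cbn [fst snd] in S1. unfold I in S1. rewrite im_dir_decomposition in S1.
  eapply is_series_ext; [|exact S1]. intros n.
  cbv beta. rewrite <- (im_dir_decomposition q) at 3. fold I. rewrite slice_pt_pow by exact HI.
  rewrite Ec. unfold slice_pt. simpl. ring_R.
Qed.

(** * Values of expansions on slices *)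

Definition qradius_ge_1 (a : nat -> quat) : Prop :=
  Rbar_le 1 (CV_radius (fun n => re (a n))) /\ Rbar_le 1 (CV_radius (fun n => imi (a n))) /\
  Rbar_le 1 (CV_radius (fun n => imj (a n))) /\ Rbar_le 1 (CV_radius (fun n => imk (a n))).

Lemma qreal_pow (x : R) (n : nat) : (qreal x ^ n)%H = qreal (x ^ n).
Proof.
  induction n as [|n IH]; [reflexivity|]. simpl qpow. rewrite IH. qring.
Qed.

Lemma has_expansion_real (h : quat -> quat) (a : nat -> quat) (x : R) :
  has_expansion h a -> Rabs x < 1 -> is_qseries (fun n => qscal (x ^ n) (a n)) (h (qreal x)).
Proof.
  intros Ha Hx. eapply is_qseries_ext; [|apply Ha, ball1_qreal, Hx].
  intros n. cbv beta. rewrite qreal_pow. qring.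
Qed.

Lemma has_expansion_coordinates (h : quat -> quat) (a : nat -> quat) (x : R) :
  has_expansion h a -> Rabs x < 1 ->
  is_series (fun n => re (a n) * x ^ n) (re (h (qreal x))) /\
  is_series (fun n => imi (a n) * x ^ n) (imi (h (qreal x))) /\
  is_series (fun n => imj (a n) * x ^ n) (imj (h (qreal x))) /\
  is_series (fun n => imk (a n) * x ^ n) (imk (h (qreal x))).
Proof.
  intros Ha Hx. destruct (has_expansion_real h a x Ha Hx) as (H0 & H1 & H2 & H3).
  repeat split; (eapply is_series_ext; [|eassumption]); intros n; simpl; ring_R.
Qed.

Lemma has_expansion_radius (h : quat -> quat) (a : nat -> quat) :
  has_expansion h a -> qradius_ge_1 a.
Proof.
  intros Ha.
  assert (Hx : forall x, 0 <= x < 1 -> Rabs x < 1) by (intros; rewrite Rabs_right; lra).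
  split; [|split; [|split]]; apply CV_radius_ge_1_intro; intros x H;
    destruct (has_expansion_coordinates h a x Ha (Hx x H)) as (H0 & H1 & H2 & H3);
    eexists; eassumption.
Qed.

Lemma has_expansion_unique (h : quat -> quat) (a b : nat -> quat) :
  has_expansion h a -> has_expansion h b -> forall n, a n = b n.
Proof.
  intros Ha Hb n. apply quat_ext.
  - apply (power_series_unique (fun n => re (a n)) (fun n => re (b n)) 1
      (fun x => re (h (qreal x))) Rlt_0_1);
      [exact (fun x Hx => proj1 (has_expansion_coordinates h a x Ha Hx))
      |exact (fun x Hx => proj1 (has_expansion_coordinates h b x Hb Hx))].
  - apply (power_series_unique (fun n => imi (a n)) (fun n => imi (b n)) 1
      (fun x => imi (h (qreal x))) Rlt_0_1);
      [exact (fun x Hx => proj1 (proj2 (has_expansion_coordinates h a x Ha Hx)))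
      |exact (fun x Hx => proj1 (proj2 (has_expansion_coordinates h b x Hb Hx)))].
  - apply (power_series_unique (fun n => imj (a n)) (fun n => imj (b n)) 1
      (fun x => imj (h (qreal x))) Rlt_0_1);
      [exact (fun x Hx => proj1 (proj2 (proj2 (has_expansion_coordinates h a x Ha Hx))))
      |exact (fun x Hx => proj1 (proj2 (proj2 (has_expansion_coordinates h b x Hb Hx))))].
  - apply (power_series_unique (fun n => imk (a n)) (fun n => imk (b n)) 1
      (fun x => imk (h (qreal x))) Rlt_0_1);
      [exact (fun x Hx => proj2 (proj2 (proj2 (has_expansion_coordinates h a x Ha Hx))))
      |exact (fun x Hx => proj2 (proj2 (proj2 (has_expansion_coordinates h b x Hb Hx))))].
Qed.

(** [coeffs] selects some expansion by choice; uniqueness identifies it with any given one. *)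
Lemma coeffs_eq (h : quat -> quat) (a : nat -> quat) :
  has_expansion h a -> forall n, coeffs h n = a n.
Proof.
  intros Ha. apply (has_expansion_unique h); [|exact Ha].
  unfold coeffs. apply epsilon_spec. exists a. exact Ha.
Qed.

Lemma is_qseries_unique (u : nat -> quat) (l : quat) : is_qseries u l -> qSeries u = l.
Proof.
  intros (H0 & H1 & H2 & H3). apply quat_ext; simpl; apply is_series_unique; assumption.
Qed.

Lemma is_qseries_plus (u v : nat -> quat) (l m : quat) :
  is_qseries u l -> is_qseries v m -> is_qseries (fun n => u n + v n)%H (l + m)%H.
Proof.
  intros (H0 & H1 & H2 & H3) (K0 & K1 & K2 & K3).
  repeat split; apply (is_series_plus (V := R_NormedModule)); assumption.
Qed.

(* The sum of [q^n a_n] at [q = x + y I] is [stem_re a z + I stem_im a z] with [z = x + i y],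
   where neither stem depends on [I]. *)
Definition stem_re (a : nat -> quat) (z : C) : quat :=
  Quat (fst (cps (fun n => re (a n)) z)) (fst (cps (fun n => imi (a n)) z))
       (fst (cps (fun n => imj (a n)) z)) (fst (cps (fun n => imk (a n)) z)).

Definition stem_im (a : nat -> quat) (z : C) : quat :=
  Quat (snd (cps (fun n => re (a n)) z)) (snd (cps (fun n => imi (a n)) z))
       (snd (cps (fun n => imj (a n)) z)) (snd (cps (fun n => imk (a n)) z)).

Definition slice_val (a : nat -> quat) (I : quat) (z : C) : quat :=
  (stem_re a z + I * stem_im a z)%H.

Definition to_slice (I : quat) (z : C) : quat := slice_pt I (fst z) (snd z).

Lemma is_qseries_slice_val (a : nat -> quat) (I : quat) (z : C) :
  qradius_ge_1 a -> imag_unit I -> Cmod z < 1 ->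
  is_qseries (fun n => to_slice I z ^ n * a n)%H (slice_val a I z).
Proof.
  intros (R0 & R1 & R2 & R3) HI Hz.
  destruct (is_series_cps _ z R0 Hz), (is_series_cps _ z R1 Hz),
    (is_series_cps _ z R2 Hz), (is_series_cps _ z R3 Hz).
  assert (Hre : is_qseries (fun n => qscal (fst (z ^ n)%C) (a n)) (stem_re a z))
    by (repeat split; assumption).
  assert (Him : is_qseries (fun n => qscal (snd (z ^ n)%C) (a n)) (stem_im a z))
    by (repeat split; assumption).
  eapply is_qseries_ext; [|exact (is_qseries_plus _ _ _ _ Hre (is_qseries_mul_l I _ _ Him))].
  intros n. cbv beta. unfold to_slice. rewrite slice_pt_pow by exact HI.
  rewrite <- surjective_pairing. unfold slice_pt. qring.
Qed.

Lemma has_expansion_slice_val (h : quat -> quat) (a : nat -> quat) (I : quat) (z : C) :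
  has_expansion h a -> imag_unit I -> Cmod z < 1 -> h (to_slice I z) = slice_val a I z.
Proof.
  intros Ha HI Hz.
  rewrite <- (is_qseries_unique _ _
    (is_qseries_slice_val a I z (has_expansion_radius h a Ha) HI Hz)).
  symmetry. apply is_qseries_unique, Ha, ball1_slice_pt; [exact HI|].
  rewrite <- surjective_pairing. exact Hz.
Qed.

Lemma to_slice_surj (q : quat) : ball1 q ->
  exists I z, imag_unit I /\ Cmod z < 1 /\ q = to_slice I z.
Proof.
  intros Hq. exists (im_dir q), (re q, im_norm q).
  pose proof (imag_unit_im_dir q) as HI.
  assert (E : q = to_slice (im_dir q) (re q, im_norm q))
    by (symmetry; apply im_dir_decomposition).
  split; [exact HI|]. split; [|exact E].
  apply (ball1_slice_pt (im_dir q)); [exact HI|]. rewrite im_dir_decomposition. exact Hq.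
Qed.

Lemma ball1_to_slice (I : quat) (z : C) : imag_unit I -> Cmod z < 1 -> ball1 (to_slice I z).
Proof.
  intros HI Hz. apply ball1_slice_pt; [exact HI|]. rewrite <- surjective_pairing. exact Hz.
Qed.

Lemma to_slice_eq_0 (I : quat) (z : C) : imag_unit I -> (to_slice I z = 0%H <-> z = RtoC 0).
Proof.
  intros HI. split.
  - intros H. apply Cmod_eq_0.
    pose proof (slice_pt_norm I (fst z) (snd z) HI) as H1.
    change (slice_pt I (fst z) (snd z)) with (to_slice I z) in H1. rewrite H in H1.
    unfold Cmod. rewrite <- H1. unfold qnormsq. simpl.
    replace (0 * (0 * 1) + 0 * (0 * 1) + 0 * (0 * 1) + 0 * (0 * 1)) with 0 by ring. apply sqrt_0.
  - intros ->. unfold to_slice, slice_pt. qring.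
Qed.

Definition qconv (a b : nat -> quat) (n : nat) : quat :=
  qsum_n (fun k => a k * b (n - k)%nat)%H n.

Lemma cps_lin4 (u0 u1 u2 u3 : nat -> R) (k0 k1 k2 k3 : R) (z : C) :
  Rbar_le 1 (CV_radius u0) -> Rbar_le 1 (CV_radius u1) ->
  Rbar_le 1 (CV_radius u2) -> Rbar_le 1 (CV_radius u3) -> Cmod z < 1 ->
  Rbar_le 1 (CV_radius (fun n => k0 * u0 n + k1 * u1 n + k2 * u2 n + k3 * u3 n)) /\
  cps (fun n => k0 * u0 n + k1 * u1 n + k2 * u2 n + k3 * u3 n) z
  = (RtoC k0 * cps u0 z + RtoC k1 * cps u1 z + RtoC k2 * cps u2 z + RtoC k3 * cps u3 z)%C.
Proof.
  intros H0 H1 H2 H3 Hz.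
  pose proof (CV_radius_ge_1_scal k0 _ H0) as K0. pose proof (CV_radius_ge_1_scal k1 _ H1) as K1.
  pose proof (CV_radius_ge_1_scal k2 _ H2) as K2. pose proof (CV_radius_ge_1_scal k3 _ H3) as K3.
  pose proof (CV_radius_ge_1_plus _ _ K0 K1) as K01.
  pose proof (CV_radius_ge_1_plus _ _ K01 K2) as K012.
  split; [exact (CV_radius_ge_1_plus _ _ K012 K3)|].
  rewrite <- !cps_scal.
  rewrite (cps_plus (fun n => k0 * u0 n + k1 * u1 n + k2 * u2 n) (fun n => k3 * u3 n)) by assumption.
  rewrite (cps_plus (fun n => k0 * u0 n + k1 * u1 n) (fun n => k2 * u2 n)) by assumption.
  rewrite (cps_plus (fun n => k0 * u0 n) (fun n => k1 * u1 n)) by assumption.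
  reflexivity.
Qed.

Lemma PS_mult_lin4 (a0 a1 a2 a3 b0 b1 b2 b3 : nat -> R) (k0 k1 k2 k3 : R) (n : nat) :
  sum_n (fun k => k0 * (a0 k * b0 (n - k)%nat) + k1 * (a1 k * b1 (n - k)%nat)
    + k2 * (a2 k * b2 (n - k)%nat) + k3 * (a3 k * b3 (n - k)%nat)) n
  = k0 * PS_mult a0 b0 n + k1 * PS_mult a1 b1 n + k2 * PS_mult a2 b2 n + k3 * PS_mult a3 b3 n.
Proof.
  rewrite sum_n_Reals. unfold PS_mult. rewrite !scal_sum, <- !sum_plus.
  apply sum_eq. intros; ring.
Qed.

(** This is the product [(B + i C) (B' + i C')] in the complexified quaternions, where [i] is
    central. Each coordinate is a signed sum of four scalar Cauchy products; [key] treats one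
    coordinate, with the signs [k1], [k2], [k3] of the quaternion table. *)
Lemma stem_qconv (a b : nat -> quat) (z : C) :
  qradius_ge_1 a -> qradius_ge_1 b -> Cmod z < 1 ->
  qradius_ge_1 (qconv a b) /\
  stem_re (qconv a b) z = (stem_re a z * stem_re b z - stem_im a z * stem_im b z)%H /\
  stem_im (qconv a b) z = (stem_re a z * stem_im b z + stem_im a z * stem_re b z)%H.
Proof.
  intros (A0 & A1 & A2 & A3) (B0 & B1 & B2 & B3) Hz.
  assert (key : forall (a0 a1 a2 a3 b0 b1 b2 b3 c : nat -> R) (k1 k2 k3 : R),
    (forall n, c n = sum_n (fun k => 1 * (a0 k * b0 (n - k)%nat) + k1 * (a1 k * b1 (n - k)%nat)
      + k2 * (a2 k * b2 (n - k)%nat) + k3 * (a3 k * b3 (n - k)%nat)) n) ->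
    Rbar_le 1 (CV_radius a0) -> Rbar_le 1 (CV_radius a1) ->
    Rbar_le 1 (CV_radius a2) -> Rbar_le 1 (CV_radius a3) ->
    Rbar_le 1 (CV_radius b0) -> Rbar_le 1 (CV_radius b1) ->
    Rbar_le 1 (CV_radius b2) -> Rbar_le 1 (CV_radius b3) ->
    Rbar_le 1 (CV_radius c) /\
    cps c z = (RtoC 1 * (cps a0 z * cps b0 z) + RtoC k1 * (cps a1 z * cps b1 z)
      + RtoC k2 * (cps a2 z * cps b2 z) + RtoC k3 * (cps a3 z * cps b3 z))%C).
  { intros a0 a1 a2 a3 b0 b1 b2 b3 c k1 k2 k3 Hc Ha0 Ha1 Ha2 Ha3 Hb0 Hb1 Hb2 Hb3.
    destruct (cps_lin4 _ _ _ _ 1 k1 k2 k3 z (CV_radius_ge_1_mult a0 b0 Ha0 Hb0)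
      (CV_radius_ge_1_mult a1 b1 Ha1 Hb1) (CV_radius_ge_1_mult a2 b2 Ha2 Hb2)
      (CV_radius_ge_1_mult a3 b3 Ha3 Hb3) Hz) as [K1 K2].
    assert (E : forall n, c n = 1 * PS_mult a0 b0 n + k1 * PS_mult a1 b1 n
      + k2 * PS_mult a2 b2 n + k3 * PS_mult a3 b3 n)
      by (intros n; rewrite Hc; apply PS_mult_lin4).
    rewrite (CV_radius_ext _ _ E), (cps_ext _ _ z E). split; [exact K1|].
    rewrite K2, !cps_mult by assumption. reflexivity. }
  set (a0 := fun n => re (a n)) in *. set (a1 := fun n => imi (a n)) in *.
  set (a2 := fun n => imj (a n)) in *. set (a3 := fun n => imk (a n)) in *.
  set (b0 := fun n => re (b n)) in *. set (b1 := fun n => imi (b n)) in *.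
  set (b2 := fun n => imj (b n)) in *. set (b3 := fun n => imk (b n)) in *.
  destruct (key a0 a1 a2 a3 b0 b1 b2 b3 (fun n => re (qconv a b n)) (-1) (-1) (-1))
    as [R0 E0]; try assumption.
  { intros n. apply sum_n_ext. intros k. unfold a0, a1, a2, a3, b0, b1, b2, b3. simpl. ring_R. }
  destruct (key a0 a1 a2 a3 b1 b0 b3 b2 (fun n => imi (qconv a b n)) 1 1 (-1))
    as [R1 E1]; try assumption.
  { intros n. apply sum_n_ext. intros k. unfold a0, a1, a2, a3, b0, b1, b2, b3. simpl. ring_R. }
  destruct (key a0 a1 a2 a3 b2 b3 b0 b1 (fun n => imj (qconv a b n)) (-1) 1 1)
    as [R2 E2]; try assumption.
  { intros n. apply sum_n_ext. intros k. unfold a0, a1, a2, a3, b0, b1, b2, b3. simpl. ring_R. }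
  destruct (key a0 a1 a2 a3 b3 b2 b1 b0 (fun n => imk (qconv a b n)) 1 (-1) 1)
    as [R3 E3]; try assumption.
  { intros n. apply sum_n_ext. intros k. unfold a0, a1, a2, a3, b0, b1, b2, b3. simpl. ring_R. }
  split; [repeat split; assumption|].
  unfold stem_re, stem_im. rewrite E0, E1, E2, E3.
  fold a0 a1 a2 a3 b0 b1 b2 b3.
  split; apply quat_ext; cbn -[cps]; ring.
Qed.

(** * Regular products and quotients on slices *)

Lemma reg_mul_slice (f g : quat -> quat) (a b : nat -> quat) (I : quat) (z : C) :
  has_expansion f a -> has_expansion g b -> imag_unit I -> Cmod z < 1 ->
  reg_mul f g (to_slice I z) = slice_val (qconv a b) I z.
Proof.
  intros Ha Hb HI Hz.
  destruct (stem_qconv a b z (has_expansion_radius f a Ha) (has_expansion_radius g b Hb) Hz)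
    as [Hr _].
  unfold reg_mul. apply is_qseries_unique.
  eapply is_qseries_ext; [|exact (is_qseries_slice_val _ I z Hr HI Hz)].
  intros n. cbv beta. f_equal. unfold qconv, qsum_n.
  apply quat_ext; simpl; apply sum_n_ext; intros k; rewrite !(coeffs_eq f a Ha), !(coeffs_eq g b Hb);
    reflexivity.
Qed.

(** * The regular conjugate and the rotation of the imaginary unit *)

Lemma stem_qconj (a : nat -> quat) (z : C) :
  stem_re (fun n => qconj (a n)) z = qconj (stem_re a z) /\
  stem_im (fun n => qconj (a n)) z = qconj (stem_im a z).
Proof.
  assert (E : forall u : nat -> R, cps (fun n => - u n) z = (- cps u z)%C).
  { intros u. rewrite (cps_ext _ (fun n => (-1) * u n)) by (intros; ring).
    rewrite cps_scal. apply injective_projections; simpl; ring. }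
  unfold stem_re, stem_im; cbn [re imi imj imk qconj].
  rewrite (E (fun n => imi (a n))), (E (fun n => imj (a n))), (E (fun n => imk (a n))).
  split; reflexivity.
Qed.

Lemma has_expansion_reg_conj (f : quat -> quat) (a : nat -> quat) :
  has_expansion f a -> has_expansion (reg_conj f) (fun n => qconj (a n)).
Proof.
  intros Ha q Hq.
  destruct (to_slice_surj q Hq) as (I & z & HI & Hz & ->).
  assert (Hr : qradius_ge_1 (fun n => qconj (a n))).
  { destruct (has_expansion_radius f a Ha) as (R0 & R1 & R2 & R3).
    assert (Hn : forall u : nat -> R, Rbar_le 1 (CV_radius u) -> Rbar_le 1 (CV_radius (fun n => - u n))).
    { intros u Hu. rewrite (CV_radius_ext _ (fun n => (-1) * u n)) by (intros; ring).
      apply CV_radius_ge_1_scal, Hu. }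
    split; [exact R0|]. split; [|split]; apply Hn; assumption. }
  pose proof (is_qseries_slice_val _ I z Hr HI Hz) as H.
  unfold reg_conj.
  replace (qSeries (fun n => to_slice I z ^ n * qconj (coeffs f n))%H)
    with (slice_val (fun n => qconj (a n)) I z); [exact H|].
  symmetry. apply is_qseries_unique. eapply is_qseries_ext; [|exact H].
  intros n. cbv beta. rewrite (coeffs_eq f a Ha). reflexivity.
Qed.

(* With [p = conj B + I conj C], the value at [I] of the stem product [conj F * G] is [p] times the
   value of [G] at the rotated unit [J]. *)
Lemma stem_conj_mul (I J p B C B' C' : quat) :
  p = (qconj B + I * qconj C)%H -> (p * J)%H = (I * p)%H -> imag_unit I ->
  ((qconj B * B' - qconj C * C') + I * (qconj B * C' + qconj C * B'))%H = (p * (B' + J * C'))%H.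
Proof.
  intros Hp HJ HI.
  transitivity (p * B' + I * p * C')%H.
  - rewrite Hp. transitivity (qconj B * B' + (I * I) * (qconj C * C') + I * (qconj B * C' + qconj C * B'))%H.
    + rewrite HI. qring.
    + qring.
  - rewrite <- HJ. qring.
Qed.

(** The stems of the symmetrization are the real numbers [|B|^2 - |C|^2] and [2 re (B conj C)],
    which are the same for [f * f^c] and [f^c * f]. The second form has the factor [f^c] on the
    left, as the quotient requires. *)
Lemma stem_sym_comm (I B C : quat) :
  ((B * qconj B - C * qconj C) + I * (B * qconj C + C * qconj B))%H
  = ((qconj B * B - qconj C * C) + I * (qconj B * C + qconj C * B))%H.
Proof. qring. Qed.

Lemma imag_unit_conj (I p : quat) : imag_unit I -> p <> 0%H -> imag_unit (/ p * I * p)%H.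
Proof.
  intros HI Hp. unfold imag_unit.
  transitivity (/ p * I * (p * / p) * I * p)%H; [rewrite !qmul_assoc; reflexivity|].
  rewrite (qinv_r p Hp), qmul_1_r.
  transitivity (/ p * (I * I) * p)%H; [rewrite !qmul_assoc; reflexivity|].
  rewrite HI. transitivity (qscal (-1) (/ p * p))%H; [qring|].
  rewrite (qinv_l p Hp). qring.
Qed.

(* [v p] is the value at [J] of a stem with real coefficients, so it commutes with [J]. *)
Lemma stem_rotated_product (I J v B C : quat) :
  v = (B + J * C)%H -> (v * I)%H = (J * v)%H -> imag_unit J ->
  (v * (qconj B + I * qconj C))%H
  = (qreal (qnormsq B - qnormsq C) + J * qreal (2 * re (B * qconj C)%H))%H.
Proof.
  intros Hv HvI HJ.
  transitivity (v * qconj B + v * I * qconj C)%H; [clear; qring|].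
  rewrite HvI, Hv.
  transitivity (B * qconj B + J * J * (C * qconj C) + J * (C * qconj B + B * qconj C))%H;
    [clear; qring|].
  rewrite HJ. clear. unfold qnormsq. qring.
Qed.

Lemma qmul_cancel_l (v p q : quat) : v <> 0%H -> (v * p)%H = (v * q)%H -> p = q.
Proof.
  intros Hv H. rewrite <- (qmul_1_l p), <- (qmul_1_l q), <- (qinv_l v Hv), <- !qmul_assoc, H.
  reflexivity.
Qed.

(** Conjugating a vanishing value gives [B = C I]. If [C] is not zero, then [J = - C I C^(-1)] is an
    imaginary unit with [B + J C = 0]; if [C = 0], then [B = 0] as well. So a zero of the regular
    conjugate forces a zero of [f] on the same sphere. *)
Lemma stem_conj_neq_0 (I B C : quat) : imag_unit I ->
  (forall J, imag_unit J -> (B + J * C)%H <> 0%H) -> (qconj B + I * qconj C)%H <> 0%H.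
Proof.
  intros HI H Hp.
  assert (HB : B = (C * I)%H).
  { apply imag_unit_iff in HI. destruct HI as [HI _].
    pose proof (f_equal re Hp) as H0. pose proof (f_equal imi Hp) as H1.
    pose proof (f_equal imj Hp) as H2. pose proof (f_equal imk Hp) as H3.
    apply quat_ext; simpl in *; rewrite HI in *; lra. }
  destruct (excluded_middle_informative (C = 0%H)) as [E|E].
  - apply (H I HI). rewrite HB, E. qring.
  - apply (H (- (C * I * / C))%H).
    + pose proof (imag_unit_conj I (/ C)%H HI) as HJ.
      assert (Hi : (/ C)%H <> 0%H).
      { intros Hc. pose proof (qinv_l C E) as HC. rewrite Hc in HC.
        apply (f_equal re) in HC. simpl in HC. lra. }
      specialize (HJ Hi).
      assert (EC : (/ / C)%H = C).
      { rewrite <- (qmul_1_r (/ / C)%H), <- (qinv_l C E), qmul_assoc, (qinv_l _ Hi). qring. }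
      rewrite EC in HJ. unfold imag_unit in *. rewrite <- HJ. qring.
    + rewrite HB. transitivity (C * I - C * I * (/ C * C))%H.
      * rewrite !qmul_assoc. qring.
      * rewrite (qinv_l C E). qring.
Qed.

Lemma slice_val_neq_0 (f : quat -> quat) (a : nat -> quat) (J : quat) (z : C) :
  has_expansion f a ->
  (forall q : quat, ball1 q -> (f q = 0%H <-> q = 0%H)) ->
  imag_unit J -> Cmod z < 1 -> z <> 0 -> slice_val a J z <> 0%H.
Proof.
  intros Ha f_zeros HJ Hz Hz0 H. apply Hz0, (to_slice_eq_0 J z HJ).
  apply f_zeros; [apply ball1_to_slice; assumption|].
  rewrite (has_expansion_slice_val f a J z Ha HJ Hz). exact H.
Qed.

Lemma conj_slice_val_neq_0 (f : quat -> quat) (a : nat -> quat) (I : quat) (z : C) :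
  has_expansion f a ->
  (forall q : quat, ball1 q -> (f q = 0%H <-> q = 0%H)) ->
  imag_unit I -> Cmod z < 1 -> z <> 0 -> slice_val (fun n => qconj (a n)) I z <> 0%H.
Proof.
  intros Ha f_zeros HI Hz Hz0. unfold slice_val. destruct (stem_qconj a z) as [-> ->].
  apply stem_conj_neq_0; [exact HI|]. intros J HJ. apply (slice_val_neq_0 f a); assumption.
Qed.

Lemma reg_sym_slice (f : quat -> quat) (a : nat -> quat) (I : quat) (z : C) :
  has_expansion f a ->
  imag_unit I -> Cmod z < 1 ->
  reg_sym f (to_slice I z)
  = ((qconj (stem_re a z) * stem_re a z - qconj (stem_im a z) * stem_im a z)
     + I * (qconj (stem_re a z) * stem_im a z + qconj (stem_im a z) * stem_re a z))%H.
Proof.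
  intros Ha HI Hz. unfold reg_sym.
  pose proof (has_expansion_reg_conj f a Ha) as Hc.
  rewrite (reg_mul_slice f (reg_conj f) a (fun n => qconj (a n))) by assumption.
  destruct (stem_qconv a (fun n => qconj (a n)) z (has_expansion_radius _ _ Ha)
    (has_expansion_radius _ _ Hc) Hz) as (_ & E1 & E2).
  destruct (stem_qconj a z) as [E3 E4].
  unfold slice_val. rewrite E1, E2, E3, E4. apply stem_sym_comm.
Qed.

Lemma reg_conj_mul_slice (f g : quat -> quat) (a b : nat -> quat) (I : quat) (z : C) :
  has_expansion f a ->
  has_expansion g b ->
  imag_unit I -> Cmod z < 1 ->
  reg_mul (reg_conj f) g (to_slice I z)
  = ((qconj (stem_re a z) * stem_re b z - qconj (stem_im a z) * stem_im b z)
     + I * (qconj (stem_re a z) * stem_im b z + qconj (stem_im a z) * stem_re b z))%H.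
Proof.
  intros Ha Hb HI Hz.
  pose proof (has_expansion_reg_conj f a Ha) as Hc.
  rewrite (reg_mul_slice (reg_conj f) g (fun n => qconj (a n)) b) by assumption.
  destruct (stem_qconv (fun n => qconj (a n)) b z (has_expansion_radius _ _ Hc)
    (has_expansion_radius _ _ Hb) Hz) as (_ & E1 & E2).
  destruct (stem_qconj a z) as [E3 E4].
  unfold slice_val. rewrite E1, E2, E3, E4. reflexivity.
Qed.

(** At [I], the symmetrization and [f^c * g] both factor as the same [p], the value of [f^c], times
    the value of [f] respectively [g] at [J]; in the quotient [p] cancels. *)
Lemma reg_recip_mul_rotate (f g : quat -> quat) (a b : nat -> quat) (I J : quat) (z : C) :
  has_expansion f a ->
  has_expansion g b ->
  (forall q : quat, ball1 q -> (f q = 0%H <-> q = 0%H)) ->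
  imag_unit I -> imag_unit J -> Cmod z < 1 -> z <> 0 ->
  (slice_val (fun n => qconj (a n)) I z * J)%H = (I * slice_val (fun n => qconj (a n)) I z)%H ->
  reg_recip_mul f g (to_slice I z) = (/ f (to_slice J z) * g (to_slice J z))%H.
Proof.
  intros Ha Hb f_zeros HI HJ Hz Hz0 Hrot.
  pose proof (conj_slice_val_neq_0 f a I z Ha f_zeros HI Hz Hz0) as Hp.
  pose proof (slice_val_neq_0 f a J z Ha f_zeros HJ Hz Hz0) as Hv.
  unfold reg_recip_mul.
  rewrite (reg_sym_slice f a), (reg_conj_mul_slice f g a b) by assumption.
  rewrite (has_expansion_slice_val f a J z), (has_expansion_slice_val g b J z) by assumption.
  assert (Ep : slice_val (fun n => qconj (a n)) I z
    = (qconj (stem_re a z) + I * qconj (stem_im a z))%H).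
  { unfold slice_val. destruct (stem_qconj a z) as [-> ->]. reflexivity. }
  set (p := slice_val (fun n => qconj (a n)) I z) in *.
  rewrite !(stem_conj_mul I J p) by assumption.
  fold (slice_val a J z). fold (slice_val b J z).
  rewrite (qinv_mul p _ Hp Hv).
  transitivity (/ slice_val a J z * (/ p * p) * slice_val b J z)%H;
    [rewrite !qmul_assoc; reflexivity|].
  rewrite (qinv_l p Hp), qmul_1_r. reflexivity.
Qed.

Lemma reg_sym_neq_0 (f : quat -> quat) (a : nat -> quat) (I : quat) (z : C) :
  has_expansion f a ->
  (forall q : quat, ball1 q -> (f q = 0%H <-> q = 0%H)) ->
  imag_unit I -> Cmod z < 1 -> z <> 0 -> reg_sym f (to_slice I z) <> 0%H.
Proof.
  intros Ha f_zeros HI Hz Hz0.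
  pose proof (conj_slice_val_neq_0 f a I z Ha f_zeros HI Hz Hz0) as Hp.
  assert (Ep : slice_val (fun n => qconj (a n)) I z
    = (qconj (stem_re a z) + I * qconj (stem_im a z))%H).
  { unfold slice_val. destruct (stem_qconj a z) as [-> ->]. reflexivity. }
  rewrite (reg_sym_slice f a) by assumption.
  set (p := slice_val (fun n => qconj (a n)) I z) in *.
  rewrite (stem_conj_mul I (/ p * I * p)%H p);
    [|exact Ep|rewrite !qmul_assoc, (qinv_r p Hp), qmul_1_l; reflexivity|exact HI].
  intros H. apply qmul_integral in H. destruct H as [H|H]; [exact (Hp H)|].
  revert H. apply (slice_val_neq_0 f a); auto using imag_unit_conj.
Qed.

Lemma reg_recip_mul_to_pointwise (f g : quat -> quat) (a b : nat -> quat) (I : quat) (z : C) :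
  has_expansion f a ->
  has_expansion g b ->
  (forall q : quat, ball1 q -> (f q = 0%H <-> q = 0%H)) ->
  imag_unit I -> Cmod z < 1 -> z <> 0 ->
  exists J, imag_unit J /\
    reg_recip_mul f g (to_slice I z) = (/ f (to_slice J z) * g (to_slice J z))%H.
Proof.
  intros Ha Hb f_zeros HI Hz Hz0. pose proof (conj_slice_val_neq_0 f a I z Ha f_zeros HI Hz Hz0) as Hp.
  set (p := slice_val (fun n => qconj (a n)) I z) in *.
  exists (/ p * I * p)%H.
  pose proof (imag_unit_conj I p HI Hp) as HJ. split; [exact HJ|].
  apply (reg_recip_mul_rotate f g a b); try assumption. fold p.
  rewrite !qmul_assoc, (qinv_r p Hp), qmul_1_l. reflexivity.
Qed.

(** Here [p] depends on the unknown [I], so [p J = I p] cannot be solved for [I] by conjugating with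
    [p]. The choice [I = v^(-1) J v], with [v] the value of [f] at [J], works: [v p] is the value of
    the symmetrization at [J] and commutes with [J], so [v p J = J v p = v I p], and [v] cancels. *)
Lemma pointwise_to_reg_recip_mul (f g : quat -> quat) (a b : nat -> quat) (J : quat) (z : C) :
  has_expansion f a ->
  has_expansion g b ->
  (forall q : quat, ball1 q -> (f q = 0%H <-> q = 0%H)) ->
  imag_unit J -> Cmod z < 1 -> z <> 0 ->
  exists I, imag_unit I /\
    reg_recip_mul f g (to_slice I z) = (/ f (to_slice J z) * g (to_slice J z))%H.
Proof.
  intros Ha Hb f_zeros HJ Hz Hz0. pose proof (slice_val_neq_0 f a J z Ha f_zeros HJ Hz Hz0) as Hv.
  set (v := slice_val a J z) in *.
  pose proof (imag_unit_conj J v HJ Hv) as HI. set (I := (/ v * J * v)%H) in *.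
  exists I. split; [exact HI|].
  apply (reg_recip_mul_rotate f g a b); try assumption.
  unfold slice_val. destruct (stem_qconj a z) as [-> ->].
  set (B := stem_re a z) in *. set (C := stem_im a z) in *.
  set (p := (qconj B + I * qconj C)%H).
  assert (HvI : (v * I)%H = (J * v)%H).
  { unfold I. rewrite !qmul_assoc, (qinv_r v Hv), qmul_1_l. reflexivity. }
  pose proof (stem_rotated_product I J v B C eq_refl HvI HJ) as Hvp. fold p in Hvp.
  assert (E : (v * (p * J))%H = (v * (I * p))%H).
  { rewrite (qmul_assoc v I p), HvI, <- (qmul_assoc J v p), (qmul_assoc v p J), Hvp.
    clear. generalize (qnormsq B - qnormsq C) (2 * re (B * qconj C)%H). intros s t. qring. }
  exact (qmul_cancel_l v _ _ Hv E).
Qed.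

(** On a ray, [re (f (t u) w)] is a real power series in [t] with coefficients [re (u^n a_n w)] and
    can be differentiated termwise. The vector [u] need not have norm one: the lemma serves both for
    rays from the origin and for [u = q] at [r = 1]. *)
Lemma is_derive_radial (f : quat -> quat) (a : nat -> quat) (u w : quat) (r : R) :
  has_expansion f a -> 0 < r -> ball1 (qscal r u) ->
  exists d, is_derive (fun t => re (f (qscal t u) * w)%H) r d /\
    is_series (fun n => re (qscal r u ^ n * qscal (INR n) (a n) * w)%H) (r * d).
Proof.
  intros Ha Hr Hq.
  pose proof (fun t => qnorm_qscal t u) as Hn.
  assert (Hu : 0 <= qnorm u) by apply sqrt_pos.
  unfold ball1 in Hq. rewrite Hn, Rabs_right in Hq by lra.
  assert (HT : exists T, r < T /\ T * qnorm u < 1).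
  { exists (r + (1 - r * qnorm u) / (2 * (1 + qnorm u))).
    assert (0 < (1 - r * qnorm u) / (2 * (1 + qnorm u))) by (apply Rdiv_lt_0_compat; lra).
    split; [lra|].
    assert ((1 - r * qnorm u) / (2 * (1 + qnorm u)) * qnorm u
      <= (1 - r * qnorm u) / (2 * (1 + qnorm u)) * (1 + qnorm u)) by (apply Rmult_le_compat_l; lra).
    assert ((1 - r * qnorm u) / (2 * (1 + qnorm u)) * (1 + qnorm u) = (1 - r * qnorm u) / 2)
      by (field; lra).
    nra. }
  destruct HT as (T & HrT & HT).
  set (A := fun n => re (u ^ n * a n * w)%H).
  assert (Hpow : forall t n, (qscal t u ^ n)%H = qscal (t ^ n) (u ^ n)%H).
  { intros t n. induction n as [|n IH]; simpl qpow; [|rewrite IH]; qring. }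
  assert (HA : forall t, Rabs t < T -> is_series (fun n => A n * t ^ n) (re (f (qscal t u) * w)%H)).
  { intros t Ht.
    assert (Hb : ball1 (qscal t u)) by (unfold ball1; rewrite Hn; nra).
    pose proof (is_qseries_re_mul _ _ w (Ha _ Hb)) as H.
    eapply is_series_ext; [|exact H].
    intros n. unfold A. cbv beta. rewrite Hpow. simpl. ring_R. }
  assert (HR : Rbar_lt (Rabs r) (CV_radius A)).
  { apply Rbar_lt_le_trans with T; [simpl; rewrite Rabs_right; lra|].
    apply (CV_radius_ge A T (fun t => re (f (qscal t u) * w)%H)).
    intros x Hx. apply HA. rewrite Rabs_right; lra. }
  exists (PSeries (PS_derive A) r). split.
  - apply (is_derive_ext_loc (PSeries A)); [|apply is_derive_PSeries, HR].
    assert (Hd : 0 < Rmin r (T - r)) by (apply Rmin_pos; lra).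
    exists (mkposreal _ Hd). intros t Ht. apply is_series_unique, HA.
    assert (Ht' : Rabs (t - r) < Rmin r (T - r)) by exact Ht.
    pose proof (Rmin_l r (T - r)). pose proof (Rmin_r r (T - r)).
    apply Rabs_def2 in Ht'. rewrite Rabs_right; lra.
  - assert (H : is_series (fun n => PS_derive A n * r ^ n) (PSeries (PS_derive A) r)).
    { apply Series_correct, (proj1 (ex_pseries_R (PS_derive A) r)), ex_pseries_derive, HR. }
    apply (is_series_scal r) in H.
    (* The term of index 0 carries the factor [INR 0], so the derived series times [r] is the full
       series shifted by one. *)
    apply is_series_decr_1.
    evar_last; [eapply is_series_ext; [|exact H]|].
    + intros n. unfold PS_derive, A. rewrite Hpow. unfold scal; simpl scal; unfold mult.
      cbn -[INR qpow pow]. simpl pow. simpl mult. ring_R.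
    + unfold plus, opp, scal; simpl. unfold mult; simpl. ring_R.
Qed.

(** * Radial derivatives *)

Lemma slice_derive_partial (f : quat -> quat) (q : quat) :
  slice_regular f -> ball1 q ->
  slice_derive f q = partial_x f (im_dir q) (re q) (im_norm q).
Proof.
  intros Hf Hq. unfold slice_derive.
  pose proof (imag_unit_im_dir q) as HI.
  rewrite slice_regular_cauchy_riemann; [|exact Hf|exact HI|].
  - rewrite imag_unit_sqr_mul by exact HI.
    generalize (partial_x f (im_dir q) (re q) (im_norm q)). intros X.
    apply quat_ext; simpl; field.
  - apply (ball1_slice_pt (im_dir q)); [exact HI|]. rewrite im_dir_decomposition. exact Hq.
Qed.

(** The derivative of [t -> f (t q)] at [t = 1] is computed twice. Termwise it is the sum of
    [q^n n a_n]; by the chain rule and Cauchy-Riemann it is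
    [x f_x + y f_y = (x + y I) f_x = q f'(q)]. *)
Lemma has_expansion_mul_slice_derive (f : quat -> quat) (a : nat -> quat) :
  slice_regular f -> has_expansion f a ->
  has_expansion (fun p => p * slice_derive f p)%H (fun n => qscal (INR n) (a n)).
Proof.
  intros Hf Ha q Hq. apply is_qseries_of_re_mul. intros w.
  assert (E1 : qscal 1 q = q) by qring.
  destruct (is_derive_radial f a q w 1 Ha Rlt_0_1) as (d & Hd & Hs); [rewrite E1; exact Hq|].
  rewrite E1, Rmult_1_l in Hs.
  replace (re (q * slice_derive f q * w)%H) with d; [exact Hs|].
  rewrite slice_derive_partial by assumption.
  pose proof (imag_unit_im_dir q) as HI. pose proof (im_dir_decomposition q) as HD.
  set (I := im_dir q) in *. set (x := re q) in *. set (y := im_norm q) in *.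
  assert (Hz : Cmod (x, y) < 1) by (apply (ball1_slice_pt I); [exact HI | rewrite HD; exact Hq]).
  destruct (slice_regular_differentiable f I x y w Hf HI Hz) as [D1 _].
  assert (D2 : differentiable_pt_lim (fun s t => re (f (slice_pt I s t) * w)%H) (1 * x) (1 * y)
    (re (partial_x f I x y * w)%H) (re (I * partial_x f I x y * w)%H)).
  { rewrite !Rmult_1_l. exact D1. }
  assert (dx : derivable_pt_lim (fun t => t * x) 1 x).
  { apply is_derive_Reals. auto_derive; auto. ring. }
  assert (dy : derivable_pt_lim (fun t => t * y) 1 y).
  { apply is_derive_Reals. auto_derive; auto. ring. }
  pose proof (derivable_pt_lim_comp_2d _ (fun t => t * x) (fun t => t * y) _ _ _ _ _ D2 dx dy) as D3.
  apply is_derive_Reals in D3. apply is_derive_unique in D3. apply is_derive_unique in Hd.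
  rewrite <- Hd.
  transitivity (Derive (fun t => re (f (slice_pt I (t * x) (t * y)) * w)%H) 1).
  - apply Derive_ext. intros t. do 3 f_equal. rewrite <- HD. unfold slice_pt. qring.
  - rewrite D3. rewrite <- HD. unfold slice_pt. simpl. ring.
Qed.

Lemma expansion_at_0 (f : quat -> quat) (a : nat -> quat) :
  has_expansion f a -> f 0%H = a O /\ partial_x f (im_dir 0%H) 0 0 = a 1%nat.
Proof.
  intros Ha.
  assert (key : forall (p : quat -> R) (A : nat -> R), (forall x, Rabs x < 1 ->
    is_series (fun n => A n * x ^ n) (p (f (qreal x)))) ->
    p (f 0%H) = A O /\ Derive (fun s => p (f (slice_pt (im_dir 0%H) s 0))) 0 = A 1%nat).
  { intros p A H.
    assert (E : forall x, Rabs x < 1 -> PSeries A x = p (f (qreal x)))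
      by (intros x Hx; apply is_series_unique, H, Hx).
    split.
    - rewrite <- (E 0) by (rewrite Rabs_R0; lra). apply PSeries_0.
    - apply is_derive_unique. apply (is_derive_ext_loc (PSeries A)).
      + exists (mkposreal _ Rlt_0_1). intros x Hx.
        rewrite slice_pt_real. apply E.
        replace x with (x - 0) by ring. exact Hx.
      + evar_last; [apply is_derive_PSeries|].
        * apply Rbar_lt_le_trans with 1; [simpl; rewrite Rabs_R0; lra|].
          apply (CV_radius_ge A 1 (fun x => p (f (qreal x)))). intros x Hx. apply H.
          rewrite Rabs_right; lra.
        * rewrite PSeries_0. unfold PS_derive. simpl. ring_R. }
  destruct (key re _ (fun x Hx => proj1 (has_expansion_coordinates f a x Ha Hx))).
  destruct (key imi _ (fun x Hx => proj1 (proj2 (has_expansion_coordinates f a x Ha Hx)))).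
  destruct (key imj _ (fun x Hx => proj1 (proj2 (proj2 (has_expansion_coordinates f a x Ha Hx))))).
  destruct (key imk _ (fun x Hx => proj2 (proj2 (proj2 (has_expansion_coordinates f a x Ha Hx))))).
  split; apply quat_ext; assumption.
Qed.

Lemma im_norm_0 : im_norm 0%H = 0.
Proof.
  unfold im_norm; simpl. replace (0 * (0 * 1) + 0 * (0 * 1) + 0 * (0 * 1)) with 0 by ring.
  apply sqrt_0.
Qed.

Lemma ball1_0 : ball1 0%H.
Proof. apply ball1_qreal. rewrite Rabs_R0. lra. Qed.

Lemma slice_derive_0 (f : quat -> quat) (a : nat -> quat) :
  slice_regular f -> has_expansion f a -> slice_derive f 0%H = a 1%nat.
Proof.
  intros Hf Ha. rewrite slice_derive_partial by (assumption || apply ball1_0).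
  rewrite im_norm_0. apply (expansion_at_0 f a Ha).
Qed.

Lemma re_inv_mul (p q : quat) :
  re (/ p * q)%H = (re p * re q + imi p * imi q + imj p * imj q + imk p * imk q) / qnormsq p.
Proof.
  rewrite qinv_eq. generalize (qnormsq p). intros n. simpl. unfold Rdiv. ring.
Qed.

(** The function is twice the logarithm of [|f (t u)| / t^alpha], the doubling sparing the square
    root. Each coordinate of [f (t u)] has the matching coordinate of [g / r] as derivative, so
    [|f|^2] has derivative [2 / r] times the inner product of [f] and [g], and [re_inv_mul]
    recognizes the quotient. *)
Lemma is_derive_radial_log (f g : quat -> quat) (a : nat -> quat) (u : quat) (r alpha : R) :
  has_expansion f a -> has_expansion g (fun n => qscal (INR n) (a n)) ->
  0 < r -> ball1 (qscal r u) -> f (qscal r u) <> 0%H ->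
  is_derive (fun t => ln (qnormsq (f (qscal t u))) - 2 * alpha * ln t) r
    (2 / r * (re (/ f (qscal r u) * g (qscal r u))%H - alpha)).
Proof.
  intros Ha Hg Hr Hq H0.
  assert (Hw : forall w, is_derive (fun t => re (f (qscal t u) * w)%H) r
    (re (g (qscal r u) * w)%H / r)).
  { intros w. destruct (is_derive_radial f a u w r Ha Hr Hq) as (d & Hd & Hs).
    pose proof (is_qseries_re_mul _ _ w (Hg _ Hq)) as Hs'.
    apply is_series_unique in Hs. apply is_series_unique in Hs'.
    assert (Ed : r * d = re (g (qscal r u) * w)%H) by (rewrite <- Hs, <- Hs'; reflexivity).
    evar_last; [exact Hd|].
    rewrite <- Ed. apply (Rmult_eq_reg_l r); [|lra]. unfold Rdiv. rewrite (Rmult_comm r (r * d * / r)).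
    rewrite Rmult_assoc, Rinv_l by lra. ring_R. }
  assert (D0 : is_derive (fun t => re (f (qscal t u))) r (re (g (qscal r u)) / r)).
  { apply (is_derive_ext (fun t => re (f (qscal t u) * 1)%H)); [intros; rewrite qmul_1_r; reflexivity|].
    rewrite <- (qmul_1_r (g (qscal r u))). apply Hw. }
  assert (D1 : is_derive (fun t => imi (f (qscal t u))) r (imi (g (qscal r u)) / r)).
  { apply (is_derive_ext (fun t => re (f (qscal t u) * Quat 0 (-1) 0 0)%H)); [intros; simpl; ring_R|].
    evar_last; [apply Hw|]. simpl. unfold Rdiv. ring_R. }
  assert (D2 : is_derive (fun t => imj (f (qscal t u))) r (imj (g (qscal r u)) / r)).
  { apply (is_derive_ext (fun t => re (f (qscal t u) * Quat 0 0 (-1) 0)%H)); [intros; simpl; ring_R|].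
    evar_last; [apply Hw|]. simpl. unfold Rdiv. ring_R. }
  assert (D3 : is_derive (fun t => imk (f (qscal t u))) r (imk (g (qscal r u)) / r)).
  { apply (is_derive_ext (fun t => re (f (qscal t u) * Quat 0 0 0 (-1))%H)); [intros; simpl; ring_R|].
    evar_last; [apply Hw|]. simpl. unfold Rdiv. ring_R. }
  assert (Hsq : forall (h : R -> R) (d : R), is_derive h r d -> is_derive (fun t => h t ^ 2) r (2 * h r * d)).
  { intros h d Hh. evar_last; [apply (is_derive_pow h 2 r d Hh)|]. simpl. ring_R. }
  assert (Hm : is_derive (fun t => qnormsq (f (qscal t u))) r
    (2 / r * (re (f (qscal r u)) * re (g (qscal r u)) + imi (f (qscal r u)) * imi (g (qscal r u))
      + imj (f (qscal r u)) * imj (g (qscal r u)) + imk (f (qscal r u)) * imk (g (qscal r u))))).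
  { unfold qnormsq.
    evar_last.
    - exact (is_derive_plus _ _ _ _ _ (is_derive_plus _ _ _ _ _ (is_derive_plus _ _ _ _ _
        (Hsq _ _ D0) (Hsq _ _ D1)) (Hsq _ _ D2)) (Hsq _ _ D3)).
    - unfold plus; simpl. unfold Rdiv. ring_R. }
  pose proof (qnormsq_pos _ H0) as Hpos.
  evar_last.
  - apply (is_derive_minus (fun t => ln (qnormsq (f (qscal t u)))) (fun t => 2 * alpha * ln t)).
    + apply (is_derive_comp ln (fun t => qnormsq (f (qscal t u)))); [|exact Hm].
      apply is_derive_ln. exact Hpos.
    + apply is_derive_scal. apply is_derive_ln. exact Hr.
  - rewrite re_inv_mul. unfold minus, plus, opp, scal; simpl. unfold mult; simpl.
    match goal with |- @eq _ ?x ?y => change (@eq R x y) end.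
    field. split; lra.
Qed.

Lemma is_derive_ge_0 (f : R -> R) (x l b : R) :
  x < b -> is_derive f x l -> (forall y, x < y < b -> f x <= f y) -> 0 <= l.
Proof.
  intros Hb Hd Hle. apply Rnot_lt_le. intros Hl.
  apply is_derive_Reals in Hd.
  assert (He : 0 < - l / 2) by lra.
  destruct (Hd (- l / 2) He) as [d Hd'].
  set (h := Rmin (d / 2) ((b - x) / 2)).
  pose proof (cond_pos d) as Hdp.
  assert (Hh : 0 < h) by (apply Rmin_pos; lra).
  assert (h <= d / 2) by apply Rmin_l. assert (h <= (b - x) / 2) by apply Rmin_r.
  assert (Hh0 : h <> 0) by lra.
  assert (Hhd : Rabs h < d) by (rewrite Rabs_right; lra).
  specialize (Hd' h Hh0 Hhd). apply Rabs_def2 in Hd'.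
  assert (Hy : f x <= f (x + h)) by (apply Hle; lra).
  assert (0 <= (f (x + h) - f x) / h).
  { apply Rmult_le_pos; [lra|]. left. apply Rinv_0_lt_compat, Hh. }
  lra.
Qed.

Lemma growth_lt_iff (m n r s alpha : R) : 0 < m -> 0 < n -> 0 < r -> 0 < s ->
  sqrt m / Rpower r alpha < sqrt n / Rpower s alpha <->
  ln m - 2 * alpha * ln r < ln n - 2 * alpha * ln s.
Proof.
  assert (E : forall m r, 0 < m -> 0 < r ->
    ln (sqrt m / Rpower r alpha) = (ln m - 2 * alpha * ln r) / 2).
  { intros m' r' Hm Hr. rewrite ln_div; [|apply sqrt_lt_R0, Hm|apply exp_pos].
    unfold Rpower. rewrite ln_exp.
    assert (Hs : ln m' = 2 * ln (sqrt m')).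
    { rewrite <- (sqrt_sqrt m') at 1 by lra.
      rewrite ln_mult by (apply sqrt_lt_R0, Hm). ring. }
    rewrite Hs. field. }
  intros Hm Hn Hr Hs.
  assert (P1 : 0 < sqrt m / Rpower r alpha)
    by (apply Rdiv_lt_0_compat; [apply sqrt_lt_R0, Hm | apply exp_pos]).
  assert (P2 : 0 < sqrt n / Rpower s alpha)
    by (apply Rdiv_lt_0_compat; [apply sqrt_lt_R0, Hn | apply exp_pos]).
  split; intros H.
  - apply (ln_increasing _ _ P1) in H. rewrite !E in H by assumption. lra.
  - apply ln_lt_inv; [exact P1|exact P2|]. rewrite !E by assumption. lra.
Qed.

(** * The minimum principle for the regular quotient *)

Definition is_holo (F : C -> C) : Prop := exists D, C1_holo F D.

Lemma is_holo_const (c : C) : is_holo (fun _ => c).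
Proof. eexists; apply C1_holo_const. Qed.

Lemma is_holo_plus (F G : C -> C) :
  is_holo F -> is_holo G -> is_holo (fun z => F z + G z)%C.
Proof. intros [D HD] [E HE]. eexists. apply C1_holo_plus; eassumption. Qed.

Lemma is_holo_mult (F G : C -> C) :
  is_holo F -> is_holo G -> is_holo (fun z => F z * G z)%C.
Proof. intros [D HD] [E HE]. eexists. apply C1_holo_mult; eassumption. Qed.

Lemma is_holo_inv (F : C -> C) :
  is_holo F -> (forall z, Cmod z < 1 -> F z <> 0) -> is_holo (fun z => / F z)%C.
Proof. intros [D HD] H. eexists. apply C1_holo_inv; eassumption. Qed.

Lemma is_holo_cps (a : nat -> R) : Rbar_le 1 (CV_radius a) -> is_holo (cps a).
Proof. intros H. eexists. apply C1_holo_cps, H. Qed.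

(* For [H = conj F G] in the complexified quaternions, [quot_num] is [H0 + i (I . (H1, H2, H3))] and
   [quot_den] is the norm form of [F]; as [re (I v) = - I . v], the real part of their quotient is
   that of the regular quotient at [x + I y]. *)
Definition quot_num (I : quat) (f0 f1 f2 f3 g0 g1 g2 g3 : C) : C :=
  (f0 * g0 + f1 * g1 + f2 * g2 + f3 * g3
   + Ci * (RtoC (imi I) * (f0 * g1 + RtoC (-1) * (f1 * g0) + RtoC (-1) * (f2 * g3) + f3 * g2)
         + RtoC (imj I) * (f0 * g2 + f1 * g3 + RtoC (-1) * (f2 * g0) + RtoC (-1) * (f3 * g1))
         + RtoC (imk I) * (f0 * g3 + RtoC (-1) * (f1 * g2) + f2 * g1 + RtoC (-1) * (f3 * g0))))%C.

Definition quot_den (f0 f1 f2 f3 : C) : C := (f0 * f0 + f1 * f1 + f2 * f2 + f3 * f3)%C.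

Lemma is_holo_quot_num (I : quat) (f0 f1 f2 f3 g0 g1 g2 g3 : C -> C) :
  is_holo f0 -> is_holo f1 -> is_holo f2 -> is_holo f3 ->
  is_holo g0 -> is_holo g1 -> is_holo g2 -> is_holo g3 ->
  is_holo (fun z => quot_num I (f0 z) (f1 z) (f2 z) (f3 z) (g0 z) (g1 z) (g2 z) (g3 z)).
Proof.
  intros. unfold quot_num.
  repeat first [assumption | apply is_holo_const
    | refine (is_holo_plus (fun z => _) (fun z => _) _ _)
    | refine (is_holo_mult (fun z => _) (fun z => _) _ _)].
Qed.

Lemma is_holo_quot_den (f0 f1 f2 f3 : C -> C) :
  is_holo f0 -> is_holo f1 -> is_holo f2 -> is_holo f3 ->
  is_holo (fun z => quot_den (f0 z) (f1 z) (f2 z) (f3 z)).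
Proof.
  intros. unfold quot_den.
  repeat first [assumption | apply is_holo_const
    | refine (is_holo_plus (fun z => _) (fun z => _) _ _)
    | refine (is_holo_mult (fun z => _) (fun z => _) _ _)].
Qed.

(** The numerator on the right is the image of [X + I Y] under [q -> re q - i re (I q)]. This map is
    complex linear for the left action of [R + I R], so division by [s + t I] on the left becomes
    division by the complex number [(s, t)]. *)
Lemma re_slice_quotient (I X Y : quat) (s t : R) : imag_unit I -> s ^ 2 + t ^ 2 <> 0 ->
  re (/ (slice_pt I s t) * (X + I * Y))%H
  = fst (((re X, re Y) + Ci * ((imi I * imi X + imj I * imj X + imk I * imk X)%R,
       (imi I * imi Y + imj I * imj Y + imk I * imk Y)%R)) / (s, t))%C.
Proof.
  intros HI Hst. rewrite qinv_eq, slice_pt_norm by exact HI.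
  apply imag_unit_iff in HI. destruct HI as [H0 H1].
  set (k := (/ (s ^ 2 + t ^ 2))%R).
  transitivity (k * (s * re X + t * re Y * (imi I ^ 2 + imj I ^ 2 + imk I ^ 2)
    - s * (imi I * imi Y + imj I * imj Y + imk I * imk Y)
    + t * (imi I * imi X + imj I * imj X + imk I * imk X))).
  - simpl. rewrite H0. ring.
  - rewrite H1. simpl. unfold Rdiv.
    replace (s * (s * 1) + t * (t * 1)) with (s ^ 2 + t ^ 2) by ring. fold k. ring.
Qed.

(** As the stems of the symmetrization are real, its value lies in [R + I R] and is the complex
    number [quot_den] placed on the slice. *)
Lemma slice_quotient_components (I B C B' C' : quat) (f0 f1 f2 f3 g0 g1 g2 g3 : Complex.C) :
  imag_unit I ->
  B = Quat (fst f0) (fst f1) (fst f2) (fst f3) -> C = Quat (snd f0) (snd f1) (snd f2) (snd f3) ->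
  B' = Quat (fst g0) (fst g1) (fst g2) (fst g3) -> C' = Quat (snd g0) (snd g1) (snd g2) (snd g3) ->
  ((qconj B * B - qconj C * C) + I * (qconj B * C + qconj C * B))%H <> 0%H ->
  quot_den f0 f1 f2 f3 <> 0 /\
  re (/ ((qconj B * B - qconj C * C) + I * (qconj B * C + qconj C * B))
      * ((qconj B * B' - qconj C * C') + I * (qconj B * C' + qconj C * B')))%H
  = fst (quot_num I f0 f1 f2 f3 g0 g1 g2 g3 / quot_den f0 f1 f2 f3)%C.
Proof.
  intros HI -> -> -> -> H0.
  set (N := quot_den f0 f1 f2 f3).
  match type of H0 with ?q <> _ => assert (E : q = slice_pt I (fst N) (snd N)) end.
  { unfold N, quot_den, slice_pt. qring. }
  rewrite E in H0 |- *.
  assert (HN : N <> RtoC 0).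
  { intros Hc. apply H0. rewrite Hc. unfold slice_pt. qring. }
  split; [exact HN|].
  rewrite re_slice_quotient; [|exact HI|apply C_neq_0_sqr, HN].
  rewrite <- surjective_pairing. do 2 f_equal.
  unfold quot_num. apply injective_projections; simpl; ring.
Qed.

Lemma cps_at_0 (u : nat -> R) : Rbar_le 1 (CV_radius u) -> cps u (RtoC 0) = RtoC (u O).
Proof.
  intros Hu. rewrite cps_shift; [ring|exact Hu|rewrite Cmod_0; lra].
Qed.

(** Numerator and denominator are both homogeneous of degree two, so the zeros of [f] and [g] at the
    origin cancel in the quotient. *)
Lemma quot_homogeneous (I : quat) (z f0 f1 f2 f3 g0 g1 g2 g3 : C) :
  z <> 0 -> quot_den f0 f1 f2 f3 <> 0 ->
  (quot_num I (z * f0) (z * f1) (z * f2) (z * f3) (z * g0) (z * g1) (z * g2) (z * g3)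
    / quot_den (z * f0) (z * f1) (z * f2) (z * f3)
   = quot_num I f0 f1 f2 f3 g0 g1 g2 g3 / quot_den f0 f1 f2 f3)%C.
Proof.
  intros Hz Hn.
  assert (E : quot_den (z * f0) (z * f1) (z * f2) (z * f3) = (z * z * quot_den f0 f1 f2 f3)%C)
    by (unfold quot_den; ring).
  assert (E' : quot_num I (z * f0) (z * f1) (z * f2) (z * f3) (z * g0) (z * g1) (z * g2) (z * g3)
    = (z * z * quot_num I f0 f1 f2 f3 g0 g1 g2 g3)%C) by (unfold quot_num; ring).
  rewrite E, E'. field. auto.
Qed.

Lemma shift_component (p : quat -> R) (a : nat -> quat) (z : C) :
  Rbar_le 1 (CV_radius (fun n => p (a n))) -> p (a O) = 0 -> Cmod z < 1 ->
  cps (fun n => p (a n)) z = (z * cps (fun n => p (a (S n))) z)%C.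
Proof.
  intros Hr H0 Hz. rewrite cps_shift, H0 by assumption. ring.
Qed.

(* The real part of [f^{-*} * g] on the slice of [I] is the real part of a function that is
   holomorphic across the origin, so the minimum principle makes the weak inequality strict. *)
Lemma reg_recip_mul_strict (f g : quat -> quat) (a : nat -> quat) (alpha : R) :
  has_expansion f a -> has_expansion g (fun n => qscal (INR n) (a n)) ->
  (forall q : quat, ball1 q -> (f q = 0%H <-> q = 0%H)) ->
  a O = 0%H -> a 1%nat = 1%H -> alpha < 1 ->
  (forall q, ball1 q -> q <> 0%H -> alpha <= re (reg_recip_mul f g q)) ->
  forall q, ball1 q -> q <> 0%H -> alpha < re (reg_recip_mul f g q).
Proof.
  intros Ha Hb Hf Ha0 Ha1 Halpha Hweak q Hq Hq0.
  destruct (to_slice_surj q Hq) as (I & w & HI & Hw & ->).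
  assert (Hw0 : w <> 0) by (intros Hc; apply Hq0, to_slice_eq_0; assumption).
  set (b := fun n => qscal (INR n) (a n)) in *.
  assert (Hb0 : b O = 0%H) by (unfold b; rewrite Ha0; qring).
  assert (Hb1 : b 1%nat = 1%H) by (unfold b; rewrite Ha1; qring).
  destruct (has_expansion_radius f a Ha) as (A0 & A1 & A2 & A3).
  destruct (has_expansion_radius g b Hb) as (B0 & B1 & B2 & B3).
  (* The shifted coefficients are those of the stems divided by [z]; with them the quotient extends
     across the origin. *)
  set (f0 := cps (fun n => re (a (S n)))). set (f1 := cps (fun n => imi (a (S n)))).
  set (f2 := cps (fun n => imj (a (S n)))). set (f3 := cps (fun n => imk (a (S n)))).
  set (g0 := cps (fun n => re (b (S n)))). set (g1 := cps (fun n => imi (b (S n)))).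
  set (g2 := cps (fun n => imj (b (S n)))). set (g3 := cps (fun n => imk (b (S n)))).
  set (num := fun z => quot_num I (f0 z) (f1 z) (f2 z) (f3 z) (g0 z) (g1 z) (g2 z) (g3 z)).
  set (den := fun z => quot_den (f0 z) (f1 z) (f2 z) (f3 z)).
  assert (Hval : forall z, Cmod z < 1 -> z <> 0 -> den z <> 0 /\
    re (reg_recip_mul f g (to_slice I z)) = fst (num z / den z)%C).
  { intros z Hz Hz0.
    assert (HS : reg_sym f (to_slice I z) <> 0%H) by (apply (reg_sym_neq_0 f a); assumption).
    unfold reg_recip_mul.
    rewrite (reg_sym_slice f a) in HS |- * by assumption.
    rewrite (reg_conj_mul_slice f g a b) by assumption.
    assert (EA : stem_re a z = Quat (fst (z * f0 z)%C) (fst (z * f1 z)%C) (fst (z * f2 z)%C) (fst (z * f3 z)%C)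
      /\ stem_im a z = Quat (snd (z * f0 z)%C) (snd (z * f1 z)%C) (snd (z * f2 z)%C) (snd (z * f3 z)%C)).
    { unfold stem_re, stem_im.
      rewrite (shift_component re a), (shift_component imi a), (shift_component imj a),
        (shift_component imk a) by (assumption || (rewrite Ha0; reflexivity)).
      split; reflexivity. }
    assert (EB : stem_re b z = Quat (fst (z * g0 z)%C) (fst (z * g1 z)%C) (fst (z * g2 z)%C) (fst (z * g3 z)%C)
      /\ stem_im b z = Quat (snd (z * g0 z)%C) (snd (z * g1 z)%C) (snd (z * g2 z)%C) (snd (z * g3 z)%C)).
    { unfold stem_re, stem_im.
      rewrite (shift_component re b), (shift_component imi b), (shift_component imj b),
        (shift_component imk b) by (assumption || (rewrite Hb0; reflexivity)).
      split; reflexivity. }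
    destruct (slice_quotient_components I _ _ _ _ _ _ _ _ _ _ _ _ HI
      (proj1 EA) (proj2 EA) (proj1 EB) (proj2 EB) HS) as [HN HE].
    assert (Hn : quot_den (f0 z) (f1 z) (f2 z) (f3 z) <> RtoC 0).
    { intros Hc. apply HN. transitivity (z * z * quot_den (f0 z) (f1 z) (f2 z) (f3 z))%C.
      - unfold quot_den. ring.
      - rewrite Hc. ring. }
    split; [exact Hn|].
    rewrite HE, quot_homogeneous by assumption. reflexivity. }
  (* At the origin only [a 1 = b 1 = 1] contributes, so the scalar components are 1 and the others
     vanish. *)
  assert (Hnum0 : num (RtoC 0) = RtoC 1 /\ den (RtoC 0) = RtoC 1).
  { unfold num, den, f0, f1, f2, f3, g0, g1, g2, g3.
    rewrite !cps_at_0 by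
      (first [apply (CV_radius_ge_1_shift (fun n => re (a n))) | apply (CV_radius_ge_1_shift (fun n => imi (a n)))
        | apply (CV_radius_ge_1_shift (fun n => imj (a n))) | apply (CV_radius_ge_1_shift (fun n => imk (a n)))
        | apply (CV_radius_ge_1_shift (fun n => re (b n))) | apply (CV_radius_ge_1_shift (fun n => imi (b n)))
        | apply (CV_radius_ge_1_shift (fun n => imj (b n))) | apply (CV_radius_ge_1_shift (fun n => imk (b n)))];
       assumption).
    rewrite Ha1, Hb1. unfold quot_num, quot_den. simpl re. simpl imi. simpl imj. simpl imk.
    split; ring. }
  destruct Hnum0 as [Hnum0 Hden0].
  assert (Hden : forall z, Cmod z < 1 -> den z <> 0).
  { intros z Hz. destruct (Ceq_dec z (RtoC 0)) as [->|Hz0].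
    - rewrite Hden0. apply C1_nz.
    - apply Hval; assumption. }
  assert (HH : is_holo (fun z => num z * / den z + RtoC (- alpha))%C).
  { apply (is_holo_plus (fun z => num z * / den z)%C); [|apply is_holo_const].
    apply (is_holo_mult num (fun z => / den z)%C).
    - apply is_holo_quot_num; apply is_holo_cps.
      + apply (CV_radius_ge_1_shift (fun n => re (a n))), A0.
      + apply (CV_radius_ge_1_shift (fun n => imi (a n))), A1.
      + apply (CV_radius_ge_1_shift (fun n => imj (a n))), A2.
      + apply (CV_radius_ge_1_shift (fun n => imk (a n))), A3.
      + apply (CV_radius_ge_1_shift (fun n => re (b n))), B0.
      + apply (CV_radius_ge_1_shift (fun n => imi (b n))), B1.
      + apply (CV_radius_ge_1_shift (fun n => imj (b n))), B2.
      + apply (CV_radius_ge_1_shift (fun n => imk (b n))), B3.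
    - apply is_holo_inv; [|exact Hden].
      apply is_holo_quot_den; apply is_holo_cps.
      + apply (CV_radius_ge_1_shift (fun n => re (a n))), A0.
      + apply (CV_radius_ge_1_shift (fun n => imi (a n))), A1.
      + apply (CV_radius_ge_1_shift (fun n => imj (a n))), A2.
      + apply (CV_radius_ge_1_shift (fun n => imk (a n))), A3. }
  destruct HH as [D HD].
  assert (Hre : forall c : C, fst (c + RtoC (- alpha))%C = fst c - alpha) by (intros; reflexivity).
  assert (H0 : fst (num (RtoC 0) * / den (RtoC 0))%C = 1).
  { rewrite Hnum0, Hden0, Cinv_r by apply C1_nz. reflexivity. }
  destruct (Hval w Hw Hw0) as [_ ->].
  (* Harnack's inequality is applied to the quotient minus [alpha]: the weak inequality makes its
     real part nonnegative, and at the origin it is [1 - alpha > 0]. *)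
  enough (0 < fst (num w * / den w + RtoC (- alpha))%C) by (rewrite Hre in H; unfold Cdiv; lra).
  apply (harnack _ D w HD); [|rewrite Hre, H0; lra|exact Hw].
  intros z Hz. rewrite Hre. destruct (Ceq_dec z (RtoC 0)) as [->|Hz0].
  - rewrite H0. lra.
  - destruct (Hval z Hz Hz0) as [_ HE].
    pose proof (Hweak (to_slice I z) (ball1_to_slice I z HI Hz)
      (fun Hc => Hz0 (proj1 (to_slice_eq_0 I z HI) Hc))) as Hz1.
    rewrite HE in Hz1. unfold Cdiv in Hz1. lra.
Qed.

(** * Equivalence of the three growth conditions *)

Theorem lemma3p7 (alpha : R) (f : quat -> quat)
  (alpha_lt1 : alpha < 1)
  (f_regular : slice_regular f)
  (f_zeros : forall q : quat, ball1 q -> (f q = 0%H <-> q = 0%H))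
  (f'_at_0 : slice_derive f 0%H = 1%H) :
  let cond1 := forall q : quat, ball1 q -> q <> 0%H ->
    re (/ f q * (q * slice_derive f q))%H > alpha in
  let cond2 := forall q : quat, ball1 q -> q <> 0%H ->
    re (reg_recip_mul f (fun p => (p * slice_derive f p)%H) q) > alpha in
  let cond3 := forall u : quat, sphere1 u ->
    let M := fun r : R => qnorm (f (qscal r u)) / Rpower r alpha in
    forall r s : R, 0 < r -> r < s -> s < 1 -> M r < M s in
  (cond1 <-> cond2) /\ (cond2 <-> cond3).
Proof.
  intros cond1 cond2 cond3.
  destruct (slice_regular_expansion f f_regular) as [a Ha].
  pose proof (has_expansion_mul_slice_derive f a f_regular Ha) as Hg.
  set (g := fun p => (p * slice_derive f p)%H) in *.
  assert (Ha0 : a O = 0%H).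
  { rewrite <- (proj1 (expansion_at_0 f a Ha)). apply f_zeros; [apply ball1_0|reflexivity]. }
  assert (Ha1 : a 1%nat = 1%H) by (rewrite <- (slice_derive_0 f a f_regular Ha); exact f'_at_0).
  (* An arbitrary property of the real part is allowed because both the strict inequality of (1) and
     the weak one derived from (3) have to be transferred. *)
  assert (pointwise_to_reg : forall P : R -> Prop,
    (forall q, ball1 q -> q <> 0%H -> P (re (/ f q * g q)%H)) ->
    forall q, ball1 q -> q <> 0%H -> P (re (reg_recip_mul f g q))).
  { intros P HP q Hq Hq0. destruct (to_slice_surj q Hq) as (I & z & HI & Hz & ->).
    assert (Hz0 : z <> 0) by (intros Hc; apply Hq0, to_slice_eq_0; assumption).
    destruct (reg_recip_mul_to_pointwise f g a _ I z Ha Hg f_zeros HI Hz Hz0) as (J & HJ & ->).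
    apply HP; [apply ball1_to_slice; assumption|].
    intros Hc. apply Hz0, (to_slice_eq_0 J z HJ), Hc. }
  assert (reg_to_pointwise : cond2 -> cond1).
  { intros H2 q Hq Hq0. destruct (to_slice_surj q Hq) as (J & z & HJ & Hz & ->).
    assert (Hz0 : z <> 0) by (intros Hc; apply Hq0, to_slice_eq_0; assumption).
    destruct (pointwise_to_reg_recip_mul f g a _ J z Ha Hg f_zeros HJ Hz Hz0) as (I & HI & E).
    change (re (/ f (to_slice J z) * g (to_slice J z))%H > alpha). rewrite <- E.
    apply H2; [apply ball1_to_slice; assumption|].
    intros Hc. apply Hz0, (to_slice_eq_0 I z HI), Hc. }
  assert (Hball : forall u r, sphere1 u -> 0 < r < 1 -> ball1 (qscal r u) /\ qscal r u <> 0%H).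
  { intros u r Hu Hr. unfold sphere1 in Hu.
    assert (E : qnorm (qscal r u) = r) by (rewrite qnorm_qscal, Hu, Rabs_right; lra).
    split; [unfold ball1; lra|]. intros Hc.
    pose proof (qnorm_sqr (qscal r u)) as E2. rewrite E, Hc in E2. unfold qnormsq in E2. simpl in E2. nra. }
  (* [L u] is twice the logarithm of [M]; by the positive factor [2 / r], its derivative has the
     sign of the excess over [alpha] in (1). *)
  set (L := fun u r => ln (qnormsq (f (qscal r u))) - 2 * alpha * ln r).
  assert (HL : forall u r, sphere1 u -> 0 < r < 1 ->
    is_derive (L u) r (2 / r * (re (/ f (qscal r u) * g (qscal r u))%H - alpha))).
  { intros u r Hu Hr. destruct (Hball u r Hu Hr) as [Hb H0].
    apply (is_derive_radial_log f g a); try assumption; [lra|].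
    intros Hc. apply H0, f_zeros; assumption. }
  assert (HML : forall u r s, sphere1 u -> 0 < r < 1 -> 0 < s < 1 ->
    (qnorm (f (qscal r u)) / Rpower r alpha < qnorm (f (qscal s u)) / Rpower s alpha
     <-> L u r < L u s)).
  { intros u r s Hu Hr Hs.
    destruct (Hball u r Hu Hr) as [Hb H0]. destruct (Hball u s Hu Hs) as [Hb' H0'].
    apply growth_lt_iff; try lra; apply qnormsq_pos; intros Hc;
      [apply H0 | apply H0']; apply f_zeros; assumption. }
  split; [split; [exact (pointwise_to_reg (fun x => x > alpha)) | exact reg_to_pointwise]|].
  split.
  - intros H2. apply reg_to_pointwise in H2.
    intros u Hu M r s Hr Hrs Hs. apply HML; [exact Hu|lra|lra|].
    destruct (MVT_gen (L u) r s (fun t => 2 / t * (re (/ f (qscal t u) * g (qscal t u))%H - alpha)))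
      as (c & Hc & E).
    + rewrite Rmin_left, Rmax_right by lra. intros t Ht. apply HL; [exact Hu|lra].
    + rewrite Rmin_left, Rmax_right by lra. intros t Ht.
      apply continuity_pt_filterlim, (ex_derive_continuous (L u)).
      eexists. apply HL; [exact Hu|lra].
    + rewrite Rmin_left, Rmax_right in Hc by lra.
      destruct (Hball u c Hu) as [Hb H0]; [lra|].
      pose proof (H2 _ Hb H0) as Hpos. fold (g (qscal c u)) in Hpos.
      assert (0 < 2 / c) by (apply Rdiv_lt_0_compat; lra).
      assert (0 < 2 / c * (re (/ f (qscal c u) * g (qscal c u))%H - alpha) * (s - r)).
      { apply Rmult_lt_0_compat; [apply Rmult_lt_0_compat|]; lra. }
      lra.
  - intros H3 q Hq Hq0.
    apply (reg_recip_mul_strict f g a alpha); try assumption.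
    apply (pointwise_to_reg (fun x => alpha <= x)).
    clear q Hq Hq0. intros q Hq Hq0.
    (* On the ray through [q], the growth of [L u] to the right of [r = |q|] makes its derivative at
       [r] nonnegative. *)
    set (r := qnorm q). set (u := qscal (/ r) q).
    assert (Hr : 0 < r).
    { apply qnormsq_pos in Hq0. apply sqrt_lt_R0. exact Hq0. }
    unfold ball1 in Hq. fold r in Hq.
    assert (Hu : sphere1 u).
    { unfold sphere1, u. rewrite qnorm_qscal. fold r.
      rewrite Rabs_right by (left; apply Rinv_0_lt_compat, Hr). apply Rinv_l. lra. }
    assert (Eq : qscal r u = q).
    { unfold u. clearbody r. apply quat_ext; simpl; field; lra. }
    pose proof (HL u r Hu (conj Hr Hq)) as HD. rewrite Eq in HD.
    apply is_derive_ge_0 with (b := 1) in HD; [|exact Hq|].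
    + assert (0 < 2 / r) by (apply Rdiv_lt_0_compat; lra).
      apply Rnot_lt_le. intros Hn.
      assert (2 / r * (alpha - re (/ f q * g q)%H) > 0) by (apply Rmult_lt_0_compat; lra).
      lra.
    + intros s Hs. left. apply HML; [exact Hu|lra|lra|]. apply H3; [exact Hu|lra|lra|lra].
Qed.
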